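(* Let $G$ be a unipotent algebraic $\mathbb{Z}$-group, $p$ a prime, and $\Delta\in\mathcal{L}(G)$ an arithmetic lattice in $G$. Then for any $(A,B)\in\mathfrak{U}(\Delta)$, $$\mathrm{c}(\overline{\Delta}, G(\mathbb{Z}_p)) = \left|\det(B)^2\det(A)^{-1}\right|_p^{-1}.$$
   Context: A unipotent algebraic $\mathbb{Z}$-group is a unipotent algebraic group $G$ defined over $\mathbb{Z}$. It is regarded as embedded as a closed subgroup of a group of lower-triangular unipotent matrices (Kolchin's theorem), and $G(R)$ denotes its group of $R$-points. For subgroups $A,B$ of a common group, $\mathrm{c}(A,B) := [A:A\cap B]\,[B:A\cap B]$. $\mathcal{L}(G)$ is the set of arithmetic lattices in $G$, i.e. subgroups of $G(\mathbb{R})$ commensurable with $G(\mathbb{Z})$ (finite $\mathrm{c}$); all of them lie in $G(\mathbb{Q})$. A bar or superscript ${}^-$ denotes closure in $G(\mathbb{Q}_p)$. Fix a Mal'cev basis $(x_1,\dots,x_n)$ of $G(\mathbb{Z})$: $1<\langle x_1\rangle<\langle x_1,x_2\rangle<\dots<\langle x_1,\dots,x_n\rangle=G(\mathbb{Z})$ is a central series with infinite cyclic successive quotients. Elements of $G(\mathbb{Q}_p)$ are identified with $p$-adic words $\mathbf{x}(\mathbf{a})=x_1^{a_1}\cdots x_n^{a_n}$, $\mathbf{a}\in\mathbb{Q}_p^n$ ($\mathbf{x}$ parametrizes $G(\mathbb{Z})$ when restricted to $\mathbb{Z}^n$). Let $G_i=\langle x_1^{r_1},\dots,x_i^{r_i}: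 r_1,\dots,r_i\in\mathbb{Q}_p\rangle$. For a closed subgroup $H\le G(\mathbb{Q}_p)$, an $n$-tuple $(h_1,\dots,h_n)$ of elements of $H$ is a good basis for $H$ if $\langle h_1,\dots,h_i\rangle^-=H\cap G_i$ for each $i=1,\dots,n$. $T_n(R)$ is the set of lower-triangular $n\times n$ matrices over $R$. For $\Delta\in\mathcal{L}(G)$, $\mathfrak{U}(\Delta)$ is the set of pairs $(A,B)$ with $A\in T_n(\mathbb{Q}_p)$, $B\in T_n(\mathbb{Z}_p)$, with rows $a_i$ and $b_i$ respectively, such that $(\mathbf{x}(a_1),\dots,\mathbf{x}(a_n))$ is a good basis for $\overline{\Delta}$ and $(\mathbf{x}(b_1),\dots,\mathbf{x}(b_n))$ is a good basis for $\overline{\Delta}\cap G(\mathbb{Z}_p)$. *)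

(* Defs.v *)
From HB Require Import structures.
From mathcomp Require Import all_boot all_order all_algebra.
From mathcomp Require Import all_classical all_reals all_analysis.
From mathcomp Require mpoly.

Set Implicit Arguments.
Unset Strict Implicit.
Unset Printing Implicit Defensive.
Import Order.TTheory GRing.Theory Num.Theory.

Local Open Scope classical_set_scope.
Local Open Scope ring_scope.

(** * The p-adic numbers *)

(* Z_p is the inverse limit of the rings Z/p^n.  The class modulo p^n is
   represented by its remainder [residue n]; the compatibility condition
   contains the bound [residue n < p ^ n]. *)
Record padic_int (p : nat) (p_pr : prime p) := PadicInt {
  residue :> nat -> nat;
  residueS : forall n, (residue n.+1 %% p ^ n)%N = residue n
}.

Section PadicInt.
Context (p : nat) (p_pr : prime p).
Local Notation Zp := (padic_int p_pr).
Implicit Types x y z : Zp.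

HB.instance Definition _ := gen_eqMixin Zp.
HB.instance Definition _ := gen_choiceMixin Zp.

Lemma padic_intP x y : (forall n, x n = y n) -> x = y.
Proof.
case: x y => [f hf] [g hg] /= /funext fg; subst g; congr PadicInt.
exact: Prop_irrelevance.
Qed.

Lemma residue_mod x m n : (m <= n)%N -> (x n %% p ^ m)%N = x m.
Proof.
elim: n => [|n IH]; first by rewrite leqn0 => /eqP->; rewrite -(residueS x 0) modn_mod.
rewrite leq_eqVlt => /predU1P[->|]; first by rewrite -(residueS x) modn_mod.
by rewrite ltnS => le_mn; rewrite -(IH le_mn) -(residueS x n) modn_dvdm// dvdn_exp2l.
Qed.

Lemma residue_id x n : (x n %% p ^ n)%N = x n.
Proof. exact: residue_mod. Qed.

Lemma residue_lt x n : (x n < p ^ n)%N.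
Proof. by rewrite -(residue_id x n) ltn_mod expn_gt0 prime_gt0. Qed.

Definition coherent (f : nat -> nat) := forall n, f n.+1 = f n %[mod p ^ n].

Lemma mk_padic_subproof f : coherent f ->
  forall n, ((f n.+1 %% p ^ n.+1) %% p ^ n)%N = (f n %% p ^ n)%N.
Proof. by move=> hf n; rewrite modn_dvdm ?hf// dvdn_exp2l. Qed.

Definition mk_padic f (hf : coherent f) : Zp :=
  PadicInt p_pr (mk_padic_subproof hf).

Lemma padic_nat_subproof k : coherent (fun=> k). Proof. by []. Qed.

Lemma padic_add_subproof x y : coherent (fun n => x n + y n)%N.
Proof. by move=> n; rewrite -modnDm !residueS. Qed.

Lemma padic_mul_subproof x y : coherent (fun n => x n * y n)%N.
Proof. by move=> n; rewrite -modnMm !residueS. Qed.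

Lemma padic_opp_subproof x : coherent (fun n => p ^ n - x n)%N.
Proof.
move=> n; apply/eqP; rewrite -(eqn_modDr (x n.+1)) subnK; last exact/ltnW/residue_lt.
rewrite -(modnDmr (_ - _)) residueS subnK; last exact/ltnW/residue_lt.
by rewrite modnn expnS modnMl.
Qed.

Definition padic_nat k := mk_padic (padic_nat_subproof k).
Definition padic_add x y := mk_padic (padic_add_subproof x y).
Definition padic_mul x y := mk_padic (padic_mul_subproof x y).
Definition padic_opp x := mk_padic (padic_opp_subproof x).

Fact padic_addA : associative padic_add.
Proof. by move=> x y z; apply: padic_intP => n /=; rewrite modnDml modnDmr addnA. Qed.
Fact padic_addC : commutative padic_add.
Proof. by move=> x y; apply: padic_intP => n /=; rewrite addnC. Qed.
Fact padic_add0 : left_id (padic_nat 0) padic_add.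
Proof. by move=> x; apply: padic_intP => n /=; rewrite mod0n add0n residue_id. Qed.
Fact padic_addN : left_inverse (padic_nat 0) padic_opp padic_add.
Proof.
move=> x; apply: padic_intP => n /=.
by rewrite modnDml subnK ?modnn ?mod0n//; exact/ltnW/residue_lt.
Qed.

HB.instance Definition _ :=
  GRing.isZmodule.Build Zp padic_addA padic_addC padic_add0 padic_addN.

Fact padic_mulA : associative padic_mul.
Proof. by move=> x y z; apply: padic_intP => n /=; rewrite modnMml modnMmr mulnA. Qed.
Fact padic_mulC : commutative padic_mul.
Proof. by move=> x y; apply: padic_intP => n /=; rewrite mulnC. Qed.
Fact padic_mul1 : left_id (padic_nat 1) padic_mul.
Proof. by move=> x; apply: padic_intP => n /=; rewrite modnMml mul1n residue_id. Qed.
Fact padic_mulD : left_distributive padic_mul padic_add.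
Proof.
by move=> x y z; apply: padic_intP => n /=; rewrite modnMml modnDml modnDmr mulnDl.
Qed.
Fact padic_1neq0 : padic_nat 1 != 0.
Proof.
apply/eqP => /(congr1 (fun z : Zp => z 1%N)) /=.
by rewrite expn1 modn_small ?prime_gt1// mod0n.
Qed.

HB.instance Definition _ := GRing.Zmodule_isComNzRing.Build Zp
  padic_mulA padic_mulC padic_mul1 padic_mulD padic_1neq0.

Definition padic_unit : pred Zp := fun x => `[< exists y, y * x = 1 >].
Definition padic_inv x : Zp := xget x [set y | y * x = 1].

Fact padic_mulVx : {in padic_unit, left_inverse 1 padic_inv *%R}.
Proof.
move=> x; rewrite unfold_in => /asboolP ux.
exact: (@xgetPex _ x [set y | y * x = 1]).
Qed.
Fact padic_unitP x y : y * x = 1 -> padic_unit x.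
Proof. by move=> yx; apply/asboolP; exists y. Qed.
Fact padic_inv_out : {in [predC padic_unit], padic_inv =1 id}.
Proof.
move=> x; rewrite inE unfold_in => /asboolPn ux; apply: xgetPN => y yx.
by apply: ux; exists y.
Qed.

HB.instance Definition _ := GRing.ComNzRing_hasMulInverse.Build Zp
  padic_mulVx padic_unitP padic_inv_out.

Lemma padic_neq0P x : x != 0 -> exists n, x n != 0%N.
Proof.
move=> x0; apply: contrapT => /forallNP x_eq0; case/eqP: x0; apply: padic_intP => n.
by rewrite [RHS]mod0n; apply/eqP/negbNE/negP/x_eq0.
Qed.

(* The p-adic valuation of a nonzero element; [0] on [0]. *)
Definition padic_val x : nat :=
  if pselect (exists n, x n.+1 != 0%N) is left nz then ex_minn nz else 0%N.

Lemma padic_valP x n : x != 0 -> (x n == 0)%N = (n <= padic_val x)%N.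
Proof.
move=> /padic_neq0P[m xm].
have x0 : x 0%N = 0%N by apply/eqP; rewrite -leqn0 -ltnS residue_lt.
rewrite /padic_val; case: pselect => [nz|[]]; last first.
  by case: m xm => [|m] xm; [rewrite x0 in xm | exists m].
case: ex_minnP => k xk kmin; apply/idP/idP => [/eqP xn|le_nk].
  rewrite leqNgt; apply/negP => lt_kn.
  by move: xk; rewrite -(residue_mod x lt_kn) xn mod0n.
case: n le_nk => [|n] lt_nk; first by rewrite x0.
by apply: contraLR lt_nk => xn; rewrite -leqNgt kmin.
Qed.

Lemma padic_logn x n : x != 0 -> (padic_val x < n)%N ->
  (0 < x n)%N /\ logn p (x n) = padic_val x.
Proof.
move=> x0 lt_vn; have xn0 : (0 < x n)%N by rewrite lt0n padic_valP// -ltnNge.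
split=> //; apply/eqP; rewrite eqn_leq.
rewrite -pfactor_dvdn// /dvdn (residue_mod x (ltnW lt_vn)) padic_valP// leqnn andbT.
by rewrite leqNgt -pfactor_dvdn// /dvdn (residue_mod x lt_vn) padic_valP// ltnn.
Qed.

Lemma padic_mulE x y n : x != 0 -> y != 0 ->
  ((x * y)%R n == 0)%N = (n <= padic_val x + padic_val y)%N.
Proof.
move=> x0 y0; pose N := maxn n (padic_val x + padic_val y).+1.
have ltx : (padic_val x < N)%N by rewrite leq_max ltnS leq_addr orbT.
have [xN lx] := padic_logn x0 ltx.
have lty : (padic_val y < N)%N by rewrite leq_max ltnS leq_addl orbT.
have [yN ly] := padic_logn y0 lty.
rewrite -(residue_mod (x * y) (leq_maxl n (padic_val x + padic_val y).+1)) -/N.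
rewrite [(x * y) N]/= modn_dvdm ?dvdn_exp2l ?leq_maxl//.
by rewrite -/(dvdn _ _) pfactor_dvdn ?muln_gt0 ?xN// lognM// lx ly.
Qed.

Fact padic_mulf_eq0 x y : x * y = 0 -> (x == 0) || (y == 0).
Proof.
move=> xy0; apply/norP => -[x0 y0].
have := padic_mulE (padic_val x + padic_val y).+1 x0 y0.
by rewrite xy0 ltnn [X in (X == _)]mod0n.
Qed.

HB.instance Definition _ := GRing.ComUnitRing_isIntegral.Build Zp padic_mulf_eq0.

Lemma padic_valM x y : x != 0 -> y != 0 ->
  padic_val (x * y) = (padic_val x + padic_val y)%N.
Proof.
move=> x0 y0; have xy0 : x * y != 0 by rewrite mulf_neq0.
have h n : (n <= padic_val (x * y)%R)%N = (n <= padic_val x + padic_val y)%N.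
  by rewrite -padic_valP// padic_mulE.
by apply/eqP; rewrite eqn_leq -h leqnn h leqnn.
Qed.

Lemma padic_valD x y : x != 0 -> y != 0 -> x + y != 0 ->
  (minn (padic_val x) (padic_val y) <= padic_val (x + y)%R)%N.
Proof.
move=> x0 y0 xy0; rewrite -padic_valP//.
set m := minn _ _; have /eqP xm : x m == 0%N by rewrite padic_valP// geq_minl.
have /eqP ym : y m == 0%N by rewrite padic_valP// geq_minr.
by rewrite [X in X == _]/= xm ym mod0n.
Qed.

Definition padic_int_norm x : rat :=
  if x == 0 then 0 else p%:R ^- padic_val x.

Let p_gt0 : 0 < p%:R :> rat. Proof. by rewrite ltr0n prime_gt0. Qed.

Lemma padic_int_norm_ge0 x : 0 <= padic_int_norm x.
Proof. by rewrite /padic_int_norm; case: ifP => // _; rewrite invr_ge0 exprn_ge0// ltW. Qed.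

Lemma padic_int_norm_eq0 x : (padic_int_norm x == 0) = (x == 0).
Proof.
rewrite /padic_int_norm; case: (eqVneq x 0) => [|_]; first by rewrite eqxx.
by rewrite invr_eq0 expf_eq0 gt_eqF// andbF.
Qed.

Lemma padic_int_normM x y : padic_int_norm (x * y) = padic_int_norm x * padic_int_norm y.
Proof.
rewrite /padic_int_norm mulf_eq0.
case: (eqVneq x 0) => [|x0] /=; first by rewrite mul0r.
case: (eqVneq y 0) => [|y0] /=; first by rewrite mulr0.
by rewrite padic_valM// exprD invfM.
Qed.

Lemma padic_int_normD x y :
  padic_int_norm (x + y) <= Num.max (padic_int_norm x) (padic_int_norm y).
Proof.
have [->|x0] := eqVneq x 0; first by rewrite add0r le_max lexx orbT.
have [->|y0] := eqVneq y 0; first by rewrite addr0 le_max lexx.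
have [->|xy0] := eqVneq (x + y) 0.
  by rewrite le_max {1}/padic_int_norm eqxx padic_int_norm_ge0.
have mon : {homo (fun k : nat => (p%:R : rat) ^- k) : m n / (m <= n)%N >-> n <= m}.
  move=> m n le_mn; rewrite lef_pV2 ?posrE ?exprn_gt0// ler_weXn2l//.
  by rewrite ler1n prime_gt0.
have := padic_valD x0 y0 xy0.
rewrite /padic_int_norm (negPf x0) (negPf y0) (negPf xy0) geq_min le_max.
by case/orP => /mon ->; rewrite ?orbT.
Qed.

Lemma padic_int_normN x : padic_int_norm (- x) = padic_int_norm x.
Proof.
have n1 : padic_int_norm (- 1) = 1.
  have /eqP := padic_int_normM (- 1) (- 1).
  have -> : padic_int_norm (- 1 * - 1) = 1.
    rewrite mulrNN mulr1; have /esym/eqP := padic_int_normM 1 1.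
    rewrite mulr1 -subr_eq0 -{3}[padic_int_norm 1]mulr1 -mulrBr mulf_eq0.
    by rewrite padic_int_norm_eq0 oner_eq0 subr_eq0 => /eqP.
  rewrite eq_sym -expr2 sqrf_eq1 => /orP[/eqP//|/eqP n1].
  by have := padic_int_norm_ge0 (- 1); rewrite n1 ler0N1.
by rewrite -mulN1r padic_int_normM n1 mul1r.
Qed.

End PadicInt.

Definition padic (p : nat) (p_pr : prime p) : Type := {fraction padic_int p_pr}.

Section Padic.
Context (p : nat) (p_pr : prime p).
Local Notation Zp := (padic_int p_pr).
Local Notation Qp := (padic p_pr).
Implicit Types x y z : Qp.

HB.instance Definition _ := GRing.Field.on Qp.

Definition padic_of_int : Zp -> Qp := @FracField.tofrac _.
HB.instance Definition _ := GRing.RMorphism.on padic_of_int.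

Definition padic_norm x : rat :=
  padic_int_norm (frac (repr x)).1 / padic_int_norm (frac (repr x)).2.

Lemma padic_fracE x :
  x = padic_of_int (frac (repr x)).1 / padic_of_int (frac (repr x)).2.
Proof.
set d := (frac _).2; have d0 : d != 0 by exact: denom_ratioP.
have D0 : padic_of_int d != 0 by rewrite /padic_of_int tofrac_eq0.
apply: (mulIf D0); rewrite divfK// /d.
rewrite -{1}[x]reprK; move: (repr x) => r.
rewrite /padic_of_int /GRing.mul /= !piE.
apply/eqmodP; rewrite /= FracField.equivfE /FracField.mulf.
rewrite !numden_Ratio ?mulf_neq0 ?oner_eq0 ?denom_ratioP//.
by rewrite !mulr1 mulrC.
Qed.

Lemma padic_ind (P : Qp -> Prop) :
  (forall a b : Zp, b != 0 -> P (padic_of_int a / padic_of_int b)) -> forall x, P x.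
Proof. by move=> h x; rewrite [x]padic_fracE; apply: h; exact: denom_ratioP. Qed.

Lemma padic_norm_frac (a b : Zp) : b != 0 ->
  padic_norm (padic_of_int a / padic_of_int b) = padic_int_norm a / padic_int_norm b.
Proof.
move=> b0; set x := _ / _; rewrite /padic_norm.
have d0 : (frac (repr x)).2 != 0 by exact: denom_ratioP.
have := padic_fracE x; move: (frac _).1 (frac _).2 d0 => n d d0 /eqP.
rewrite eqr_div ?/padic_of_int ?tofrac_eq0// -!tofracM tofrac_eq => /eqP adnb.
apply/eqP; rewrite eqr_div ?padic_int_norm_eq0// -!padic_int_normM.
by rewrite adnb.
Qed.

Lemma padic_norm_ge0 x : 0 <= padic_norm x.
Proof. by rewrite divr_ge0 ?padic_int_norm_ge0. Qed.

Lemma padic_norm_eq0 x : (padic_norm x == 0) = (x == 0).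
Proof.
elim/padic_ind: x => a b b0; rewrite padic_norm_frac//.
by rewrite !mulf_eq0 !invr_eq0 !padic_int_norm_eq0 /padic_of_int !tofrac_eq0.
Qed.

Lemma padic_normM x y : padic_norm (x * y) = padic_norm x * padic_norm y.
Proof.
elim/padic_ind: x => a b b0; elim/padic_ind: y => c d d0.
rewrite mulf_div -!rmorphM !padic_norm_frac ?mulf_neq0// !padic_int_normM.
by rewrite mulf_div.
Qed.

Lemma padic_normN x : padic_norm (- x) = padic_norm x.
Proof.
elim/padic_ind: x => a b b0.
by rewrite -mulNr -rmorphN !padic_norm_frac// padic_int_normN.
Qed.

Lemma padic_normD x y :
  padic_norm (x + y) <= Num.max (padic_norm x) (padic_norm y).
Proof.
elim/padic_ind: x => a b b0; elim/padic_ind: y => c d d0.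
rewrite addf_div ?/padic_of_int ?tofrac_eq0// -!rmorphM -rmorphD.
rewrite -/(padic_of_int _) -/(padic_of_int (b * d)) !padic_norm_frac ?mulf_neq0//.
have n_gt0 (z : Zp) : z != 0 -> 0 < padic_int_norm z.
  by move=> z0; rewrite lt_def padic_int_norm_eq0 z0 padic_int_norm_ge0.
rewrite ler_pdivrMr ?n_gt0 ?mulf_neq0//.
rewrite maxr_pMl ?padic_int_norm_ge0//.
apply: le_trans (padic_int_normD _ _) _.
rewrite !padic_int_normM.
rewrite mulrA divfK ?gt_eqF ?n_gt0// [X in _ <= Num.max _ X]mulrCA.
by rewrite divfK ?gt_eqF ?n_gt0// [X in _ <= Num.max _ X]mulrC.
Qed.

Definition padic_dist x y : rat := padic_norm (x - y).

Fact padic_distxx x : padic_dist x x = 0.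
Proof. by apply/eqP; rewrite /padic_dist subrr padic_norm_eq0. Qed.
Fact padic_dist_eq0 x y : padic_dist x y = 0 -> x = y.
Proof. by move/eqP; rewrite padic_norm_eq0 subr_eq0 => /eqP. Qed.
Fact padic_distC x y : padic_dist x y = padic_dist y x.
Proof. by rewrite /padic_dist -padic_normN opprB. Qed.
Fact padic_dist_triangle y x z : padic_dist x z <= padic_dist x y + padic_dist y z.
Proof.
rewrite /padic_dist -[x in X in X <= _](subrK y) -addrA.
apply: le_trans (padic_normD _ _) _.
by rewrite ge_max lerDl lerDr !padic_norm_ge0.
Qed.

HB.instance Definition _ := isMetric.Build rat Qp
  padic_distxx padic_dist_eq0 padic_distC padic_dist_triangle.

End Padic.

(** * Subgroups of matrix groups *)

Section MatrixGroups.
Context (S : comUnitRingType) (N : nat).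
Implicit Types (H K X : set 'M[S]_N) (g h : 'M[S]_N).

Definition is_subgroup H :=
  [/\ H `<=` [set g | g \in unitmx], H 1%:M,
      forall g h, H g -> H h -> H (g *m h) & forall g, H g -> H (invmx g)].

Definition generated X : set 'M[S]_N := smallest is_subgroup X.

Definition mxpowz g (k : int) : 'M[S]_N :=
  match k with Posz m => g ^+ m | Negz m => invmx g ^+ m.+1 end.

(* The quotient H / K is infinite cyclic: for some y in H, every element of H
   lies in y ^ k K for exactly one integer k. *)
Definition infinite_cyclic_quotient H K :=
  exists2 y, H y & forall g, H g -> exists! k : int, K (mxpowz y (- k) *m g).

Definition left_cosets H K : set (set 'M[S]_N) :=
  [set [set g *m k | k in K] | g in H].

(* [+oo] for a subgroup of infinite index *)
Definition index (R : realType) H K : \bar R := counting (left_cosets H K).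
Arguments index : clear implicits.

Definition comm_index (R : realType) H K : \bar R :=
  (index R H (H `&` K) * index R K (H `&` K))%E.

End MatrixGroups.
Arguments comm_index {S N} R H K.

(** * Unipotent algebraic groups over Z *)

Section Locus.
Context (N : nat) (E : set (mpoly.mpoly (N * N) int)) (S : comNzRingType).

Definition unitriangular (g : 'M[S]_N) :=
  is_trig_mx g && [forall i, g i i == 1].

(* The variables of the polynomials are the N * N matrix entries. *)
Definition unipotent_locus : set 'M[S]_N :=
  [set g | unitriangular g /\
     forall P, E P -> mpoly.mmap (intr : int -> S) (fun k => mxvec g ord0 k) P = 0].

End Locus.
Arguments unipotent_locus {N} E S _.

(* A Zariski closed subgroup, cut out by polynomials with integer
   coefficients, of the group of lower-triangular unipotent N x N matrices.
   The group condition bears on points over fields of characteristic 0 only;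
   it then also holds for points over their subrings, the inverse of a
   unitriangular matrix being polynomial in its entries. *)
Record unipotent_Zgroup := UnipotentZGroup {
  msize : nat;
  equations : set (mpoly.mpoly (msize * msize) int);
  points_subgroup : forall K : fieldType, [pchar K] =i pred0 ->
    is_subgroup (unipotent_locus equations K)
}.

Arguments equations : clear implicits.

Definition points (G : unipotent_Zgroup) (S : comNzRingType) : set 'M[S]_(msize G) :=
  unipotent_locus (equations G) S.
Arguments points : clear implicits.

Section Lattices.
Context (G : unipotent_Zgroup).
Local Notation N := (msize G).

Definition arithmetic_lattice (R : realType) (Delta : set 'M[R]_N) :=
  [/\ is_subgroup Delta, Delta `<=` points G R &
      (comm_index R Delta [set map_mx intr g | g in points G int] < +oo)%E].

Section MalcevBasis.
Context (n : nat) (x : 'I_n -> 'M[int]_N).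

Definition malcev_term (i : nat) : set 'M[int]_N :=
  generated [set x j | j in [set j : 'I_n | (j < i)%N]].

Definition malcev_basis :=
  [/\ malcev_term n = points G int,
      forall i, (i < n)%N -> forall g h, malcev_term i.+1 g -> points G int h ->
        malcev_term i (invmx g *m invmx h *m g *m h) &
      forall i, (i < n)%N ->
        infinite_cyclic_quotient (malcev_term i.+1) (malcev_term i)].

End MalcevBasis.

Section PadicPoints.
Context (p : nat) (p_pr : prime p).
Local Notation Zp := (padic_int p_pr).
Local Notation Qp := (padic p_pr).
Implicit Types (H X : set 'M[Qp]_N).

Definition Zp_points : set 'M[Qp]_N :=
  [set map_mx (@padic_of_int p p_pr) g | g in points G Zp].

Definition closure_in_G X : set 'M[Qp]_N := closure X `&` points G Qp.

(* An arithmetic lattice consists of rational matrices, which are viewed both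
   over R and over Qp. *)
Definition padic_closure (R : realType) (Delta : set 'M[R]_N) : set 'M[Qp]_N :=
  closure_in_G
    [set map_mx ratr g | g in [set g : 'M[rat]_N | Delta (map_mx ratr g)]].

Definition padic_binomial (a : Qp) (k : nat) : Qp :=
  (\prod_(j < k) (a - j%:R)) / k`!%:R.

(* The power g ^ a of a unipotent matrix, that is exp (a log g), by the
   binomial series; it stops since (g - 1) ^ N = 0. *)
Definition unipotent_power (g : 'M[Qp]_N) (a : Qp) : 'M[Qp]_N :=
  \sum_(k < N) padic_binomial a k *: (g - 1%:M) ^+ k.

Context (n : nat) (x : 'I_n -> 'M[int]_N).

Definition basis_power (i : 'I_n) (a : Qp) := unipotent_power (map_mx intr (x i)) a.

Definition padic_word (a : 'rV[Qp]_n) : 'M[Qp]_N :=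
  \prod_(i < n) basis_power i (a ord0 i).

Definition padic_filtration (i : 'I_n) : set 'M[Qp]_N :=
  generated [set g | exists2 j : 'I_n, (j <= i)%N & exists r, g = basis_power j r].

Definition good_basis H (h : 'I_n -> 'M[Qp]_N) :=
  (forall i, H (h i)) /\
  forall i : 'I_n,
    closure_in_G (generated [set h j | j in [set j : 'I_n | (j <= i)%N]])
    = H `&` padic_filtration i.

Definition good_pairs (R : realType) (Delta : set 'M[R]_N) :
    set ('M[Qp]_n * 'M[Zp]_n) :=
  [set AB | [/\ is_trig_mx AB.1, is_trig_mx AB.2,
    good_basis (padic_closure Delta) (fun i => padic_word (row i AB.1)) &
    good_basis (padic_closure Delta `&` Zp_points)
      (fun i => padic_word (map_mx (@padic_of_int p p_pr) (row i AB.2)))]].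

End PadicPoints.
End Lattices.

Arguments arithmetic_lattice G {R} Delta.
Arguments malcev_basis G {n} x.
Arguments padic_closure G {p} p_pr {R} Delta.
Arguments good_pairs G {p} p_pr {n} x {R} Delta.
Arguments Zp_points G {p} p_pr.

(* Main.v *)
(* Let alpha_i (x(a)) = a_i.  On G_i the coordinate alpha_i is a homomorphism with
   kernel G_(i-1), and a good basis (h_1, ..., h_n) of a closed subgroup H gives
   alpha_i (H cap G_i) = Z_p alpha_i (h_i).  Hence, if L <= H have good bases with
   diagonals (l_i) and (k_i), then [H : L] is the product of the |k_i / l_i|_p.
   This is applied to the intersection of cl(Delta) with G(Z_p), inside cl(Delta)
   and inside G(Z_p), for which alpha_i (G(Z_p) cap G_i) = Z_p.

   The coordinates are rational polynomials in the matrix entries.  By induction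
   on i, some polynomial vanishes on <x_1, ..., x_(i-1)> but not on all powers of
   x_i; finite differences of left translates make it invariant under
   <x_1, ..., x_(i-1)>, and finite differences of right translates by x_i then
   make it linear in the exponent of x_i.

   A rational polynomial that vanishes on G(Z) vanishes on G(Q_p), so that every
   point over Q_p is a word.  For every field K of characteristic 0 the logarithms
   of the points over K form a linear space, cut out by the same rational
   equations for all K.  If E(b) is an extension of E in K, replacing b by its
   conjugates (or by natural numbers, if b is transcendental) in sum_k b^k W_k and
   inverting a Vandermonde matrix shows that the W_k, which have entries in E, are
   logarithms of points; so the space is spanned by its rational elements.

   Finally G(Z_p) = x(Z_p^n): a point of G(Z_p) is close to a word with exponents
   in Z[1/p], whose entries lie in Z[1/p] and in Z_p, hence in Z. *)

From HB Require Import structures.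
Require Import Defs.
From mathcomp Require Import all_boot all_order all_algebra all_field.
From mathcomp Require Import all_classical all_reals all_analysis.
From mathcomp Require Import ring.

Set Implicit Arguments.
Unset Strict Implicit.
Unset Printing Implicit Defensive.
Import Order.TTheory GRing.Theory Num.Theory.

Local Open Scope classical_set_scope.
Local Open Scope ring_scope.


(** * Exponentials and powers of unipotent matrices *)

(** Two facts behind the overview need real work. The first is density: the definition of the group
    provides no rational point besides 1, and its equations are arbitrary polynomials. What helps is
    that a polynomial over a field of characteristic 0 that vanishes at all natural numbers is zero.
    The powers g^m of a point therefore force every exp(t log g) into the group, which makes the
    logarithms a linear space. The same test at natural exponents carries every rule for words from
    G(Z) to G(Q_p): the coordinates, the additivity of alpha_i on G_i, its behaviour under p-adic
    powers. The second fact is that the diagonals of A and B have no zero: since c is finite, some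
    power of each x_i lies in Delta, and it has a nonzero i-th coordinate. With diagonals (a_i) and
    (b_i), the two indices are then the products of the |a_i / b_i|_p and of the |1 / b_i|_p, and
    together they give the inverse of |det(B)^2 / det(A)|_p. *)

Section Char0.
Context (K : fieldType) (K0 : [pchar K] =i pred0).

Lemma natf_neq0_char0 k : (k.+1%:R : K) != 0.
Proof. by move/pcharf0P: K0 => ->. Qed.

Lemma natf_inj_char0 : injective (fun k : nat => k%:R : K).
Proof.
move=> i j; wlog ij : i j / (i <= j)%N => [H|] e.
  by case/orP: (leq_total i j) => /H; [apply | move=> /(_ (esym e))].
move/eqP: e; rewrite eq_sym -subr_eq0 -natrB//; move/pcharf0P: K0 => ->.
by rewrite subn_eq0 => ji; apply/eqP; rewrite eqn_leq ij.
Qed.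

Lemma intr_eq0_char0 (m : int) : ((m%:~R : K) == 0) = (m == 0).
Proof.
by case: m => k; rewrite ?NegzE ?mulrNz ?oppr_eq0 -pmulrn; move/pcharf0P: K0 => ->.
Qed.

Lemma intr_inj_char0 : injective (intr : int -> K).
Proof.
move=> a b /eqP; rewrite -subr_eq0 -mulrzBr intr_eq0_char0 subr_eq0.
by move/eqP.
Qed.

Lemma fact_neq0_char0 k : (k`!%:R : K) != 0.
Proof. by move/pcharf0P: K0 => ->; rewrite -lt0n fact_gt0. Qed.

Lemma poly_nat_eq0 (P : {poly K}) : (forall m : nat, P.[m%:R] = 0) -> P = 0.
Proof.
move=> H; apply/eqP; apply: contraT => P0.
pose s : seq K := [seq k%:R | k <- iota 0 (size P)].
have us : uniq s by rewrite map_inj_uniq ?iota_uniq//; exact: natf_inj_char0.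
have rs : all (root P) s by apply/allP => _ /mapP[k _ ->]; apply/eqP.
by have := max_poly_roots P0 rs us; rewrite size_map size_iota ltnn.
Qed.

(** Tests at multiples of [D] only, because the exponential of a rational matrix is known to be
    integral only at such multiples ([lie_rat_integral]). *)
Lemma poly_eventually_eq0 (P : {poly K}) D : (0 < D)%N ->
  (forall m : nat, P.[(D * m)%:R] = 0) -> P = 0.
Proof.
move=> D0 H; have /poly_nat_eq0 : forall m : nat, (P \Po (D%:R *: 'X)).[m%:R] = 0.
  by move=> m; rewrite horner_comp hornerZ hornerX -natrM H.
move/eqP; rewrite comp_poly2_eq0 => [/eqP//|].
rewrite size_scale ?size_polyX//; case: D D0 {H} => // D _; exact: natf_neq0_char0.
Qed.

Lemma poly_inv_nat_eq0 (P : {poly K}) :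
  (forall m : nat, P.[m.+1%:R^-1] = 0) -> P = 0.
Proof.
move=> H; apply/eqP; apply: contraT => P0.
pose s : seq K := [seq k.+1%:R^-1 | k <- iota 0 (size P)].
have us : uniq s.
  by rewrite map_inj_uniq ?iota_uniq// => i j /invr_inj /natf_inj_char0[].
have rs : all (root P) s by apply/allP => _ /mapP[k _ ->]; apply/eqP.
by have := max_poly_roots P0 rs us; rewrite size_map size_iota ltnn.
Qed.

End Char0.

Section StrictLower.
Context (R : comNzRingType) (N : nat).
Implicit Types X Y g : 'M[R]_N.

Definition strict_lower X := forall i j : 'I_N, (i <= j)%N -> X i j = 0.

Lemma strict_lower0 : strict_lower 0. Proof. by move=> i j _; rewrite mxE. Qed.

Lemma strict_lowerD X Y : strict_lower X -> strict_lower Y -> strict_lower (X + Y).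
Proof. by move=> hX hY i j ij; rewrite mxE hX// hY// addr0. Qed.

Lemma strict_lowerZ c X : strict_lower X -> strict_lower (c *: X).
Proof. by move=> hX i j ij; rewrite mxE hX// mulr0. Qed.

Lemma strict_lower_sum (I : Type) (r : seq I) (P : pred I) (f : I -> 'M[R]_N) :
  (forall i, P i -> strict_lower (f i)) -> strict_lower (\sum_(i <- r | P i) f i).
Proof.
by move=> h; apply: big_ind; [exact: strict_lower0 | exact: strict_lowerD |].
Qed.

Lemma strict_lowerM X Y : strict_lower X -> strict_lower Y -> strict_lower (X * Y).
Proof.
move=> hX hY i j ij; rewrite mxE big1// => k _.
have [ik|ki] := leqP i k; first by rewrite hX ?mul0r.
by rewrite hY ?mulr0// (leq_trans (ltnW ki)).
Qed.

Lemma strict_lowerX X k : strict_lower X -> strict_lower (X ^+ k.+1).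
Proof. by move=> hX; elim: k => [//|k IH]; rewrite exprS; apply: strict_lowerM. Qed.

Lemma strict_lower_expr X k (i j : 'I_N) : strict_lower X ->
  (i < j + k)%N -> (X ^+ k) i j = 0.
Proof.
move=> hX; elim: k i => [|k IH] i.
  rewrite addn0 => ij; rewrite expr0 mxE; case: eqP => // e.
  by rewrite e ltnn in ij.
move=> ij; rewrite exprS mxE big1// => l _.
have [il|li] := leqP i l; first by rewrite hX ?mul0r.
rewrite IH ?mulr0//; rewrite addnS ltnS in ij; exact: leq_trans ij.
Qed.

Lemma strict_lower_nilp X k : strict_lower X -> (N <= k)%N -> X ^+ k = 0.
Proof.
move=> hX Nk; apply/matrixP => i j; rewrite mxE strict_lower_expr//.
by rewrite (leq_trans (ltn_ord i))// (leq_trans Nk)// leq_addl.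
Qed.

End StrictLower.

Lemma exprZmx (R : comNzRingType) N c (A : 'M[R]_N) k :
  (c *: A) ^+ k = c ^+ k *: A ^+ k.
Proof.
elim: k => [|k IH]; first by rewrite !expr0 scale1r.
rewrite !exprS IH -[LHS]/((c *: A) *m (c ^+ k *: A ^+ k)).
by rewrite -scalemxAl -scalemxAr scalerA.
Qed.

Lemma strict_lower_map (R S : comNzRingType) (f : {rmorphism R -> S}) N (X : 'M[R]_N) :
  strict_lower X -> strict_lower (map_mx f X).
Proof. by move=> hX i j ij; rewrite mxE hX// rmorph0. Qed.

Section ExpLog.
Context (R : comUnitRingType) (N : nat).
Implicit Types X Y g : 'M[R]_N.

(** Defined over a unit ring rather than a field because it is also taken over [{poly K}], where the
    factorials are invertible. The truncation loses nothing when [X] is strictly lower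
    triangular. *)
Definition mxexp X : 'M[R]_N := \sum_(k < N) (k`!%:R)^-1 *: X ^+ k.

(* The logarithm of [1 + Y]. *)
Definition mxlog1 Y : 'M[R]_N := \sum_(k < N.-1) ((-1) ^+ k / k.+1%:R) *: Y ^+ k.+1.

Lemma mxlog1_strict_lower X : strict_lower X -> strict_lower (mxlog1 X).
Proof.
by move=> hX; apply: strict_lower_sum => i _; apply/strict_lowerZ/strict_lowerX.
Qed.

End ExpLog.

Lemma map_mxX_sq (R S : comNzRingType) (f : {rmorphism R -> S}) N (X : 'M[R]_N) k :
  map_mx f (X ^+ k) = map_mx f X ^+ k.
Proof. exact: rmorphXn. Qed.

Section ExpMap.
Context (R S : comUnitRingType) (f : {rmorphism R -> S}) (N : nat).
Hypothesis unitR : forall k, (k.+1%:R : R) \is a GRing.unit.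

Lemma fact_unit k : (k`!%:R : R) \is a GRing.unit.
Proof. by elim: k => [|k IH]; rewrite ?unitr1// factS natrM unitrM unitR. Qed.

Lemma map_mxexp (X : 'M[R]_N) : map_mx f (mxexp X) = mxexp (map_mx f X).
Proof.
rewrite /mxexp rmorph_sum/=; apply: eq_bigr => k _.
by rewrite map_mxZ map_mxX_sq rmorphV ?rmorph_nat// fact_unit.
Qed.

Lemma map_mxlog1 (X : 'M[R]_N) : map_mx f (mxlog1 X) = mxlog1 (map_mx f X).
Proof.
rewrite /mxlog1 rmorph_sum/=; apply: eq_bigr => k _.
rewrite map_mxZ map_mxX_sq rmorphM rmorphXn rmorphN1.
by rewrite rmorphV ?rmorph_nat// unitR.
Qed.
End ExpMap.

Section Power.
Context (K : fieldType).

Definition gbinom (a : K) (k : nat) : K := (\prod_(j < k) (a - j%:R)) / k`!%:R.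

Definition mxpower N (g : 'M[K]_N) (a : K) : 'M[K]_N :=
  \sum_(k < N) gbinom a k *: (g - 1) ^+ k.

Hypothesis K0 : [pchar K] =i pred0.

Lemma gbinom0 a : gbinom a 0 = 1.
Proof. by rewrite /gbinom big_ord0 fact0 divr1. Qed.

Lemma gbinomS a k : gbinom a k.+1 = (a - k%:R) / k.+1%:R * gbinom a k.
Proof.
rewrite /gbinom big_ord_recr /= factS natrM invfM.
by rewrite [_ * (a - _)]mulrC -!mulrA; congr (_ * _); rewrite mulrCA.
Qed.

Lemma gbinom_nat m k : gbinom m%:R k = 'C(m, k)%:R.
Proof.
elim: k => [|k IH]; first by rewrite gbinom0 bin0.
rewrite gbinomS IH mulrAC; apply: (canLR (mulfK (natf_neq0_char0 K0 k))).
have [km|mk] := leqP k m; last by rewrite !bin_small ?mul0r ?mulr0 // ltnW.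
by rewrite -natrB// -!natrM mulnC [in RHS]mulnC mul_bin_left mulnC.
Qed.

Section Truncated.
Variable M : nat.
Local Notation eqT k p q := (forall i, (i < k)%N -> (p : {poly K})`_i = (q : {poly K})`_i).

(** Truncations of the power series exp(tX), log(1 + X) / X, log(1 + X) and (1 + X)^t. *)
Let eT (t : K) : {poly K} := \poly_(k < M.+1) (t ^+ k / k`!%:R).
Let L1 : {poly K} := \poly_(k < M) ((-1) ^+ k / k.+1%:R).
Let L : {poly K} := 'X * L1.
Let bT (t : K) : {poly K} := \poly_(k < M.+1) gbinom t k.

(** A strictly lower triangular matrix of size M + 1 has its (M + 1)-st power zero, so every
    identity between matrix functions below reduces to a comparison of coefficients in degrees at
    most M. *)
Lemma horner_mx_trunc (Y : 'M[K]_M.+1) (p q : {poly K}) :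
  strict_lower Y -> eqT M.+1 p q -> horner_mx Y p = horner_mx Y q.
Proof.
move=> hY pq; rewrite -[p](poly_take_drop M.+1) -[q](poly_take_drop M.+1).
have -> : take_poly M.+1 p = take_poly M.+1 q.
  by apply/polyP => i; rewrite !coef_take_poly; case: ifP => // /pq.
by rewrite !rmorphD !rmorphM !rmorphXn /= horner_mx_X strict_lower_nilp// !mulr0.
Qed.

Lemma eqT_mul k (p q p' q' : {poly K}) :
  eqT k p p' -> eqT k q q' -> eqT k (p * q) (p' * q').
Proof.
move=> hp hq i ik; rewrite !coefM; apply: eq_bigr => j _.
rewrite hp ?hq//; first by rewrite (leq_ltn_trans (leq_subr _ _)).
by rewrite (leq_trans _ ik)// ltn_ord.
Qed.

Lemma eT_add s t : eqT M.+1 (eT s * eT t) (eT (s + t)).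
Proof.
move=> k kM; rewrite coefM coef_poly kM exprDn mulr_suml.
rewrite (reindex_inj rev_ord_inj) /=; apply: eq_bigr => j _; rewrite subSS.
have jk : (j <= k)%N by rewrite -ltnS.
rewrite subKn// !coef_poly (leq_ltn_trans jk kM) (leq_ltn_trans (leq_subr _ _) kM).
rewrite -mulr_natr.
have fj := fact_neq0_char0 K0 j; have fkj := fact_neq0_char0 K0 (k - j).
have fk := fact_neq0_char0 K0 k; move: fk; rewrite -(bin_fact jk) !natrM => fk.
have bk : ('C(k, j)%:R : K) != 0 by apply: contra_neq fk => ->; rewrite mul0r.
by field; rewrite bk fj fkj.
Qed.

(** Below the truncation, Q = exp(t log(1 + X)) satisfies (1 + X) Q' = t Q and Q(0) = 1. This
    determines its coefficients by the recursion [gbinomS] of the binomial coefficients. *)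
Lemma eT_log t : eqT M.+1 (eT t \Po L) (bT t).
Proof.
pose Q := eT t \Po L; have L0 : L.[0] = 0 by rewrite hornerM hornerX mul0r.
have dL : eqT M ((1 + 'X) * L^`()) 1.
  have LS j : (j < M)%N -> L`_j.+1 *+ j.+1 = (-1) ^+ j.
    by move=> jM; rewrite coefXM coef_poly /= jM -[LHS]mulr_natr divfK ?natf_neq0_char0.
  move=> i iM; rewrite mulrDl mul1r coefD coefXM coef1 coef_deriv LS//.
  case: i iM => [|i] iM /=; first by rewrite addr0.
  by rewrite coef_deriv LS ?(ltnW iM)// exprS mulN1r addNr.
(* The derivative of the truncated exponential misses one term, a multiple of X^M. After composition
   with [L], which is divisible by X, the defect only affects degrees from M on. *)
have dE : (eT t)^`() = t *: eT t - (t * (t ^+ M / M`!%:R)) *: 'X^M.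
  apply/polyP => i; rewrite coef_deriv coefB !coefZ !coef_poly coefXn ltnS.
  rewrite ltnS [(i <= M)%N]leq_eqVlt; have [->|iM] := eqVneq i M.
    by rewrite ltnn mul0rn mulr1 subrr.
  rewrite mulr0 subr0 /=; case: ifP => _; last by rewrite mulr0 mul0rn.
  rewrite factS natrM exprS -[LHS]mulr_natr.
  have := natf_neq0_char0 K0 i; have := fact_neq0_char0 K0 i => f1 f2.
  by field; rewrite f1 addrC natr1.
have LM i : (i < M)%N -> ('X^M \Po L)`_i = 0.
  by move=> iM; rewrite comp_Xn_poly exprMn coefXnM iM.
have dQ : eqT M ((1 + 'X) * Q^`()) (t *: Q).
  move=> i iM; rewrite deriv_comp mulrCA -[RHS]mulr1; rewrite -[1 in RHS]/1.
  have h : eqT M ((eT t)^`() \Po L) (t *: Q).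
    move=> k kM; rewrite dE comp_polyB !comp_polyZ coefB [X in _ - X]coefZ LM// mulr0 subr0.
    by [].
  by rewrite (eqT_mul h dL iM) !mulr1.
have step i : (i < M)%N -> Q`_i.+1 = (t - i%:R) / i.+1%:R * Q`_i.
  move=> iM; have := dQ i iM; rewrite mulrDl mul1r coefD coefXM coefZ !coef_deriv.
  have := natf_neq0_char0 K0 i => i0 e; apply: (mulIf i0).
  rewrite mulrAC divfK ?natf_neq0_char0// mulrBl.
  rewrite -e mulr_natr; case: i {iM i0 e} => [|i]; first by rewrite mul0r subr0 addr0.
  by rewrite mulr_natl addrK.
have Q0 : Q`_0 = 1.
  by rewrite -horner_coef0 horner_comp L0 horner_coef0 coef_poly fact0 expr0 divr1.
suff H i : (i <= M)%N -> Q`_i = gbinom t i.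
  by move=> i iM; rewrite coef_poly iM H.
elim: i => [|i IH] iM; first by rewrite Q0 gbinom0.
by rewrite step// IH ?gbinomS// ltnW.
Qed.

Lemma bT_nat m : eqT M.+1 (bT m%:R) ((1 + 'X) ^+ m).
Proof.
move=> i iM; rewrite coef_poly iM gbinom_nat exprDn coef_sum.
have E (j : 'I_m.+1) : ((1 ^+ (m - j) * 'X^j *+ 'C(m, j)) : {poly K})`_i = 
    ((i == j) * 'C(m, j))%:R.
  by rewrite expr1n mul1r coefMn coefXn -mulrnA.
under eq_bigr do rewrite E.
have [im|mi] := ltnP i m.+1.
  rewrite (bigD1 (Ordinal im)) //= eqxx mul1n big1 ?addr0// => j /negPf.
  by rewrite -val_eqE /= eq_sym => ->.
rewrite bin_small// big1// => j _; case: eqP => // e.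
by rewrite e leqNgt ltn_ord in mi.
Qed.

Lemma mxexp_horner (X : 'M[K]_M.+1) t : mxexp (t *: X) = horner_mx X (eT t).
Proof.
rewrite /mxexp /eT poly_def rmorph_sum /=; apply: eq_bigr => k _.
by rewrite linearZ /= rmorphXn /= horner_mx_X exprZn scalerA mulrC.
Qed.

Lemma mxlog1_horner (X : 'M[K]_M.+1) : mxlog1 X = horner_mx X L.
Proof.
rewrite /mxlog1 /L /L1 poly_def rmorphM rmorph_sum /= mulr_sumr.
apply: eq_bigr => k _.
by rewrite linearZ /= rmorphXn /= horner_mx_X -scalerAr exprS.
Qed.

Lemma mxpower_horner (X : 'M[K]_M.+1) t : mxpower (1 + X) t = horner_mx X (bT t).
Proof.
rewrite /mxpower /bT poly_def rmorph_sum /=; apply: eq_bigr => k _.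
by rewrite linearZ /= rmorphXn /= horner_mx_X addrAC subrr add0r.
Qed.

Lemma horner_mx_comp_poly (X : 'M[K]_M.+1) p q :
  horner_mx X (p \Po q) = horner_mx (horner_mx X q) p.
Proof.
elim/poly_ind: p => [|p c IH]; first by rewrite comp_poly0 !rmorph0.
rewrite comp_polyD comp_polyM comp_polyX comp_polyC !rmorphD !rmorphM /=.
by rewrite IH horner_mx_X !horner_mx_C.
Qed.

End Truncated.

Lemma mx0_eq (A B : 'M[K]_0) : A = B.
Proof. by apply/matrixP => -[]. Qed.

Lemma mxexpD N (X : 'M[K]_N) s t : strict_lower X ->
  mxexp ((s + t) *: X) = mxexp (s *: X) * mxexp (t *: X).
Proof.
case: N X => [|M] X hX; first exact: mx0_eq.
rewrite !mxexp_horner -rmorphM; apply: horner_mx_trunc => // i iM.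
by rewrite eT_add.
Qed.

Lemma mxexp_log N (X : 'M[K]_N) t : strict_lower X ->
  mxexp (t *: mxlog1 X) = mxpower (1 + X) t.
Proof.
case: N X => [|M] X hX; first exact: mx0_eq.
rewrite mxexp_horner mxlog1_horner -horner_mx_comp_poly mxpower_horner.
by apply: horner_mx_trunc => //; apply: eT_log.
Qed.

Lemma mxpower_nat N (g : 'M[K]_N) m : strict_lower (g - 1) -> mxpower g m%:R = g ^+ m.
Proof.
case: N g => [|M] g hX; first exact: mx0_eq.
rewrite -[g](subrK 1) addrC mxpower_horner (horner_mx_trunc hX (@bT_nat M m)).
by rewrite rmorphXn rmorphD /= horner_mx_X rmorph1.
Qed.

Lemma mxpower1 N (g : 'M[K]_N) : strict_lower (g - 1) -> mxpower g 1 = g.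
Proof. by move=> hg; rewrite -[1]/(1%:R) mxpower_nat// expr1. Qed.

Lemma mxpower_exp_log N (g : 'M[K]_N) t : strict_lower (g - 1) ->
  mxpower g t = mxexp (t *: mxlog1 (g - 1)).
Proof. by move=> hg; rewrite mxexp_log// addrC subrK. Qed.

Lemma mxexp_log1 N (g : 'M[K]_N) : strict_lower (g - 1) -> mxexp (mxlog1 (g - 1)) = g.
Proof. by move=> hg; rewrite -[mxlog1 _]scale1r -mxpower_exp_log// mxpower1. Qed.

Lemma mxpowerD N (g : 'M[K]_N) s t : strict_lower (g - 1) ->
  mxpower g (s + t) = mxpower g s * mxpower g t.
Proof.
by move=> hg; rewrite !mxpower_exp_log// mxexpD//; exact: mxlog1_strict_lower.
Qed.

Lemma mxpower0 N (g : 'M[K]_N) : mxpower g 0 = 1.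
Proof.
rewrite /mxpower; case: N g => [|M] g; first exact: mx0_eq.
rewrite big_ord_recl gbinom0 scale1r expr0 big1 ?addr0// => i _.
by rewrite /gbinom big_ord_recl subr0 !mul0r scale0r.
Qed.

Lemma mxexp_nat N (X : 'M[K]_N) m : strict_lower X -> mxexp (m%:R *: X) = mxexp X ^+ m.
Proof.
move=> hX; elim: m => [|m IH]; last by rewrite -natr1 mxexpD// IH scale1r exprSr.
rewrite scale0r expr0 /mxexp; case: N X hX  => [|M] X hX; first exact: mx0_eq.
by rewrite big_ord_recl expr0 fact0 invr1 scale1r big1 ?addr0// => i _; rewrite expr0n scaler0.
Qed.

End Power.

(** * Polynomial functions *)

Section PolyFun.
Context (K : fieldType).

(** In characteristic 0 this is the prime field, described by integers alone so that no morphism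
    from [rat] has to be chosen. *)
Definition ratset : set K := [set a | exists d, exists m : int, d.+1%:R * a = m%:~R].

(** Polynomial functions as functions on any type [T] with chosen coordinates [c]. Thus matrix
    entries, exponents of words and a single scalar are treated alike, and substitution is an
    induction ([polyfun_comp]). The constants are [ratset] for rational coefficients, and [setT]
    once some arguments are frozen. *)
Inductive polyfun (C : set K) (T I : Type) (c : I -> T -> K) : (T -> K) -> Prop :=
| polyfun_cst a : C a -> polyfun C c (fun=> a)
| polyfun_coord i : polyfun C c (c i)
| polyfunD f g : polyfun C c f -> polyfun C c g -> polyfun C c (fun t => f t + g t)
| polyfunM f g : polyfun C c f -> polyfun C c g -> polyfun C c (fun t => f t * g t).

Lemma ratset_int (m : int) : ratset m%:~R.
Proof. by exists 0%N, m; rewrite mul1r. Qed.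

Lemma ratset_nat (m : nat) : ratset m%:R.
Proof. exact: (ratset_int (Posz m)). Qed.

Lemma ratsetD a b : ratset a -> ratset b -> ratset (a + b).
Proof.
move=> [d [m hm]] [e [l hl]]; exists (d.+1 * e.+1).-1, (e.+1%:Z * m + d.+1%:Z * l).
rewrite prednK ?muln_gt0// natrM mulrDr rmorphD !rmorphM /= -hm -hl.
by rewrite !mulrA [e.+1%:~R * _]mulrC.
Qed.

Lemma ratsetM a b : ratset a -> ratset b -> ratset (a * b).
Proof.
move=> [d [m hm]] [e [l hl]]; exists (d.+1 * e.+1).-1, (m * l).
by rewrite prednK ?muln_gt0// natrM mulrACA hm hl rmorphM.
Qed.

Lemma polyfun_ratset T I (c : I -> T -> K) f t : polyfun ratset c f ->
  (forall i, ratset (c i t)) -> ratset (f t).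
Proof.
by move=> pf ct; elim: pf => // [g h _ + _|g h _ + _]; [exact: ratsetD|exact: ratsetM].
Qed.

Lemma polyfunW (C D : set K) T I (c : I -> T -> K) f :
  C `<=` D -> polyfun C c f -> polyfun D c f.
Proof.
move=> CD; elim=> [a /CD|i|g h _ + _|g h _ + _].
- exact: polyfun_cst.
- exact: polyfun_coord.
- exact: polyfunD.
- exact: polyfunM.
Qed.

Lemma polyfun_comp C T I (c : I -> T -> K) T' I' (c' : I' -> T' -> K)
    (phi : T' -> T) f :
  (forall i, polyfun C c' (fun t => c i (phi t))) -> polyfun C c f ->
  polyfun C c' (fun t => f (phi t)).
Proof.
move=> h; elim=> [a ca|i|g1 g2 _ h1 _ h2|g1 g2 _ h1 _ h2].
- exact: polyfun_cst.
- exact: h.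
- exact: polyfunD.
- exact: polyfunM.
Qed.

Hypothesis K0 : [pchar K] =i pred0.

Lemma ratsetV a : ratset a -> ratset a^-1.
Proof.
move=> [d [m hm]]; have [->|a0] := eqVneq a 0; first by rewrite invr0; exact: (ratset_nat 0).
have d0 := natf_neq0_char0 K0 d.
have E : d.+1%:R = m%:~R * a^-1 by rewrite -hm mulfK.
case: m => m in hm E *.
  case: m hm E => [|m] hm E; first by move/eqP: hm; rewrite mulf_eq0 (negPf d0) (negPf a0).
  by exists m, d.+1%:Z; rewrite -[RHS]/(d.+1%:R) E.
exists m, (- d.+1%:Z); rewrite rmorphN -[in RHS]/(d.+1%:R) /= -[(d.+1%:~R)]/(d.+1%:R) E NegzE rmorphN /=.
by rewrite mulNr opprK.
Qed.

Section Closure.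
Context (C : set K) (hC : ratset `<=` C) (T I : Type) (c : I -> T -> K).
Local Notation pf := (polyfun C c).

Lemma polyfun_rat a : ratset a -> pf (fun=> a). Proof. by move=> /hC; exact: polyfun_cst. Qed.
Lemma polyfun_nat m : pf (fun=> m%:R). Proof. exact/polyfun_rat/ratset_nat. Qed.
Lemma polyfun_int (m : int) : pf (fun=> m%:~R). Proof. exact/polyfun_rat/ratset_int. Qed.
Lemma polyfunB f g : pf f -> pf g -> pf (fun t => f t - g t).
Proof.
move=> hf hg; have -> : (fun t => f t - g t) = (fun t => f t + (-1)%:~R * g t).
  by apply/funext => t; rewrite mulN1r.
by apply: polyfunD => //; apply: polyfunM => //; exact: polyfun_int.
Qed.
Lemma polyfun_sum J (r : seq J) (P : pred J) (f : J -> T -> K) :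
  (forall j, P j -> pf (f j)) -> pf (fun t => \sum_(j <- r | P j) f j t).
Proof.
move=> h; elim: r => [|j r IH].
  have -> : (fun t => \sum_(j <- [::] | P j) f j t) = (fun=> 0%:R).
    by apply/funext => t; rewrite big_nil.
  exact: polyfun_nat.
have [Pj|Pj] := boolP (P j).
  have -> : (fun t => \sum_(j <- j :: r | P j) f j t) =
     (fun t => f j t + \sum_(j <- r | P j) f j t).
    by apply/funext => t; rewrite big_cons Pj.
  exact: polyfunD (h _ Pj) IH.
have -> // : (fun t => \sum_(j <- j :: r | P j) f j t) =
     (fun t => \sum_(j <- r | P j) f j t).
by apply/funext => t; rewrite big_cons (negPf Pj).
Qed.
Lemma polyfun_prod J (r : seq J) (f : J -> T -> K) :
  (forall j, pf (f j)) -> pf (fun t => \prod_(j <- r) f j t).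
Proof.
move=> h; elim: r => [|j r IH].
  have -> : (fun t => \prod_(j <- [::]) f j t) = (fun=> 1%:R).
    by apply/funext => t; rewrite big_nil.
  exact: polyfun_nat.
have -> : (fun t => \prod_(j <- j :: r) f j t) =
     (fun t => f j t * \prod_(j <- r) f j t).
  by apply/funext => t; rewrite big_cons.
exact: polyfunM (h _) IH.
Qed.

Definition polyfunmx N (M : T -> 'M[K]_N) := forall i j, pf (fun t => M t i j).

Lemma polyfunmx_ext N (M M' : T -> 'M[K]_N) : M =1 M' -> polyfunmx M -> polyfunmx M'.
Proof. by move=> /funext ->. Qed.

Lemma polyfunmx_cst N (A : 'M[K]_N) : (forall i j, C (A i j)) -> polyfunmx (fun=> A).
Proof. by move=> h i j; exact: polyfun_cst. Qed.

Lemma polyfunmx1 N : polyfunmx (fun=> 1 : 'M[K]_N).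
Proof.
move=> i j; apply: polyfun_rat; rewrite mxE; exact: ratset_nat.
Qed.

Lemma polyfunmxD N (A B : T -> 'M[K]_N) :
  polyfunmx A -> polyfunmx B -> polyfunmx (fun t => A t + B t).
Proof.
move=> hA hB i j; have -> : (fun t => (A t + B t) i j) = (fun t => A t i j + B t i j).
  by apply/funext => t; rewrite mxE.
exact: polyfunD.
Qed.

Lemma polyfunmxB N (A B : T -> 'M[K]_N) :
  polyfunmx A -> polyfunmx B -> polyfunmx (fun t => A t - B t).
Proof.
move=> hA hB i j; have -> : (fun t => (A t - B t) i j) = (fun t => A t i j - B t i j).
  by apply/funext => t; rewrite !mxE.
exact: polyfunB.
Qed.

Lemma polyfunmxM N (A B : T -> 'M[K]_N) :
  polyfunmx A -> polyfunmx B -> polyfunmx (fun t => A t * B t).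
Proof.
move=> hA hB i j; have -> : (fun t => (A t * B t) i j) = (fun t => \sum_k (A t i k * B t k j)).
  by apply/funext => t; rewrite !mxE.
by apply: polyfun_sum => k _; exact: polyfunM.
Qed.

Lemma polyfunmxZ N f (A : T -> 'M[K]_N) :
  pf f -> polyfunmx A -> polyfunmx (fun t => f t *: A t).
Proof.
move=> hf hA i j; have -> : (fun t => (f t *: A t) i j) = (fun t => f t * A t i j).
  by apply/funext => t; rewrite !mxE.
exact: polyfunM.
Qed.

Lemma polyfunmxX N (A : T -> 'M[K]_N) k :
  polyfunmx A -> polyfunmx (fun t => A t ^+ k).
Proof.
move=> hA; elim: k => [|k IH]; first exact: polyfunmx1.
apply: polyfunmx_ext (polyfunmxM hA IH) => t; by rewrite exprS.
Qed.

Lemma polyfunmx_sum N J (r : seq J) (A : J -> T -> 'M[K]_N) :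
  (forall j, polyfunmx (A j)) -> polyfunmx (fun t => \sum_(j <- r) A j t).
Proof.
move=> hA i j; have -> : (fun t => (\sum_(j <- r) A j t) i j) = (fun t => \sum_(k <- r) A k t i j).
  by apply/funext => t; rewrite summxE.
by apply: polyfun_sum => k _; exact: hA.
Qed.

Lemma polyfunmx_prod N J (r : seq J) (A : J -> T -> 'M[K]_N) :
  (forall j, polyfunmx (A j)) -> polyfunmx (fun t => \prod_(j <- r) A j t).
Proof.
move=> hA; elim: r => [|j r IH].
  by apply: polyfunmx_ext (@polyfunmx1 N) => t; rewrite big_nil.
by apply: polyfunmx_ext (polyfunmxM (hA j) IH) => t; rewrite big_cons.
Qed.

Lemma polyfun_gbinom f k : pf f -> pf (fun t => gbinom (f t) k).
Proof.
move=> hf; rewrite /gbinom; apply: polyfunM.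
  by apply: polyfun_prod => j; apply: polyfunB => //; exact: polyfun_nat.
by apply/polyfun_rat/ratsetV/ratset_nat.
Qed.

Lemma polyfunmx_power N f (A : T -> 'M[K]_N) :
  pf f -> polyfunmx A -> polyfunmx (fun t => mxpower (A t) (f t)).
Proof.
move=> hf hA; apply: polyfunmx_sum => k; apply: polyfunmxZ.
  exact: polyfun_gbinom.
by apply/polyfunmxX/polyfunmxB => //; exact: polyfunmx1.
Qed.

Lemma polyfunmx_exp N (A : T -> 'M[K]_N) :
  polyfunmx A -> polyfunmx (fun t => mxexp (A t)).
Proof.
move=> hA; apply: polyfunmx_sum => k; apply: polyfunmxZ.
  by apply/polyfun_rat/ratsetV/ratset_nat.
exact: polyfunmxX.
Qed.

End Closure.

(* The coordinates are the scalar itself ([None]) and arbitrary functions of the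
   parameter [y] ([Some u]). *)
Lemma polyfun_degree (Y : Type) (h : K * Y -> K) :
  polyfun setT (fun (i : option (Y -> K)) (z : K * Y) => if i is Some u then u z.2 else z.1) h ->
  exists d, forall y, exists2 Q : {poly K}, (size Q <= d)%N & forall t, h (t, y) = Q.[t].
Proof.
elim=> [a _|[u|]|f g _ [d hd] _ [e he]|f g _ [d hd] _ [e he]].
- by exists 1%N => y; exists a%:P => [|t]; rewrite ?size_polyC_leq1 ?hornerC.
- by exists 1%N => y; exists (u y)%:P => [|t]; rewrite ?size_polyC_leq1 ?hornerC.
- by exists 2%N => y; exists 'X => [|t]; rewrite ?size_polyX ?hornerX.
- exists (maxn d e) => y; have [P sP hP] := hd y; have [Q sQ hQ] := he y.
  exists (P + Q) => [|t]; last by rewrite hornerD hP hQ.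
  apply: leq_trans (size_polyD _ _) _.
  by rewrite geq_max !leq_max sP sQ orbT.
- exists (d + e)%N => y; have [P sP hP] := hd y; have [Q sQ hQ] := he y.
  exists (P * Q) => [|t]; last by rewrite hornerM hP hQ.
  apply: leq_trans (size_polyMleq _ _) _; apply: leq_trans (leq_pred _) _.
  exact: leq_add.
Qed.

Lemma polyfun1 (h : K -> K) : polyfun setT (fun (_ : unit) (t : K) => t) h ->
  exists Q : {poly K}, forall t, h t = Q.[t].
Proof.
move=> ph; have [|d /(_ tt) [Q _ hQ]] := @polyfun_degree unit (fun z => h z.1).
  by apply: polyfun_comp ph => i; exact: (polyfun_coord _ _ None).
by exists Q.
Qed.

(** The denominator [d.+1] is what allows [separating_function] to choose an exponent at which the
    coordinates are integers. *)
Lemma polyfun1_rat (h : K -> K) : polyfun ratset (fun (_ : unit) (t : K) => t) h ->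
  exists d, exists Q : {poly int}, forall t, d.+1%:R * h t = (map_poly intr Q).[t].
Proof.
elim=> [a [d [m e]]|_|f g _ [d [P hd]] _ [e [Q he]]|f g _ [d [P hd]] _ [e [Q he]]].
- by exists d, m%:P => t; rewrite e map_polyC hornerC.
- by exists 0%N, 'X => t; rewrite map_polyX hornerX mul1r.
- exists (d.+1 * e.+1).-1, (e.+1%:Z%:P * P + d.+1%:Z%:P * Q) => t.
  rewrite prednK ?muln_gt0// natrM mulrDr rmorphD !rmorphM hornerD !hornerM -hd -he.
  rewrite /= !map_polyC !hornerC !mulrA /=.
  by rewrite -[e.+1%:~R]/(e.+1%:R) -[d.+1%:~R]/(d.+1%:R) [e.+1%:R * _]mulrC.
- exists (d.+1 * e.+1).-1, (P * Q) => t.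
  by rewrite prednK ?muln_gt0// natrM mulrACA hd he rmorphM hornerM.
Qed.

(** The coordinates are released from the natural numbers one at a time: those in [s] are already
    arbitrary, and each new one gives a polynomial in one variable with infinitely many roots. *)
Lemma polyfun_nat_eq0 (J : finType) (f : (J -> K) -> K) :
  polyfun setT (fun j (a : J -> K) => a j) f ->
  (forall m : J -> nat, f (fun j => (m j)%:R) = 0) -> forall a, f a = 0.
Proof.
move=> pf f0 a.
suff H (s : seq J) : forall b : J -> K,
    (forall j, j \notin s -> exists m : nat, b j = m%:R) -> f b = 0.
  by apply: (H (enum J)) => j; rewrite mem_enum.
elim: s => [|j s IH] b hb.
  have /choice[m hm] : forall j, exists m : nat, b j = m%:R by move=> j; exact: hb.
  by have -> : b = (fun j => (m j)%:R) by exact/funext.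
pose upd (t : K) i := if i == j then t else b i.
have -> : b = upd (b j) by apply/funext => i; rewrite /upd; case: eqP => // ->.
have [|Q hQ] := @polyfun1 (fun t => f (upd t)).
  apply: polyfun_comp pf => i; rewrite /upd; case: (i == j).
    exact: (polyfun_coord _ _ tt).
  exact: polyfun_cst.
rewrite hQ; suff -> : Q = 0 by rewrite horner0.
apply: (poly_nat_eq0 K0) => m; rewrite -hQ; apply: IH => i ij.
rewrite /upd; have [_|nij] := eqVneq i j; first by exists m.
by apply: hb; rewrite inE negb_or nij.
Qed.

End PolyFun.
Arguments ratset : clear implicits.

(** * The Lie algebra of a unipotent group *)

Section Points.
Context (G : unipotent_Zgroup).
Local Notation N := (Defs.msize G).

Lemma unitriangularP (S : comNzRingType) M (g : 'M[S]_M) :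
  unitriangular g <-> strict_lower (g - 1).
Proof.
split=> [/andP[/is_trig_mxP tg /forallP dg] i j|h].
  rewrite leq_eqVlt !mxE => /predU1P[/val_inj ->|ij].
    by rewrite (eqP (dg j)) eqxx subrr.
  by rewrite tg// -val_eqE (ltn_eqF ij) subrr.
apply/andP; split; last first.
  apply/forallP => i; have := h i i (leqnn _); rewrite !mxE eqxx => /eqP.
  by rewrite subr_eq0.
apply/is_trig_mxP => i j ij; have := h i j (ltnW ij).
by rewrite !mxE -val_eqE (ltn_eqF ij) subr0.
Qed.

Lemma mmap_rmorph (S S' : comNzRingType) (f : {rmorphism S -> S'}) k (h : 'I_k -> S) P :
  f (mpoly.mmap (intr : int -> S) h P) = mpoly.mmap (intr : int -> S') (fun i => f (h i)) P.
Proof.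
rewrite /mpoly.mmap rmorph_sum; apply: eq_bigr => m _.
rewrite rmorphM rmorph_int /mpoly.mmap1 rmorph_prod; congr (_ * _).
by apply: eq_bigr => i _; rewrite rmorphXn.
Qed.

Lemma eq_mmap (S : comNzRingType) k (h h' : 'I_k -> S) P : h =1 h' ->
  mpoly.mmap (intr : int -> S) h P = mpoly.mmap (intr : int -> S) h' P.
Proof. by move=> /funext ->. Qed.

Lemma points_map (S S' : comNzRingType) (f : {rmorphism S -> S'}) g :
  points G S g -> points G S' (map_mx f g).
Proof.
move=> [/unitriangularP ug hg]; split.
  apply/unitriangularP; have -> : map_mx f g - 1 = map_mx f (g - 1).
    by rewrite map_mxB -(rmorph1 (map_mx f)).
  exact: strict_lower_map.
move=> P EP; rewrite -[RHS](rmorph0 f) -(hg P EP) mmap_rmorph.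
by apply: eq_mmap => k; rewrite -map_mxvec mxE.
Qed.

(** The equations have integer coefficients, so their values at [g] lie in [S], in the kernel of [f]
    and hence in that of [h]. This replaces the action of field automorphisms: with [S] a polynomial
    ring, [f] evaluates at an element and [h] at a conjugate. *)
Lemma points_transfer (S S1 S2 : comNzRingType) (f : {rmorphism S -> S1})
    (h : {rmorphism S -> S2}) g :
  (forall s, f s = 0 -> h s = 0) ->
  points G S1 (map_mx f g) -> points G S2 (map_mx h g).
Proof.
move=> fh [/unitriangularP ug hg]; split.
  apply/unitriangularP => i j ij; have := ug i j ij.
  rewrite -(rmorph1 (map_mx f)) -(rmorph1 (map_mx h)) -!map_mxB mxE => /fh.
  by move=> hh; rewrite mxE; exact: hh.
move=> P EP; have E (T : comNzRingType) (u : {rmorphism S -> T}) :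
    mpoly.mmap intr ((mxvec (map_mx u g)) ord0) P = u (mpoly.mmap intr (mxvec g ord0) P).
  by rewrite mmap_rmorph; apply: eq_mmap => k; rewrite -map_mxvec mxE.
by rewrite E; apply: fh; rewrite -E; exact: hg.
Qed.

Lemma points_map_inj (S S' : comNzRingType) (f : {rmorphism S -> S'}) g :
  injective f -> points G S' (map_mx f g) -> points G S g.
Proof.
move=> fI hg; have := @points_transfer _ _ _ f idfun g _ hg.
by rewrite map_mx_id//; apply=> s; rewrite -[X in _ = X](rmorph0 f) => /fI.
Qed.

Lemma points_strict (S : comNzRingType) g : points G S g -> strict_lower (g - 1).
Proof. by case=> /unitriangularP. Qed.

Section Field.
Context (K : fieldType) (K0 : [pchar K] =i pred0).

(** Points over [{poly K}] are polynomial curves in the group. The group law is available over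
    fields only, so a curve is tested at its values, over a set [P] large enough to detect zero
    polynomials. *)
Lemma points_poly (g : 'M[{poly K}]_N) (P : K -> Prop) :
  (forall Q : {poly K}, (forall t, P t -> Q.[t] = 0) -> Q = 0) ->
  (forall t, P t -> points G K (map_mx (horner_eval t) g)) -> points G {poly K} g.
Proof.
move=> hP hg; split.
  apply/unitriangularP => i j ij; apply: hP => t /hg /points_strict /(_ i j ij).
  rewrite -{1}(rmorph1 (map_mx (horner_eval t))) -map_mxB mxE; exact: id.
move=> Q EQ; apply: hP => t /hg [_ /(_ Q EQ)] e.
rewrite -[LHS]/(horner_eval t _) mmap_rmorph -[RHS]e; apply: eq_mmap => k.
by rewrite -map_mxvec mxE.
Qed.

Lemma points1 : points G K 1.
Proof. by have [_ h _ _] := points_subgroup G K0. Qed.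

Lemma pointsM g h : points G K g -> points G K h -> points G K (g * h).
Proof. by have [_ _ H _] := points_subgroup G K0; exact: H. Qed.

Lemma pointsV g : points G K g -> points G K (invmx g).
Proof. by have [_ _ _ H] := points_subgroup G K0; exact: H. Qed.

Lemma pointsX g m : points G K g -> points G K (g ^+ m).
Proof.
move=> hg; elim: m => [|m IH]; first exact: points1.
by rewrite exprS; exact: pointsM.
Qed.

Definition lie_points : set 'M[K]_N := [set X | strict_lower X /\ points G K (mxexp X)].

Lemma lie_points0 : lie_points 0.
Proof.
split; first exact: strict_lower0.
rewrite -(scale0r (0 : 'M[K]_N)) (mxexp_nat K0 0 (@strict_lower0 K N)); exact: points1.
Qed.

Let unitP k : (k.+1%:R : {poly K}) \is a GRing.unit.
Proof.
by rewrite -polyC_natr poly_unitE size_polyC (natf_neq0_char0 K0) coefC unitfE (natf_neq0_char0 K0).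
Qed.

Lemma horner_mxexp (X : 'M[{poly K}]_N) t :
  map_mx (horner_eval t) (mxexp X) = mxexp (map_mx (horner_eval t) X).
Proof. by apply: map_mxexp. Qed.

Lemma lie_points_poly (X : 'M[{poly K}]_N) (P : K -> Prop) :
  (forall Q : {poly K}, (forall t, P t -> Q.[t] = 0) -> Q = 0) ->
  (forall t, P t -> lie_points (map_mx (horner_eval t) X)) ->
  forall t, lie_points (map_mx (horner_eval t) X).
Proof.
move=> hP hX t; split.
  move=> i j ij; rewrite mxE; have -> : X i j = 0; last exact: rmorph0.
  by apply: hP => u /hX [/(_ i j ij)]; rewrite mxE.
rewrite -horner_mxexp; apply: points_map; apply: (points_poly hP) => u /hX [_].
by rewrite -horner_mxexp.
Qed.

Lemma map_horner_XZ (X : 'M[K]_N) t :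
  map_mx (horner_eval t) ('X *: map_mx polyC X) = t *: X.
Proof. by apply/matrixP => i j; rewrite !mxE /horner_eval hornerM hornerX hornerC. Qed.

Lemma lie_pointsZ c X : lie_points X -> lie_points (c *: X).
Proof.
move=> [sX gX]; rewrite -map_horner_XZ.
apply: (@lie_points_poly _ (fun t => exists m : nat, t = m%:R)).
  by move=> Q hQ; apply: (poly_nat_eq0 K0) => m; apply: hQ; exists m.
move=> _ [m ->]; rewrite map_horner_XZ; split; first exact: strict_lowerZ.
by rewrite mxexp_nat//; exact: pointsX.
Qed.

Lemma horner0_sum M (c : nat -> {poly K}) (f : nat -> 'M[{poly K}]_N) :
  map_mx (horner_eval 0) (\sum_(k < M.+1) c k *: ('X^k *: f k)) =
  (c 0%N).[0] *: map_mx (horner_eval 0) (f 0%N).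
Proof.
rewrite big_ord_recl map_mxD expr0 scale1r map_mxZ; apply/eqP.
rewrite -subr_eq0 addrAC subrr add0r; apply/eqP.
rewrite (raddf_sum (map_mx (horner_eval 0))) big1// => k _.
by apply/matrixP => i j; rewrite /= !mxE /= /horner_eval !hornerM hornerXn expr0n mul0r mulr0.
Qed.

(* With [mxexp ('X X) mxexp ('X Y) = 1 + 'X C] and [Z = log (1 + 'X C) / 'X],
   the group contains [mxexp Z(1/m)] for all [m > 0], hence also
   [mxexp Z(0) = mxexp (X + Y)]. *)
Lemma lie_pointsD X Y : lie_points X -> lie_points Y -> lie_points (X + Y).
Proof.
move=> hX hY; have [sX gX] := hX; have [sY gY] := hY.
pose q (X : 'M[K]_N) : 'M[{poly K}]_N :=
  \sum_(k < N.-1) ((k.+1)`!%:R)^-1 *: ('X^k *: map_mx polyC X ^+ k.+1).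
have q_strict U : strict_lower U -> strict_lower (q U).
  move=> sU; apply: strict_lower_sum => k _; do 2!apply: strict_lowerZ.
  exact/strict_lowerX/(strict_lower_map polyC).
have qE U : mxexp ('X *: map_mx polyC U) = 1 + 'X *: q U.
  rewrite /mxexp /q; case: (N) U => [|M] U; first by apply/matrixP => -[].
  rewrite big_ord_recl fact0 expr0 invr1 scale1r scaler_sumr; congr (_ + _).
  apply: eq_bigr => k _; rewrite exprZn lift0 exprS -scalerA.
  by rewrite [RHS]scalerA mulrC -scalerA.
pose C := q X + q Y + 'X *: (q X * q Y).
have CE : mxexp ('X *: map_mx polyC X) * mxexp ('X *: map_mx polyC Y) = 1 + 'X *: C.
  have hl c (A B : 'M[{poly K}]_N) : (c *: A) * B = c *: (A * B).
    exact/esym/scalemxAl.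
  have hr c (A B : 'M[{poly K}]_N) : A * (c *: B) = c *: (A * B).
    exact/esym/scalemxAr.
  rewrite !qE mulrDl mul1r mulrDr mulr1 hl hr.
  by rewrite /C !scalerDr -addrA; congr (_ + _); rewrite addrCA addrA.
have sC : strict_lower C.
  apply: strict_lowerD; first by apply: strict_lowerD; exact: q_strict.
  by apply/strict_lowerZ/strict_lowerM; exact: q_strict.
pose Z : 'M[{poly K}]_N := \sum_(k < N.-1) ((-1) ^+ k / k.+1%:R) *: ('X^k *: C ^+ k.+1).
have sZ : strict_lower Z.
  by apply: strict_lower_sum => k _; do 2!apply: strict_lowerZ; exact: strict_lowerX.
have ZE : 'X *: Z = mxlog1 ('X *: C).
  rewrite /mxlog1 /Z scaler_sumr; apply: eq_bigr => k _.
  by rewrite exprZmx !scalerA ['X^(k.+1)]exprS [in RHS]mulrCA mulrA.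
have ev0 : map_mx (horner_eval 0) Z = X + Y.
  (* For N at most 1 the sums that define [q] and [Z] are empty, but then every strictly lower
     triangular matrix is 0. *)
  have [N1|N1] := leqP N 1.
    apply/matrixP => i j; have ij : (i <= j)%N.
      by rewrite (leq_trans _ (leq0n j))// -ltnS (leq_trans (ltn_ord i)).
    by rewrite (strict_lowerD sX sY)// (strict_lower_map (horner_eval 0) sZ).
  have [M EM] : exists M, N.-1 = M.+1 by case: (N) N1 => [|[|M]]// _; exists M.
  have q0 U : map_mx (horner_eval 0) (q U) = U.
    rewrite /q EM (horner0_sum M (fun k => (k.+1)`!%:R^-1) (fun k => map_mx polyC U ^+ k.+1)).
    rewrite expr1 invr1 hornerC scale1r.
    by apply/matrixP => i j; rewrite !mxE /horner_eval hornerC.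
  rewrite /Z EM (horner0_sum M (fun k => (-1) ^+ k / k.+1%:R) (fun k => C ^+ k.+1)).
  rewrite expr0 div1r invr1 hornerC scale1r expr1 /C.
  have X0 : map_mx (horner_eval 0) ('X *: (q X * q Y)) = 0.
    by apply/matrixP => i j; rewrite !mxE /horner_eval hornerM hornerX mul0r.
  by rewrite !map_mxD !q0; rewrite [X in _ + X]X0 addr0.
rewrite -ev0; apply: (@lie_points_poly _ (fun t => exists m : nat, t = m.+1%:R^-1)).
  by move=> Q hQ; apply: (poly_inv_nat_eq0 K0) => m; apply: hQ; exists m.
move=> _ [m ->]; set u := m.+1%:R^-1; set W := map_mx _ Z.
have sW : strict_lower W by exact: strict_lower_map.
split=> //; have u0 : u * m.+1%:R = 1 by rewrite mulVf// natf_neq0_char0.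
(* With u = 1 / (m + 1), the matrix u Z(u) is the logarithm of exp(uX) exp(uY), so exp Z(u) is the
   (m + 1)-st power of a point. This is why the curve is tested at inverses of natural numbers. *)
have -> : W = m.+1%:R *: (u *: W) by rewrite scalerA mulrC u0 scale1r.
rewrite mxexp_nat//; last exact: strict_lowerZ.
apply: pointsX; have -> : u *: W = mxlog1 (map_mx (horner_eval u) (1 + 'X *: C) - 1).
  rewrite map_mxD (rmorph1 (map_mx (horner_eval u))) addrAC subrr add0r.
  rewrite -map_mxlog1// -ZE map_mxZ; congr (_ *: _).
  exact: (esym (hornerX u)).
rewrite mxexp_log1//; last first.
  rewrite map_mxD (rmorph1 (map_mx (horner_eval u))) addrAC subrr add0r.
  exact/strict_lower_map/strict_lowerZ.
rewrite -CE map_mxM; apply: pointsM; rewrite horner_mxexp map_horner_XZ.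
  by have [] := lie_pointsZ u hX.
by have [] := lie_pointsZ u hY.
Qed.

End Field.
End Points.
Arguments lie_points : clear implicits.

(** * Adjoining an element to a field *)

Lemma splitting_extension (F : fieldType) (q : {poly F}) : q != 0 ->
  exists (L : fieldType) (f : {rmorphism F -> L}) (c : L) (r : seq L),
    c != 0 /\ map_poly f q = c *: \prod_(z <- r) ('X - z%:P).
Proof.
have [m] := ubnP (size q); elim: m F q => // m IH F q sq q0.
have [q1|q1] := leqP (size q) 1.
  exists F, idfun, q`_0, [::]; rewrite big_nil map_poly_id// -mul_polyC mulr1.
  have e := size1_polyC q1; split=> //.
  by apply: contra_neq q0 => q00; rewrite e q00.
(* An irreducible factor is a nonconstant divisor of least size. *)
have [p [irr_p pq]] : exists p, irreducible_poly p /\ p %| q.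
  have ex : exists k, `[< exists p : {poly F}, [/\ (1 < size p)%N, p %| q & size p = k] >].
    by exists (size q); apply/asboolP; exists q; rewrite dvdpp.
  case: (ex_minnP ex) => k /asboolP[p [p1 pq sp]] kmin; exists p; split=> //.
  have p0 : p != 0 by rewrite -size_poly_gt0 (leq_trans _ p1).
  split=> // h h1 hp; have h0 : h != 0 by apply: contraTneq hp => ->; rewrite dvd0p.
  rewrite -dvdp_size_eqp// eqn_leq dvdp_leq//= sp kmin//; apply/asboolP; exists h.
  by rewrite (dvdp_trans hp pq) ltn_neqAle eq_sym h1 size_poly_gt0 h0.
have [L _ [z pz _]] := irredp_FAdjoin irr_p.
have /factor_theorem[q2 eq2] : root (map_poly (in_alg L) q) z.
  by rewrite root_factor_theorem (dvdp_trans _ (_ : map_poly (in_alg L) p %| _)) ?dvdp_map// -root_factor_theorem.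
have mq0 : map_poly (in_alg L) q != 0 by rewrite map_poly_eq0.
have q20 : q2 != 0 by apply: contra_neq mq0; rewrite eq2 => ->; rewrite mul0r.
have [|//|L2 [f [c [r [c0 e]]]]] := IH L q2.
  have := congr1 (fun p : {poly L} => size p) eq2; rewrite size_map_poly size_Mmonic ?monicXsubC//.
  rewrite size_XsubC addn2 /= => sq2; rewrite -ltnS -sq2; exact: sq.
exists L2, (f \o in_alg L), c, (f z :: r); split=> //.
rewrite map_poly_comp eq2 rmorphM /= e map_polyXsubC -scalerAl.
by rewrite big_cons [_ * \prod_(_ <- _) _]mulrC.
Qed.

Section Subfield.
Variables (F : fieldType) (S : {pred F}) (hS : divring_closed S).
HB.instance Definition _ := GRing.isDivringClosed.Build F S hS.
Record subf := Subf {subf_val : F; _ : subf_val \in S}.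
HB.instance Definition _ := [isSub for subf_val].
HB.instance Definition _ := [Choice of subf by <:].
HB.instance Definition _ := [SubChoice_isSubIntegralDomain of subf by <:].
HB.instance Definition _ := [SubIntegralDomain_isSubField of subf by <:].

Lemma subfield_exists : exists (E : fieldType) (f : {rmorphism E -> F}),
  (forall e, f e \in S) /\ (forall x, x \in S -> exists e, f e = x).
Proof.
exists subf, (val : {rmorphism subf -> F}); split; first exact: valP.
by move=> x xS; exists (Subf xS).
Qed.
End Subfield.

Section Adjoin.
Context (E F : fieldType) (iota : {rmorphism E -> F}) (b : F).

Definition adjoin_eval : {rmorphism {poly E} -> F} := horner_eval b \o map_poly iota.

Lemma adjoin_evalE p : adjoin_eval p = (map_poly iota p).[b]. Proof. by []. Qed.

(** The subfield of [F] generated by [b] and the image of [E]. *)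
Definition adjoin_frac : {pred F} := fun x =>
  `[< exists p q : {poly E}, adjoin_eval q != 0 /\ x = adjoin_eval p / adjoin_eval q >].

Lemma adjoin_frac_closed : divring_closed adjoin_frac.
Proof.
have one : adjoin_eval 1 = 1 := rmorph1 adjoin_eval.
split.
- by apply/asboolP; exists 1, 1; rewrite one oner_neq0 divr1.
- move=> _ _ /asboolP[p [q [q0 ->]]] /asboolP[p' [q' [q'0 ->]]].
  apply/asboolP; exists (p * q' - p' * q), (q * q').
  rewrite rmorphB !(rmorphM adjoin_eval) mulf_neq0//; split=> //.
  by rewrite -mulNr addf_div// mulNr.
- move=> _ _ /asboolP[p [q [q0 ->]]] /asboolP[p' [q' [q'0 ->]]].
  apply/asboolP; have [p'0|p'0] := eqVneq (adjoin_eval p') 0.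
    exists 0, 1; rewrite one oner_neq0; split=> //.
    by rewrite p'0 mul0r invr0 mulr0 (rmorph0 adjoin_eval) mul0r.
  exists (p * q'), (q * p').
  by rewrite !(rmorphM adjoin_eval) mulf_neq0// invf_div mulf_div.
Qed.

Lemma adjoin_exists : exists (E' : fieldType) (f : {rmorphism E' -> F}),
  [/\ forall e, exists p q : {poly E}, adjoin_eval q != 0 /\ f e = adjoin_eval p / adjoin_eval q,
      exists e, f e = b & forall e, exists e', f e' = iota e].
Proof.
have [E' [f [hf fS]]] := subfield_exists adjoin_frac_closed.
have one : adjoin_eval 1 = 1 := rmorph1 adjoin_eval.
exists E', f; split=> [e||e].
- by have /asboolP := hf e.
- apply: fS; apply/asboolP; exists 'X, 1.
  by rewrite one oner_neq0 divr1 adjoin_evalE map_polyX hornerX.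
- apply: fS; apply/asboolP; exists e%:P, 1.
  by rewrite one oner_neq0 divr1 adjoin_evalE map_polyC hornerC.
Qed.

(* Enough specializations of [E[b]]: evaluations at the naturals when [b] is
   transcendental over [E], and at the conjugates of [b] otherwise. *)
Lemma adjoin_conjugates D : [pchar F] =i pred0 ->
  exists (L : fieldType) (k : {rmorphism F -> L}) d (theta : 'I_d -> {rmorphism {poly E} -> L}),
  [/\ injective (fun j => theta j 'X), forall j e, theta j e%:P = k (iota e),
      forall j p, adjoin_eval p = 0 -> theta j p = 0
    & forall p : {poly E}, (size p <= D)%N -> exists2 p' : {poly E},
        (size p' <= d)%N & adjoin_eval p' = adjoin_eval p].
Proof.
move=> F0.
have [[mu [mu0 mub]]|trans] := pselect (exists mu : {poly E}, mu != 0 /\ adjoin_eval mu = 0); last first.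
  pose th (j : 'I_D) : {rmorphism {poly E} -> F} := horner_eval (j%:R : F) \o map_poly iota.
  have thE j p : th j p = (map_poly iota p).[j%:R] by [].
  exists F, idfun, D, th; split.
  - by move=> i j; rewrite !thE map_polyX !hornerX => /(natf_inj_char0 F0) /val_inj.
  - by move=> j e; rewrite thE map_polyC hornerC.
  - move=> j p pb; have [->|p0] := eqVneq p 0; first exact: rmorph0.
    by case: trans; exists p.
  - by move=> p sp; exists p.
have ex : exists m, `[< exists mu : {poly E}, [/\ mu != 0, adjoin_eval mu = 0 & size mu = m] >].
  by exists (size mu); apply/asboolP; exists mu.
move: mu mu0 mub => _ _ _; case: (ex_minnP ex) => m /asboolP[mu [mu0 mub sm]] mmin.
have minmu (p : {poly E}) : adjoin_eval p = 0 -> (size p < m)%N -> p = 0.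
  move=> pb pm; apply/eqP; apply: contraTT pm => p0; rewrite -leqNgt.
  by apply: mmin; apply/asboolP; exists p.
have m1 : (1 < m)%N.
  rewrite ltnNge -sm; apply/negP => /size1_polyC e; move: mub; rewrite e adjoin_evalE.
  rewrite map_polyC hornerC => /eqP; rewrite fmorph_eq0 => /eqP e0.
  by rewrite e e0 eqxx in mu0.
have dvdmu (p : {poly E}) : adjoin_eval p = 0 -> mu %| p.
  move=> pb; apply/eqP/minmu; last by rewrite -sm ltn_modp.
  move: pb; rewrite {1}(divp_eq p mu) (rmorphD adjoin_eval) (rmorphM adjoin_eval).
  by rewrite mub mulr0 add0r.
(* Let g be the gcd of [mu] and its derivative. Either mu / g or g vanishes at [b]. By minimality
   the first case forces g to be constant; in the second, g would be shorter than [mu], the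
   derivative being nonzero in characteristic 0. *)
have sep : separable_poly mu.
  rewrite unlock /coprimep; set g := gcdp _ _.
  have g0 : g != 0 by rewrite gcdp_eq0 (negPf mu0).
  have /eqP : adjoin_eval (mu %/ g) * adjoin_eval g = 0.
    by rewrite -(rmorphM adjoin_eval) divpK ?dvdp_gcdl.
  rewrite mulf_eq0 => /orP[/eqP h|/eqP h].
    rewrite eqn_leq size_poly_gt0 g0 andbT leqNgt; apply/negP => g1.
    have : mu %/ g = 0.
      apply: minmu => //; rewrite size_divp// sm ltn_subrL -subn1 subn_gt0 g1.
      exact: ltnW.
    by move/eqP; rewrite divp_eq0 (negPf mu0) (negPf g0) /= ltnNge dvdp_leq// dvdp_gcdl.
  have dmu : mu^`() != 0.
    rewrite -size_poly_gt0.
    have : mu^`()`_(m.-2) != 0.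
      have m2 : (m.-2.+1 = m.-1)%N by case: (m) m1 => [|[]].
      rewrite coef_deriv m2 -sm -mulr_natr mulf_neq0 ?lead_coef_eq0//.
      rewrite -(fmorph_eq0 iota) rmorph_nat; move/pcharf0P: F0 => ->.
      by rewrite sm -lt0n; case: (m) m1 => [|[]].
    by apply: contra_neqT; rewrite -leqNgt => /size_poly_leq0P ->; rewrite coef0.
  have := minmu _ h; rewrite (leq_ltn_trans (dvdp_leq dmu (dvdp_gcdr _ _)))//.
    by move=> /(_ isT) e; rewrite e eqxx in g0.
  by rewrite -sm lt_size_deriv.
have [L [k [c [r [c0 hr]]]]] : exists (L : fieldType) (k : {rmorphism F -> L}) (c : L) (r : seq L),
   c != 0 /\ map_poly k (map_poly iota mu) = c *: \prod_(z <- r) ('X - z%:P).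
  by apply: splitting_extension; rewrite map_poly_eq0.
have ur : uniq r.
  rewrite -separable_prod_XsubC; have : separable_poly (map_poly k (map_poly iota mu)).
    by rewrite !separable_map.
  by rewrite hr unlock derivZ coprimepZl// coprimepZr.
have sr : size r = m.-1.
  have := congr1 (fun p : {poly L} => size p) hr.
  by rewrite !size_map_poly size_scale// size_prod_XsubC sm => ->.
pose th (j : 'I_m.-1) : {rmorphism {poly E} -> L} := horner_eval (nth 0 r j) \o map_poly k \o map_poly iota.
have thE j p : th j p = (map_poly k (map_poly iota p)).[nth 0 r j] by [].
exists L, k, m.-1, th; split.
- move=> i j; rewrite !thE !map_polyX !hornerX => /eqP.
  by rewrite nth_uniq ?sr// => /eqP /val_inj.
- by move=> j e; rewrite thE !map_polyC hornerC.
- move=> j p /dvdmu /dvdpP[q ->]; rewrite thE !rmorphM hornerM /= hr hornerZ.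
  suff /rootP -> : root (\prod_(z <- r) ('X - z%:P)) r`_j by rewrite !mulr0.
  by rewrite root_prod_XsubC mem_nth// sr.
- move=> p _; exists (p %% mu).
    by rewrite -ltnS prednK ?(ltnW m1)// -sm ltn_modp.
  rewrite {2}(divp_eq p mu) (rmorphD adjoin_eval) (rmorphM adjoin_eval).
  by rewrite mub mulr0 add0r.
Qed.

End Adjoin.

Lemma interpolate_closed (K : fieldType) (V : lmodType K) (U : set V) d
    (theta : 'I_d -> K) (W : 'I_d -> V) :
  U 0 -> (forall u v, U u -> U v -> U (u + v)) -> (forall c u, U u -> U (c *: u)) ->
  injective theta -> (forall j, U (\sum_(k < d) theta j ^+ k *: W k)) -> forall k, U (W k).
Proof.
move=> U0 UD UZ ti hU k.
pose A := Vandermonde d (\row_j theta j).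
have uA : A \in unitmx.
  rewrite unitmxE det_Vandermonde unitfE; apply/prodf_neq0 => i _; apply/prodf_neq0 => j ij.
  rewrite !mxE subr_eq0; apply: contraTneq ij => /ti ->; by rewrite ltnn.
have -> : W k = \sum_j invmx A j k *: (\sum_(l < d) theta j ^+ l *: W l).
  under eq_bigr do rewrite scaler_sumr.
  rewrite exchange_big /= (bigD1 k) //= [X in _ + X]big1 => [|l lk].
    rewrite addr0; under eq_bigr do rewrite scalerA.
    rewrite -scaler_suml -[LHS]scale1r; congr (_ *: _).
    have := mulmxV uA => /matrixP /(_ k k); rewrite !mxE eqxx => e.
    rewrite -[LHS]/(true%:R) -e.
    by apply: eq_bigr => j _; rewrite !mxE mulrC.
  under eq_bigr do rewrite scalerA.
  rewrite -scaler_suml (_ : \sum_(i < d) _ = 0) ?scale0r//.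
  have := mulmxV uA => /matrixP /(_ l k); rewrite !mxE (negPf lk) => e.
  rewrite -[RHS]/(false%:R) -e.
  by apply: eq_bigr => j _; rewrite !mxE mulrC.
by apply: big_ind => // j _; exact: UZ.
Qed.

(** * Zariski density of the integral points *)

Definition mxentry (K : fieldType) N (ij : 'I_N * 'I_N) (g : 'M[K]_N) : K := g ij.1 ij.2.

Lemma pchar_rmorphism (E F : fieldType) (f : {rmorphism E -> F}) :
  [pchar F] =i pred0 -> [pchar E] =i pred0.
Proof. by move=> F0 k; rewrite -(fmorph_pchar f) F0. Qed.

Section Density.
Context (G : unipotent_Zgroup).
Local Notation N := (Defs.msize G).
Context (F : fieldType) (F0 : [pchar F] =i pred0) (rq : {rmorphism rat -> F}).

Lemma lie_transfer (S : comUnitRingType) (S1 S2 : fieldType) (f : {rmorphism S -> S1})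
    (h : {rmorphism S -> S2}) (P : 'M[S]_N) :
  (forall k, (k.+1%:R : S) \is a GRing.unit) ->
  (forall s, f s = 0 -> h s = 0) ->
  lie_points G S1 (map_mx f P) -> lie_points G S2 (map_mx h P).
Proof.
move=> uS fh [sP gP]; split.
  by move=> i j /(sP i j); rewrite !mxE => /fh.
by rewrite -map_mxexp//; apply: (points_transfer fh); rewrite map_mxexp.
Qed.

(** The [F]-span of the rational logarithms, built one summand at a time because
    [polyfun_points_eq0] frees the scalars [c] one at a time. *)
Inductive lie_span : 'M[F]_N -> Prop :=
| lie_span0 : lie_span 0
| lie_spanS X c W : lie_span X -> lie_points G rat W -> lie_span (X + c *: map_mx rq W).

Lemma lie_spanD X Y : lie_span X -> lie_span Y -> lie_span (X + Y).
Proof.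
move=> hX; elim=> [|Z c W _ IH hW]; first by rewrite addr0.
by rewrite addrA; exact: lie_spanS.
Qed.

Lemma lie_spanZ c X : lie_span X -> lie_span (c *: X).
Proof.
elim=> [|Z d W _ IH hW]; first by rewrite scaler0; exact: lie_span0.
by rewrite scalerDr scalerA; exact: lie_spanS.
Qed.

Lemma lie_span_sum (I : Type) (r : seq I) (f : I -> 'M[F]_N) :
  (forall i, lie_span (f i)) -> lie_span (\sum_(i <- r) f i).
Proof.
by move=> h; apply: big_ind => //; [exact: lie_span0 | exact: lie_spanD].
Qed.

(** The property that climbs the tower of extensions, from the rationals to a field containing all
    the entries of a given logarithm. *)
Definition lie_rational (E : fieldType) (f : {rmorphism E -> F}) :=
  forall X : 'M[E]_N, lie_points G F (map_mx f X) -> lie_span (map_mx f X).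

Lemma lie_rational_rat : lie_rational rq.
Proof.
move=> X hX; rewrite -[map_mx _ _]scale1r -[_ *: _]add0r; apply: lie_spanS.
  exact: lie_span0.
have := @lie_transfer rat F rat rq idfun X _ _ hX; rewrite map_mx_id//; apply.
  by move=> k; rewrite unitfE pnatr_eq0.
by move=> s /eqP; rewrite fmorph_eq0 => /eqP.
Qed.

Section Step.
Context (E : fieldType) (iota : {rmorphism E -> F}) (hE : lie_rational iota) (b : F).

Let unitE k : (k.+1%:R : {poly E}) \is a GRing.unit.
Proof.
have := natf_neq0_char0 (pchar_rmorphism iota F0) k.
by rewrite -polyC_natr poly_unitE size_polyC coefC unitfE => ->.
Qed.

Lemma lie_rational_poly (P : 'M[{poly E}]_N) :
  lie_points G F (map_mx (adjoin_eval iota b) P) -> lie_span (map_mx (adjoin_eval iota b) P).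
Proof.
move=> hP; pose D := \max_i \max_j size (P i j).
have sP i j : (size (P i j) <= D)%N.
  by rewrite (leq_trans _ (leq_bigmax i))// (leq_trans _ (leq_bigmax j)).
have [L [k [d [th [thI thC thb red]]]]] := adjoin_conjugates iota b D F0.
(* Each entry is replaced by one with the same value at [b] and with at most [d] coefficients, as
   many as there are specializations [th j]. *)
have /choice[Q hQ] : forall ij : 'I_N * 'I_N, exists q : {poly E},
    (size q <= d)%N /\ adjoin_eval iota b q = adjoin_eval iota b (P ij.1 ij.2).
  by move=> ij; have [q ? ?] := red _ (sP ij.1 ij.2); exists q.
pose P' := \matrix_(i, j) Q (i, j).
have PP' : map_mx (adjoin_eval iota b) P = map_mx (adjoin_eval iota b) P'.
  by apply/matrixP => i j; rewrite !mxE; have [_ /= ->] := hQ (i, j).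
pose W (l : 'I_d) : 'M[E]_N := \matrix_(i, j) (P' i j)`_l.
(* The expansion in powers of the variable is used twice: at [b] over [F], and at each conjugate
   over [L]. *)
have PW (S : fieldType) (f : {rmorphism {poly E} -> S}) (u : {rmorphism E -> S}) :
    (forall e, f e%:P = u e) -> map_mx f P' = \sum_(l < d) f 'X ^+ l *: map_mx u (W l).
  move=> fu; apply/matrixP => i j; rewrite summxE !mxE.
  have [sQ _] := hQ (i, j); rewrite -[Q (i, j)]coefK poly_def rmorph_sum /=.
  rewrite (big_ord_widen d (fun l => f ((Q (i, j))`_l *: 'X^l)) sQ) big_mkcond /=.
  apply: eq_bigr => l _; rewrite !mxE; case: ltnP => [_|sl].
    by rewrite -mul_polyC rmorphM rmorphXn /= fu mulrC.
  by rewrite nth_default// rmorph0 mulr0.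
rewrite PP' in hP *; rewrite (@PW F (adjoin_eval iota b) iota); last first.
  by move=> e; rewrite adjoin_evalE map_polyC hornerC.
apply: lie_span_sum => l; apply: lie_spanZ; apply: hE.
have L0 : [pchar L] =i pred0 by move=> q; rewrite (fmorph_pchar k) F0.
suff : lie_points G L (map_mx k (map_mx iota (W l))).
  move=> h; have := @lie_transfer F L F k idfun (map_mx iota (W l)) _ _ h.
  rewrite [map_mx idfun _]map_mx_id//; apply=> [m|s]; first by rewrite unitfE natf_neq0_char0.
  by move=> /eqP; rewrite fmorph_eq0 => /eqP.
move: l; apply: (@interpolate_closed L 'M[L]_N (lie_points G L) d (fun j => th j 'X)) => //.
- by rewrite -[0](scale0r 0); apply: lie_pointsZ => //; exact: lie_points0.
- by move=> X Y; exact: lie_pointsD.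
- by move=> c X; exact: lie_pointsZ.
(* The combination at a conjugate is the specialization of [P'] there; by [thb] it inherits every
   relation that holds at [b], so it is again the logarithm of a point. *)
move=> j; have -> : \sum_(l < d) th j 'X ^+ l *: map_mx k (map_mx iota (W l)) = map_mx (th j) P'.
  rewrite (@PW _ (th j) (k \o iota)); last by move=> e; rewrite thC.
  by apply: eq_bigr => l _; congr (_ *: _); apply/matrixP => a c; rewrite !mxE.
exact: (lie_transfer unitE (thb j) hP).
Qed.

(** Denominators are harmless because logarithms of points can be rescaled: multiplying by a common
    one reduces to polynomial entries. *)
Lemma lie_rational_frac (X : 'M[F]_N) :
  (forall i j, exists p q : {poly E},
    adjoin_eval iota b q != 0 /\ X i j = adjoin_eval iota b p / adjoin_eval iota b q) ->
  lie_points G F X -> lie_span X.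
Proof.
move=> hX lX; have /choice[pq hpq] : forall ij : 'I_N * 'I_N, exists pq : {poly E} * {poly E},
    adjoin_eval iota b pq.2 != 0 /\
    X ij.1 ij.2 = adjoin_eval iota b pq.1 / adjoin_eval iota b pq.2.
  by move=> ij; have [p [q h]] := hX ij.1 ij.2; exists (p, q).
pose Q := \prod_ij (pq ij).2.
have Q0 : adjoin_eval iota b Q != 0.
  by rewrite rmorph_prod prodf_seq_neq0; apply/allP => ij _; have [] := hpq ij.
pose P := \matrix_(i, j) ((pq (i, j)).1 * \prod_(ij | ij != (i, j)) (pq ij).2).
have PE : map_mx (adjoin_eval iota b) P = adjoin_eval iota b Q *: X.
  apply/matrixP => i j; rewrite !mxE; have [q0 /= e] := hpq (i, j).
  have -> : Q = (pq (i, j)).2 * \prod_(ij | ij != (i, j)) (pq ij).2.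
    by rewrite /Q (bigD1 (i, j)).
  rewrite [X i j]e /horner_eval !(rmorphM (map_poly iota)) !hornerM.
  move: q0; rewrite adjoin_evalE => q0; by field.
have -> : X = (adjoin_eval iota b Q)^-1 *: (adjoin_eval iota b Q *: X).
  by rewrite scalerA mulVf// scale1r.
apply: lie_spanZ; rewrite -PE; apply: lie_rational_poly; rewrite PE.
exact: lie_pointsZ.
Qed.

End Step.

Lemma lie_rational_tower (l : seq F) : exists (E : fieldType) (f : {rmorphism E -> F}),
  lie_rational f /\ (forall c, c \in l -> exists e, f e = c).
Proof.
elim: l => [|b l [E [f [hf hl]]]]; first by exists rat, rq; split=> //; exact: lie_rational_rat.
have [E' [f' [h1 h2 h3]]] := adjoin_exists f b; exists E', f'; split.
  move=> X; apply: (lie_rational_frac hf) => i j.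
  by rewrite mxE; exact: h1.
move=> c; rewrite inE => /predU1P[->//|/hl[e <-]]; exact: h3.
Qed.

Lemma lie_points_span X : lie_points G F X -> lie_span X.
Proof.
move=> hX; pose l := [seq X ij.1 ij.2 | ij <- enum [set: 'I_N * 'I_N]%SET].
have [E [f [hf hl]]] := lie_rational_tower l.
have /choice[Y hY] : forall ij : 'I_N * 'I_N, exists e, f e = X ij.1 ij.2.
  by move=> ij; apply: hl; apply/mapP; exists ij => //; rewrite mem_enum finset.in_setT.
have XE : X = map_mx f (\matrix_(i, j) Y (i, j)).
  by apply/matrixP => i j; rewrite !mxE hY.
by rewrite XE; apply: hf; rewrite -XE.
Qed.

Lemma lie_rat_integral (W : 'M[rat]_N) : lie_points G rat W ->
  exists2 M, (0 < M)%N & forall m, exists2 g, points G int g &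
    map_mx intr g = mxexp ((M * m)%:R *: W).
Proof.
move=> hW; pose D := (\prod_(ij : 'I_N * 'I_N) `|denq (W ij.1 ij.2)|)%N.
have D0 : (0 < D)%N by apply: prodn_gt0 => ij; rewrite absz_gt0 denq_neq0.
pose intmx (A : 'M[rat]_N) := exists A' : 'M[int]_N, map_mx intr A' = A.
have intmxP (A : 'M[rat]_N) : (forall i j, exists m : int, A i j = m%:~R) -> intmx A.
  move=> h; have /choice[a ha] : forall ij : 'I_N * 'I_N, exists m : int, A ij.1 ij.2 = m%:~R.
    by move=> ij; exact: h.
  by exists (\matrix_(i, j) a (i, j)); apply/matrixP => i j; rewrite !mxE -(ha (i, j)).
have intM (A B : 'M[rat]_N) : intmx A -> intmx B -> intmx (A * B).
  by move=> [A' <-] [B' <-]; exists (A' * B'); rewrite map_mxM.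
have intX (A : 'M[rat]_N) k : intmx A -> intmx (A ^+ k).
  by move=> [A' <-]; exists (A' ^+ k); exact: map_mxX_sq.
have intZ (m : int) (A : 'M[rat]_N) : intmx A -> intmx (m%:~R *: A).
  by move=> [A' <-]; exists (m *: A'); rewrite map_mxZ.
have intD (A B : 'M[rat]_N) : intmx A -> intmx B -> intmx (A + B).
  by move=> [A' <-] [B' <-]; exists (A' + B'); rewrite map_mxD.
have DW : intmx (D%:R *: W).
  apply: intmxP => i j; rewrite mxE /D (bigD1 (i, j)) //= natrM.
  exists ((\prod_(ij | ij != (i, j)) `|denq (W ij.1 ij.2)|)%N%:Z * numq (W i j)).
  rewrite rmorphM /= numqE -absz_denq -!pmulrn.
  by rewrite [_%:R * _%:R]mulrC -mulrA; congr (_ * _); rewrite mulrC.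
(* [D] clears the denominators of [W], and the factorial those of the exponential series: the k-th
   term becomes (N! m)^k / k! times (D W)^k. *)
exists (D * N`!)%N => [|m]; first by rewrite muln_gt0 D0 fact_gt0.
have [g hg] : intmx (mxexp ((D * N`! * m)%:R *: W)).
  rewrite /mxexp; apply: big_ind => //; first by exists 0; rewrite map_mx0.
  move=> k _; have -> : (D * N`! * m)%:R *: W = (N`! * m)%:R *: (D%:R *: W) :> 'M[rat]_N.
    by rewrite scalerA -natrM -mulnA mulnC.
  rewrite exprZmx scalerA; case: k => [[|k] kN] /=.
    by rewrite expr0 fact0 mulr1 invr1 scale1r; exact: intX.
  have /dvdnP[c hc] : (k.+1`! %| N`!)%N.
    by rewrite -(bin_fact (ltnW kN)) dvdn_mull// dvdn_mulr.
  have -> : (k.+1`!%:R)^-1 * (N`! * m)%:R ^+ k.+1 = (c * m * (N`! * m) ^ k)%N%:Z%:~R :> rat.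
    have f0 : (k.+1`!%:R : rat) != 0 by rewrite pnatr_eq0 -lt0n fact_gt0.
    apply: (canLR (mulKf f0)); rewrite -pmulrn -natrX -natrM expnS; congr _%:R.
    set e := ((N`! * m) ^ k)%N; rewrite hc; move: (k.+1`!) => f.
    by rewrite !mulnA [(c * f)%N]mulnC.
  exact/intZ/intX.
exists g => //; apply: (@points_map_inj _ _ _ (intr : {rmorphism int -> rat})).
  exact: intr_inj.
rewrite hg; have : lie_points G rat ((D * N`! * m)%:R *: W).
  by apply: (lie_pointsZ _ _ hW); exact: pchar_num.
by case.
Qed.

(** The logarithm of [g] is a combination of rational logarithms. Along each of them [s] is a
    polynomial in the scalar, so it suffices to let the scalars be natural numbers, and multiples of
    [M] in the last step, where the exponential is an integral point. *)
Theorem polyfun_points_eq0 (s : 'M[F]_N -> F) : polyfun (ratset F) (@mxentry F N) s ->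
  (forall g, points G int g -> s (map_mx intr g) = 0) -> forall g, points G F g -> s g = 0.
Proof.
move=> ps s0.
have Q0 : [pchar rat] =i pred0 by exact: pchar_num.
have ratT : ratset F `<=` setT by [].
have psT := polyfunW ratT ps.
have curve (A B : 'M[F]_N) : exists Q : {poly F}, forall t, s (mxexp (A + t *: B)) = Q.[t].
  apply: polyfun1; apply: (polyfun_comp _ psT) => -[i j].
  rewrite /mxentry /=; move: i j; apply: polyfunmx_exp => //.
  apply: polyfunmxD => //; first exact: polyfunmx_cst.
  apply: polyfunmxZ => //; first exact: (polyfun_coord _ _ tt).
  exact: polyfunmx_cst.
have base W : lie_points G rat W -> s (mxexp (map_mx rq W)) = 0.
  move=> hW; have [Q hQ] := curve 0 (map_mx rq W); have [M M0 hM] := lie_rat_integral hW.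
  have -> : map_mx rq W = 0 + 1 *: map_mx rq W by rewrite add0r scale1r.
  rewrite hQ; suff -> : Q = 0 by rewrite horner0.
  apply: (poly_eventually_eq0 F0 M0) => m.
  have [g gG eg] := hM m; rewrite -hQ add0r; apply: etrans (s0 _ gG); congr (s _).
  have -> : (M * m)%:R *: map_mx rq W = map_mx rq ((M * m)%:R *: W).
    by rewrite map_mxZ rmorph_nat.
  rewrite -map_mxexp => [|k]; last by rewrite unitfE pnatr_eq0.
  by rewrite -eg; apply/matrixP => i j; rewrite !mxE rmorph_int.
(* The rational offset [W] is quantified inside the induction, so that it can absorb natural
   multiples of [W']. *)
have span X : lie_span X -> forall W, lie_points G rat W -> s (mxexp (map_mx rq W + X)) = 0.
  elim=> [|Z c W' _ IH hW'] W hW; first by rewrite addr0; exact: base.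
  have [Q hQ] := curve (map_mx rq W + Z) (map_mx rq W').
  rewrite addrA hQ; suff -> : Q = 0 by rewrite horner0.
  apply: (poly_nat_eq0 F0) => m; rewrite -hQ addrAC.
  have -> : map_mx rq W + m%:R *: map_mx rq W' = map_mx rq (W + m%:R *: W').
    by rewrite map_mxD map_mxZ rmorph_nat.
  exact: (IH _ (lie_pointsD Q0 hW (lie_pointsZ Q0 _ hW'))).
move=> g gG; have sg := points_strict gG.
rewrite -(mxexp_log1 F0 sg) -[mxlog1 _]add0r -(map_mx0 rq); apply: span.
  apply: lie_points_span; split; first exact: mxlog1_strict_lower.
  by rewrite mxexp_log1.
exact: lie_points0.
Qed.

End Density.

(** * The Malcev filtration *)

Section Groups.
Context (S : comUnitRingType) (N : nat).
Implicit Types (H X : set 'M[S]_N).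

Lemma generated_subgroup H X : is_subgroup H -> X `<=` H -> is_subgroup (generated X).
Proof.
move=> hH XH; split.
- by move=> g /(_ H (conj hH XH)); have [hu _ _ _] := hH; exact: hu.
- by move=> K [[_ ? _ _] _].
- by move=> g h hg hh K [sK XK]; have [_ _ kM _] := sK; apply: kM; [exact: hg|exact: hh].
- by move=> g hg K [sK XK]; have [_ _ _ kV] := sK; apply: kV; exact: hg.
Qed.

Lemma sub_generated X : X `<=` generated X.
Proof. by move=> g Xg H [_]; apply. Qed.

Lemma generated_sub H X : is_subgroup H -> X `<=` H -> generated X `<=` H.
Proof. by move=> hH XH g; apply. Qed.

Lemma generatedS X Y : X `<=` Y -> generated X `<=` generated Y.
Proof. by move=> XY g hg H [sH YH]; apply: hg; split=> // h /XY /YH. Qed.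

Lemma invmx_eq (A B : 'M[S]_N) : A *m B = 1%:M -> B = invmx A.
Proof.
move=> AB; have [uA _] := mulmx1_unit AB.
by rewrite -[B]mul1mx -(mulVmx uA) -mulmxA AB mulmx1.
Qed.

Lemma strict_lower_unit (g : 'M[S]_N) : strict_lower (g - 1) -> g \in unitmx.
Proof.
move=> /unitriangularP /andP[tg /forallP dg]; rewrite unitmxE det_trig//.
by rewrite big1 ?unitr1// => i _; rewrite (eqP (dg i)).
Qed.

Lemma subgroupX H g k : is_subgroup H -> H g -> H (g ^+ k).
Proof.
move=> [_ H1 HM _] Hg; elim: k => [|k IH]; first exact: H1.
by rewrite exprS; exact: HM.
Qed.

Lemma subgroup_powz H g m : is_subgroup H -> H g -> H (mxpowz g m).
Proof.
move=> sH Hg; have [_ _ _ HV] := sH; case: m => k; first exact: subgroupX.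
exact: (subgroupX k.+1 sH (HV _ Hg)).
Qed.

End Groups.

Lemma map_mx_inv (R S : comUnitRingType) (f : {rmorphism R -> S}) N (g : 'M[R]_N) :
  g \in unitmx -> map_mx f (invmx g) = invmx (map_mx f g).
Proof. by move=> ug; apply: invmx_eq; rewrite -map_mxM mulmxV// map_mx1. Qed.

Section PowZ.
Context (K : fieldType) (K0 : [pchar K] =i pred0) (N : nat) (g : 'M[K]_N).
Hypothesis sg : strict_lower (g - 1).

Lemma mxpowerN a : mxpower g (- a) = invmx (mxpower g a).
Proof. by apply: invmx_eq; rewrite -[LHS]/(mxpower g a * mxpower g (- a)) -mxpowerD// subrr mxpower0. Qed.

Lemma invmx_power : invmx g = mxpower g (- 1).
Proof. by rewrite mxpowerN mxpower1. Qed.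

Lemma mxpowz_power m : mxpowz g m = mxpower g m%:~R.
Proof.
case: m => k; first by rewrite -pmulrn mxpower_nat.
have ug := strict_lower_unit sg.
rewrite {2}NegzE mulrNz mxpowerN -pmulrn mxpower_nat// /mxpowz.
apply: invmx_eq; elim: (k.+1) => [|j IH]; first by rewrite !expr0 mulmx1.
rewrite [in X in _ *m X]exprS exprSr -[g ^+ j * g]/(g ^+ j *m g).
rewrite -[invmx g * _]/(invmx g *m _) -mulmxA [g *m _]mulmxA mulmxV// mul1mx.
exact: IH.
Qed.

End PowZ.

Lemma polyfunmx_inv (K : fieldType) (C : set K) N T I (c : I -> T -> K) (A : T -> 'M[K]_N) :
  [pchar K] =i pred0 -> ratset K `<=` C -> polyfunmx C c A ->
  polyfunmx C c (fun t => mxpower (A t) (- 1)).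
Proof.
move=> K0 hC hA; apply: polyfunmx_power => //.
exact: (polyfun_int hC c (-1)).
Qed.

Lemma map_mxpowz (R S : comUnitRingType) (f : {rmorphism R -> S}) N (g : 'M[R]_N) m :
  g \in unitmx -> map_mx f (mxpowz g m) = mxpowz (map_mx f g) m.
Proof.
by case: m => k ug /=; rewrite map_mxX_sq ?map_mx_inv.
Qed.

Section IntegralPoints.
Context (G : unipotent_Zgroup).
Local Notation N := (Defs.msize G).

Let Q0 : [pchar rat] =i pred0 := @pchar_num _.
Let inj : injective (intr : int -> rat) := @intr_inj _.

(** The group law is inherited from the points over [rat]; inverses stay integral since
    unitriangular matrices have determinant 1. *)
Lemma points_int_subgroup : is_subgroup (points G int).
Proof.
split.
- by move=> g /points_strict; exact: strict_lower_unit.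
- apply: (points_map_inj (f := (intr : {rmorphism int -> rat})) inj).
  by rewrite map_mx1; exact: points1.
- move=> g h hg hh; apply: (points_map_inj (f := (intr : {rmorphism int -> rat})) inj).
  by rewrite map_mxM; apply: pointsM => //; exact: points_map.
- move=> g hg; apply: (points_map_inj (f := (intr : {rmorphism int -> rat})) inj).
  rewrite map_mx_inv; last exact/strict_lower_unit/(points_strict hg).
  by apply: pointsV => //; exact: points_map.
Qed.

Context (n : nat) (x : 'I_n -> 'M[int]_N) (x_basis : malcev_basis G x).
Local Notation Gamma := (malcev_term x).

Lemma basis_points j : points G int (x j).
Proof.
have [<- _ _] := x_basis; apply: sub_generated.
by exists j => //=.
Qed.

Lemma malcev_subgroup i : is_subgroup (Gamma i).
Proof.
apply: generated_subgroup points_int_subgroup _ => _ [j _ <-]; exact: basis_points.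
Qed.

Lemma malcev_points i : Gamma i `<=` points G int.
Proof.
apply: generated_sub points_int_subgroup _ => _ [j _ <-]; exact: basis_points.
Qed.

Lemma malcev_mono i k : (i <= k)%N -> Gamma i `<=` Gamma k.
Proof.
move=> ik; apply: generatedS => _ [j ji <-]; exists j => //=.
exact: leq_trans ik.
Qed.

Lemma malcev_mem (i : 'I_n) : Gamma i.+1 (x i).
Proof. by apply: sub_generated; exists i => /=. Qed.

(** The basis is only assumed to be central: commutators drop by one step. Normality follows from
    h^-1 g h = g (g^-1 h^-1 g h). *)
Lemma malcev_conj i g h : (i <= n)%N -> Gamma i g -> points G int h ->
  Gamma i (invmx h *m g *m h).
Proof.
case: i => [|i] iN.
  move=> hg hh; have /= -> : [set (1%:M : 'M[int]_N)] g.
    apply: hg; split; last by move=> h0 [j].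
    split=> [_ ->|//|_ _ -> ->|_ ->]; rewrite /= ?unitmx1 ?mulmx1//.
    by symmetry; apply: invmx_eq; rewrite mulmx1.
  rewrite mulmx1 mulVmx; last exact/strict_lower_unit/(points_strict hh).
  by have [_ h1 _ _] := malcev_subgroup 0.
move=> hg hh; have [_ central _] := x_basis.
have ug : g \in unitmx by exact/strict_lower_unit/(points_strict (malcev_points hg)).
have -> : invmx h *m g *m h = g *m (invmx g *m invmx h *m g *m h).
  by rewrite !mulmxA mulmxV// mul1mx.
have [_ _ hM _] := malcev_subgroup i.+1; apply: hM => //.
by apply: (malcev_mono (leqnSn i)); exact: central.
Qed.

Lemma malcev_conjV i g h : (i <= n)%N -> Gamma i g -> points G int h ->
  Gamma i (h *m g *m invmx h).
Proof.
move=> iN hg hh; have uh := strict_lower_unit (points_strict hh).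
rewrite -{1}[h]invmxK; apply: malcev_conj => //.
by have [_ _ _ hV] := points_int_subgroup; exact: hV.
Qed.

Lemma mxpowz_int (g : 'M[int]_N) m : points G int g ->
  map_mx (intr : int -> rat) (mxpowz g m) = mxpower (map_mx intr g) m%:~R.
Proof.
move=> hg; rewrite map_mxpowz; last exact/strict_lower_unit/(points_strict hg).
rewrite mxpowz_power//; apply: points_strict; exact: points_map hg.
Qed.

Lemma mxpowzD g a b : points G int g -> mxpowz g (a + b) = mxpowz g a *m mxpowz g b.
Proof.
move=> hg; have mI : injective (map_mx (intr : int -> rat) : 'M[int]_N -> 'M[rat]_N).
  by move=> A B AB; apply/matrixP => i j; move/matrixP/(_ i j): AB; rewrite !mxE => /inj.
have sg : strict_lower (map_mx (intr : int -> rat) g - 1).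
  by apply: points_strict; exact: points_map hg.
by apply: mI; rewrite map_mxM !mxpowz_int// rmorphD mxpowerD.
Qed.

(** By normality the products of an element of [Gamma i] and a power of [x i] form a subgroup, and
    it contains all the generators of [Gamma i.+1]. *)
Lemma malcev_decomp (i : 'I_n) g : Gamma i.+1 g ->
  exists2 h, Gamma i h & exists m, g = h *m mxpowz (x i) m.
Proof.
have hx := basis_points i; have iN := ltnW (ltn_ord i).
have [gu g1 gM gV] := malcev_subgroup i; have [pu p1 pM pV] := points_int_subgroup.
have xz m : points G int (mxpowz (x i) m) by exact: subgroup_powz points_int_subgroup hx.
have xV a : mxpowz (x i) (- a) = invmx (mxpowz (x i) a).
  by apply: invmx_eq; rewrite -mxpowzD// subrr.
apply: (generated_sub (H := [set g | exists2 h, Gamma i h & exists m, g = h *m mxpowz (x i) m])).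
  split.
  - by move=> _ [h hh [m ->]]; rewrite /= unitmx_mul gu//= pu.
  - by exists 1%:M => //; exists 0; rewrite mulmx1.
  - move=> _ _ [h hh [m ->]] [h' hh' [m' ->]].
    exists (h *m (mxpowz (x i) m *m h' *m invmx (mxpowz (x i) m))).
      by apply: gM => //; exact: malcev_conjV.
    exists (m + m'); rewrite mxpowzD// -!mulmxA; do 2!congr (_ *m _).
    by rewrite mulKmx// pu.
  - move=> _ [h hh [m ->]]; have um : mxpowz (x i) m \in unitmx by exact: pu.
    exists (invmx (mxpowz (x i) m) *m invmx h *m mxpowz (x i) m).
      by apply: malcev_conj => //; exact: gV.
    exists (- m); symmetry; apply: invmx_eq.
    have uh := gu _ hh; rewrite /= in uh; by rewrite xV !mulmxA !mulmxK// mulmxV.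
move=> _ [j ji <-]; move: ji; rewrite /= ltnS leq_eqVlt => /predU1P[/val_inj ->|ji].
  by exists 1%:M => //; exists 1; rewrite mul1mx /= expr1.
exists (x j); last by exists 0; rewrite mulmx1.
by apply: sub_generated; exists j.
Qed.

(** The quotient is infinite cyclic on some generator [y], not on [x i] itself. Modulo [Gamma i], y
    is x_i^l, so y^|m| is the l-th power of x_i^m up to sign and lies in [Gamma i]. Then 0 and -|m|
    are both exponents for the identity, and uniqueness gives m = 0. *)
Lemma malcev_free (i : 'I_n) m : Gamma i (mxpowz (x i) m) -> m = 0.
Proof.
move=> hm; have [_ _ /(_ i (ltn_ord i)) [y Hy yu]] := x_basis.
have sub := malcev_subgroup i; have [gu g1 gM gV] := sub.
have sub1 := malcev_subgroup i.+1; have [_ s1 _ _] := sub1.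
have yp : points G int y := malcev_points Hy.
have iN := ltnW (ltn_ord i).
have [h hh [l yE]] := malcev_decomp Hy.
have hx := basis_points i.
have xz k : points G int (mxpowz (x i) k) by exact: subgroup_powz points_int_subgroup hx.
have yk k : exists2 h, Gamma i h & mxpowz y (Posz k) = h *m mxpowz (x i) (l * k%:Z).
  elim: k => [|k [h' hh' IH]]; first by exists 1%:M => //; rewrite mulr0 mul1mx.
  exists (h *m (mxpowz (x i) l *m h' *m invmx (mxpowz (x i) l))).
    by apply: gM => //; exact: malcev_conjV.
  have -> : mxpowz y k.+1%:Z = y *m mxpowz y k%:Z by rewrite /mxpowz exprS.
  have -> : l * k.+1%:Z = l + l * k%:Z by rewrite -add1n PoszD mulrDr mulr1.
  rewrite IH mxpowzD// {1}yE -!mulmxA; do 2!congr (_ *m _).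
  by rewrite mulKmx//; exact/strict_lower_unit/(points_strict (xz l)).
have xmk (k : nat) : Gamma i (mxpowz (x i) (m * k%:Z)).
  elim: k => [|k IH]; first by rewrite mulr0.
  have -> : m * k.+1%:Z = m + m * k%:Z by rewrite -add1n PoszD mulrDr mulr1.
  by rewrite mxpowzD//; exact: gM.
have xmz (k : int) : Gamma i (mxpowz (x i) (m * k)).
  case: k => k; first exact: xmk.
  rewrite NegzE mulrN (_ : mxpowz _ _ = invmx (mxpowz (x i) (m * k.+1%:Z))); first exact: gV.
  by apply: invmx_eq; rewrite -mxpowzD// subrr.
have ym : Gamma i (mxpowz y `|m|%N%:Z).
  have [h' hh' ->] := yk `|m|%N; apply: gM => //.
  by rewrite abszE normrEsg mulrA mulrC; exact: xmz.
have [k [_ ku]] := yu 1%:M s1.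
have k0 : k = 0 by apply: ku; rewrite oppr0 mulmx1.
have km : k = - `|m|%N%:Z by apply: ku; rewrite opprK mulmx1.
have : `|m|%N%:Z = 0 :> int by apply: oppr_inj; rewrite -km k0 oppr0.
by move=> /eqP; rewrite eqz_nat absz_eq0 => /eqP.
Qed.

End IntegralPoints.

(** Q(t + 1) and Q(t) have the same leading coefficient; the drop in degree makes the inductions by
    finite differences terminate. *)
Lemma size_shift_diff (F : fieldType) (Q : {poly F}) d :
  (size Q <= d.+1)%N -> (size (Q \Po ('X + 1%:P) - Q)%R <= d)%N.
Proof.
move=> sQ; have s2 : size ('X + 1%:P : {poly F}) = 2 by rewrite size_XaddC.
apply/leq_sizeP => j dj; rewrite coefB.
have [jQ|Qj] := ltnP j (size Q).
  have ej : j = d by apply/eqP; rewrite eqn_leq dj andbT -ltnS (leq_trans jQ sQ).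
  have sE : size Q = d.+1 by apply/eqP; rewrite eqn_leq sQ -ej.
  have := @lead_coef_comp F Q ('X + 1%:P); rewrite s2 lead_coefXaddC => /(_ isT).
  rewrite expr1n mulr1 /lead_coef size_comp_poly2// sE ej => ->.
  by rewrite subrr.
by rewrite !nth_default ?subrr// size_comp_poly2.
Qed.

(** * Integral words and their images over a field of characteristic 0 *)

Section Words.
Context (G : unipotent_Zgroup).
Local Notation N := (Defs.msize G).
Context (n : nat) (x : 'I_n -> 'M[int]_N) (x_basis : malcev_basis G x).
Context (F : fieldType) (F0 : [pchar F] =i pred0).
Local Notation Gamma := (malcev_term x).
Local Notation emb := (map_mx (intr : int -> F)).
Local Notation X := (fun j => emb (x j)).

Definition word (a : 'I_n -> F) : 'M[F]_N := \prod_(i < n) mxpower (X i) (a i).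

Definition embed_term i : set 'M[F]_N := [set emb g | g in Gamma i].
Local Notation GF := embed_term.

Lemma basis_strict j : strict_lower (X j - 1).
Proof. apply: points_strict; apply: points_map; exact: basis_points. Qed.

Lemma emb_powz i m : emb (mxpowz (x i) m) = mxpower (X i) m%:~R.
Proof.
rewrite map_mxpowz ?mxpowz_power//; first exact: basis_strict.
exact/strict_lower_unit/points_strict/basis_points.
Qed.

Lemma embed_termP (i : 'I_n) g : GF i.+1 g ->
  exists2 h, GF i h & exists m : int, g = h * mxpower (X i) m%:~R.
Proof.
move=> [g' /(malcev_decomp x_basis)[h hh [m ->]] <-]; exists (emb h); first by exists h.
by exists m; rewrite map_mxM emb_powz.
Qed.

Lemma embed_term_mul i g h : GF i g -> GF i h -> GF i (g * h).
Proof.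
move=> [g' hg' <-] [h' hh' <-]; exists (g' *m h'); last by rewrite map_mxM.
by have [_ _ hM _] := malcev_subgroup x_basis i; exact: hM.
Qed.

Lemma embed_term1 i : GF i 1.
Proof. by exists 1%:M; [have [] := malcev_subgroup x_basis i | rewrite map_mx1]. Qed.

Lemma embed_term0 g : GF 0 g -> g = 1.
Proof.
move=> [g' hg' <-]; suff /= -> : [set (1%:M : 'M[int]_N)] g' by rewrite map_mx1.
apply: hg'; split; last by move=> h0 [j].
split=> [_ ->|//|_ _ -> ->|_ ->]; rewrite /= ?unitmx1 ?mulmx1//.
by symmetry; apply: invmx_eq; rewrite mulmx1.
Qed.

Lemma embed_termW i k g : (i <= k)%N -> GF i g -> GF k g.
Proof. by move=> ik [g' hg' <-]; exists g' => //; exact: malcev_mono hg'. Qed.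

Lemma embed_term_powz (i : 'I_n) k (m : int) : (i < k)%N -> GF k (mxpower (X i) m%:~R).
Proof.
move=> ik; rewrite -emb_powz; exists (mxpowz (x i) m) => //.
apply: (malcev_mono ik); apply: (subgroup_powz _ (malcev_subgroup x_basis i.+1)).
exact: malcev_mem.
Qed.

Lemma embed_term_free (i : 'I_n) (m : int) : GF i (mxpower (X i) m%:~R) -> m = 0.
Proof.
rewrite -emb_powz => -[g hg e]; apply: (malcev_free x_basis (i := i)).
suff <- : g = mxpowz (x i) m by [].
apply/matrixP => a b; move/matrixP/(_ a b): e; rewrite !mxE; exact: intr_inj_char0.
Qed.

Lemma embed_term_conj i k g h : (i <= n)%N -> GF i g -> GF k h ->
  exists2 g', GF i g' & h * g = g' * h.
Proof.
move=> iN [g' hg' <-] [h' hh' <-]; have ph := malcev_points x_basis hh'.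
exists (emb (h' *m g' *m invmx h')).
  by exists (h' *m g' *m invmx h') => //; exact: malcev_conjV.
rewrite -[_ * _]map_mxM -[RHS]map_mxM mulmxKV//.
exact/strict_lower_unit/(points_strict ph).
Qed.

Lemma embed_term_full g : GF n g <-> exists2 h, points G int h & g = emb h.
Proof.
have [E _ _] := x_basis; rewrite /GF E; split=> [[h hh <-]|[h hh ->]]; exists h => //.
Qed.

(** The product of the first [k] factors of a word, indexed by natural numbers so that [k] can vary
    in an induction; the default factor 1 fills the indices outside ['I_n]. *)
Definition wordn (a : 'I_n -> F) k : 'M[F]_N :=
  \prod_(0 <= j < k) (if insub j is Some o then mxpower (X o) (a o) else 1).

Lemma wordn_full a k : (k <= n)%N -> (forall j : 'I_n, (k <= j)%N -> a j = 0) ->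
  word a = wordn a k.
Proof.
move=> kn a0; transitivity (wordn a n).
  rewrite /word /wordn big_mkord; apply: eq_bigr => i _.
  by rewrite insubT// => h; congr (mxpower (X _) (a _)); exact: val_inj.
rewrite /wordn (big_cat_nat (leq0n k) kn)//= [X in _ * X]big_nat [Y in _ * Y]big1 ?mulr1// => j /andP[kj jn].
by rewrite insubT a0// mxpower0.
Qed.

Lemma wordnS a (i : 'I_n) : wordn a i.+1 = wordn a i * mxpower (X i) (a i).
Proof.
rewrite /wordn big_nat_recr//=; congr (_ * _).
by rewrite insubT// => h; congr (mxpower (X _) (a _)); exact: val_inj.
Qed.

Lemma eq_wordn a b k : (forall j : 'I_n, (j < k)%N -> a j = b j) -> wordn a k = wordn b k.
Proof.
move=> ab; rewrite /wordn big_nat [RHS]big_nat; apply: eq_bigr => j /andP[_ jk].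
by case: insubP => // o _ jo; rewrite ab// jo.
Qed.

Definition upd (a : 'I_n -> int) (i : 'I_n) m : 'I_n -> int :=
  fun j => if j == i then m else a j.

Local Notation toF a := (fun j => (a j)%:~R : F).
Definition supp_lt (T : nmodType) k (a : 'I_n -> T) := forall j : 'I_n, (k <= j)%N -> a j = 0.

Lemma supp_lt_toF k (a : 'I_n -> int) : supp_lt k a -> supp_lt k (toF a).
Proof. by move=> h j kj; rewrite h. Qed.

Lemma word_split (a : 'I_n -> int) (i : 'I_n) : supp_lt i.+1 a ->
  word (toF a) = word (toF (upd a i 0)) * mxpower (X i) (a i)%:~R.
Proof.
move=> ha; have iN := ltn_ord i.
rewrite (wordn_full iN) ?wordnS; last exact: supp_lt_toF.
rewrite (@wordn_full (toF (upd a i 0)) i) ?(ltnW iN)//; last first.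
  move=> j; rewrite /upd leq_eqVlt => /predU1P[/val_inj ->|ij]; rewrite ?eqxx//.
  by rewrite -val_eqE gtn_eqF// ha.
congr (_ * _); apply: eq_wordn => j ji.
by rewrite /upd -val_eqE ltn_eqF.
Qed.

Lemma supp_lt_upd (a : 'I_n -> int) (i : 'I_n) : supp_lt i.+1 a -> supp_lt i (upd a i 0).
Proof.
move=> ha j; rewrite /upd leq_eqVlt => /predU1P[/val_inj ->|ij]; rewrite ?eqxx//.
by rewrite -val_eqE gtn_eqF// ha.
Qed.

Lemma word0 (a : 'I_n -> F) : (forall j, a j = 0) -> word a = 1.
Proof. by move=> h; rewrite /word big1// => i _; rewrite h mxpower0. Qed.

Lemma word_embed k (a : 'I_n -> int) : (k <= n)%N -> supp_lt k a -> GF k (word (toF a)).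
Proof.
elim: k a => [|k IH] a kn ha.
  by rewrite word0 => [|j]; [exact: embed_term1 | rewrite ha].
rewrite (@word_split a (Ordinal kn)) //; apply: embed_term_mul.
  apply: (@embed_termW k) => //; apply: IH; first exact: ltnW.
  exact: (@supp_lt_upd a (Ordinal kn)).
exact: embed_term_powz.
Qed.

Lemma embed_word k g : (k <= n)%N -> GF k g -> exists2 a : 'I_n -> int, supp_lt k a & g = word (toF a).
Proof.
elim: k g => [|k IH] g kn hg.
  by exists (fun=> 0) => //; rewrite word0// (embed_term0 hg).
have [h hh [m ->]] := @embed_termP (Ordinal kn) g hg.
have [a ha ->] := IH h (ltnW kn) hh.
have sa : supp_lt k.+1 (upd a (Ordinal kn) m).
  by move=> j kj; rewrite /upd -val_eqE gtn_eqF// ha// ltnW.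
exists (upd a (Ordinal kn) m) => //; rewrite (@word_split (upd a (Ordinal kn) m) (Ordinal kn))//.
have -> : upd a (Ordinal kn) m (Ordinal kn) = m by rewrite /upd eqxx.
congr (word _ * _); apply/funext => j; rewrite /upd.
by case: eqP => // ->; rewrite ha.
Qed.

Local Notation pf := (polyfun (ratset F) (@mxentry F N)).
Let ratE : ratset F `<=` ratset F. Proof. by []. Qed.
Let ratT : ratset F `<=` setT. Proof. by []. Qed.

Lemma ratset_basis i a b : ratset F (X i a b).
Proof. by rewrite mxE; exact: ratset_int. Qed.

Lemma polyfunmx_id : polyfunmx (ratset F) (@mxentry F N) (fun g => g).
Proof. by move=> i j; exact: (polyfun_coord _ _ (i, j)). Qed.

Lemma polyfunmx_word (C : set F) T I (c : I -> T -> F) (a : 'I_n -> T -> F) :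
  ratset F `<=` C -> (forall j, polyfun C c (a j)) ->
  polyfunmx C c (fun t => word (fun j => a j t)).
Proof.
move=> hC ha; apply: polyfunmx_prod => // j; apply: polyfunmx_power => //.
by apply: polyfunmx_cst => r s; apply: hC; exact: ratset_basis.
Qed.

(** The bound [d] is uniform in [g], so it can serve as the measure of induction when [f] is
    replaced by its finite difference. *)
Lemma polyfun_lmul_curve (f : 'M[F]_N -> F) i : pf f ->
  exists d, forall g, exists2 Q : {poly F}, (size Q <= d)%N &
    forall t, f (mxpower (X i) t * g) = Q.[t].
Proof.
move=> /(polyfunW ratT) pff.
apply: (@polyfun_degree F 'M[F]_N (fun z => f (mxpower (X i) z.1 * z.2))).
apply: polyfun_comp pff => -[a b]; rewrite /mxentry /=; move: a b.
apply: polyfunmxM => //.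
  apply: polyfunmx_power => //; first exact: (polyfun_coord _ _ None).
  exact: polyfunmx_cst.
by move=> a b; exact: (polyfun_coord _ _ (Some (fun g : 'M[F]_N => g a b))).
Qed.

End Words.

(** * Polynomial Malcev coordinates *)

Section Coordinates.
Context (G : unipotent_Zgroup).
Local Notation N := (Defs.msize G).
Context (n : nat) (x : 'I_n -> 'M[int]_N) (x_basis : malcev_basis G x).
Context (F : fieldType) (F0 : [pchar F] =i pred0).
Local Notation emb := (map_mx (intr : int -> F)).
Local Notation X := (fun j => emb (x j)).
Local Notation GF := (@embed_term G n x F).
Local Notation toF a := (fun j => (a j)%:~R : F).
Local Notation pf := (polyfun (ratset F) (@mxentry F N)).
Let ratE : ratset F `<=` ratset F. Proof. by []. Qed.
Let ratT : ratset F `<=` setT. Proof. by []. Qed.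
Let sX j : strict_lower (X j - 1). Proof. exact: basis_strict. Qed.

Lemma mxpowerS i t : mxpower (X i) (t + 1) = X i * mxpower (X i) t.
Proof. by rewrite addrC mxpowerD// mxpower1. Qed.

Lemma mxpowerSr i t : mxpower (X i) (t + 1) = mxpower (X i) t * X i.
Proof. by rewrite mxpowerD// mxpower1. Qed.

Lemma embed_term_basis (i : 'I_n) k : (i < k)%N -> GF k (X i).
Proof.
move=> ik; have := embed_term_powz x_basis F0 1 ik.
by rewrite mxpower1.
Qed.

Lemma polyfun_translate f (A B : 'M[F]_N) :
  (forall i j, ratset F (A i j)) -> (forall i j, ratset F (B i j)) ->
  pf f -> pf (fun g => f (A * g * B)).
Proof.
move=> hA hB; apply: polyfun_comp => -[i j]; rewrite /mxentry /=; move: i j.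
apply: polyfunmxM => //; last exact: polyfunmx_cst.
by apply: polyfunmxM => //; [exact: polyfunmx_cst | exact: polyfunmx_id].
Qed.

Lemma ratset1mx i j : ratset F ((1 : 'M[F]_N) i j).
Proof. by rewrite mxE; exact: ratset_nat. Qed.

Section Step.
Variable i : 'I_n.

Let iN : (i <= n)%N := ltnW (ltn_ord i).

Definition invariant_upto k f :=
  [/\ pf f, forall h, GF i h -> f h = 0, exists2 g, GF i.+1 g & f g != 0
    & forall h g, GF k h -> GF i.+1 g -> f (h * g) = f g].

(* [X_k] acts unipotently on polynomial functions of bounded degree, so the last
   nonzero iterate of [f (X_k g) - f g] is invariant. *)
Lemma invariant_step (k : 'I_n) f : (k < i)%N -> invariant_upto k f ->
  exists f', invariant_upto k.+1 f'.
Proof.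
move=> ki hf; have [pff _ _ _] := hf; have [d] := polyfun_lmul_curve x F0 k pff.
have kN : (k <= n)%N := leq_trans (ltnW ki) iN.
elim: d f hf {pff} => [|d IH] f hf hd; have [pff f0 [g0 hg0 fg0] finv] := hf.
  have [Q /size_poly_leq0P Q0 hQ] := hd g0; move: fg0.
  by rewrite -[g0]mul1r -(mxpower0 (X k)) hQ Q0 horner0 eqxx.
have XkG g : GF i.+1 g -> GF i.+1 (X k * g).
  by apply: embed_term_mul => //; apply: embed_term_basis; rewrite ltnW.
have [fX|/existsNP[g1 /not_implyP[hg1 fg1]]] :=
    pselect (forall g, GF i.+1 g -> f (X k * g) = f g).
  exists f; split=> // [|h g hh hg]; first by exists g0.
  have [h' hh' [m ->]] := embed_termP x_basis F0 hh.
  have xg : GF i.+1 (mxpower (X k) m%:~R * g).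
    by apply: embed_term_mul => //; apply: embed_term_powz => //; rewrite ltnW.
  rewrite -mulrA finv//; have [Q _ hQ] := hd g.
  (* Iterating [fX] reaches natural powers only; since [f] is polynomial along the curve, the
     negative powers follow. *)
  have nat_pow (j : nat) : f (mxpower (X k) j%:R * g) = f g.
    elim: j => [|j IHj]; first by rewrite mxpower0 mul1r.
    rewrite -natr1 mxpowerS -mulrA fX ?IHj//.
    apply: embed_term_mul => //.
    by have := @embed_term_powz _ _ _ x_basis _ F0 k i.+1 j%:Z (ltnW ki).
  have Qc : Q - (f g)%:P = 0.
    by apply: (poly_nat_eq0 F0) => j; rewrite hornerD hornerN hornerC -hQ nat_pow subrr.
  by rewrite hQ; move/eqP: Qc; rewrite subr_eq0 => /eqP ->; rewrite hornerC.
apply: (IH (fun g => f (X k * g) - f g)).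
  split.
  - apply: polyfunB => //; have := polyfun_translate (ratset_basis x F k) ratset1mx pff.
    by under eq_fun do rewrite mulr1.
  - move=> h hh; rewrite !f0 ?subrr//; apply: embed_term_mul => //.
    exact: embed_term_basis.
  - by exists g1 => //; rewrite subr_eq0; exact/eqP.
  - move=> h g hh hg; rewrite (finv h g)// mulrA.
    (* Normality moves [h] to the left of [X k], so the invariance already obtained is not lost. *)
    have [h' hh' ->] := embed_term_conj x_basis kN hh (embed_term_basis (ltnSn k)).
    by rewrite -mulrA finv//; exact: XkG.
move=> g; have [Q sQ hQ] := hd g; exists (Q \Po ('X + 1%:P) - Q).
  exact: size_shift_diff.
move=> t; rewrite hornerD hornerN horner_comp hornerD hornerX hornerC -!hQ.
by rewrite mxpowerS mulrA.
Qed.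

Lemma invariant_exists f : invariant_upto 0 f -> exists f', invariant_upto i f'.
Proof.
move=> hf; suff H k : (k <= i)%N -> exists f', invariant_upto k f' by exact: H.
elim: k => [|k IH] ki; first by exists f.
have [f' hf'] := IH (ltnW ki).
have kn : (k < n)%N := leq_trans ki iN.
exact: (@invariant_step (Ordinal kn) f').
Qed.

(** On [GF i.+1] such an [f] depends on the exponent of [x i] alone, polynomially and not
    constantly. Linearity is only reached in [top_coordinate_of]. *)
Definition right_linear f := [/\ pf f,
  forall h (m : int), GF i h -> f (h * mxpower (X i) m%:~R) = f (mxpower (X i) m%:~R)
  & exists t, f (mxpower (X i) t) != f 1].

(** Taking the difference in the exponent lowers the degree of [Q] and keeps the hypotheses as long
    as the difference is nonconstant. Once it is constant, [Q] is affine with nonzero slope and is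
    normalized. *)
Lemma top_coordinate_of f : right_linear f -> exists2 chi, pf chi &
  forall h (m : int), GF i h -> chi (h * mxpower (X i) m%:~R) = m%:~R.
Proof.
move=> hf; have [pff _ _] := hf; have [d] := polyfun_lmul_curve x F0 i pff.
move=> /(_ 1)[Q sQ hQ'].
have {hQ'} hQ t : f (mxpower (X i) t) = Q.[t] by rewrite -hQ' mulr1.
elim: d f Q hf sQ hQ {pff} => [|d IH] f Q hf sQ hQ; have [pff finv [t ft]] := hf.
  move/size_poly_leq0P: sQ => Q0; move: ft.
  by rewrite -(mxpower0 (X i)) !hQ Q0 !horner0 eqxx.
have f1 : f 1 = Q.[0] by rewrite -hQ mxpower0.
pose q := Q \Po ('X + 1%:P) - Q.
have qE u : q.[u] = Q.[u + 1] - Q.[u].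
  by rewrite hornerD hornerN horner_comp hornerD hornerX hornerC.
have [qc|/existsNP[u /eqP qu]] := pselect (forall u, q.[u] = q.[0]).
  pose c := Q.[1] - Q.[0].
  have Qnat (j : nat) : Q.[j%:R] = Q.[0] + c * j%:R.
    elim: j => [|j IHj]; first by rewrite mulr0 addr0.
    rewrite -natr1; have /eqP := qE j%:R; rewrite qc qE add0r -/c eq_sym subr_eq => /eqP ->.
    by rewrite IHj mulrDr mulr1 addrCA [c + _]addrC.
  have QE : Q = Q.[0]%:P + c *: 'X.
    apply/eqP; rewrite -subr_eq0; apply/eqP/(poly_nat_eq0 F0) => j.
    by rewrite hornerD hornerN hornerD hornerC hornerZ hornerX Qnat subrr.
  have c0 : c != 0.
    apply: contra_neq ft => c0; rewrite f1 hQ QE c0 scale0r addr0 !hornerC.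
    by [].
  have fX : f (X i) - f 1 = c by rewrite -{1}(mxpower1 F0 (sX i)) hQ f1.
  (* The normalizing constants are values of [f] at rational matrices, so the coordinate keeps
     rational coefficients. *)
  have r1 : ratset F (f 1) by apply: polyfun_ratset pff _ => -[a b]; exact: ratset1mx.
  have rX : ratset F (f (X i)).
    by apply: polyfun_ratset pff _ => -[a b]; exact: ratset_basis.
  have rc : ratset F c by rewrite -fX -mulN1r; apply: ratsetD => //; apply: ratsetM => //; exact: (ratset_int F (-1)).
  exists (fun g => (f g - f 1) * c^-1).
    apply: polyfunM; last by apply: polyfun_rat => //; exact: ratsetV.
    by apply: polyfunB => //; exact: polyfun_rat.
  move=> h m hh; rewrite finv// hQ f1 QE !hornerD !hornerZ !hornerC !hornerX mulr0 addr0.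
  by rewrite addrAC subrr add0r mulrAC divff// mul1r.
apply: (IH (fun g => f (g * X i) - f g) q); last first.
- by move=> u'; rewrite -mxpowerSr !hQ qE.
- exact: size_shift_diff.
split.
- apply: polyfunB => //; have := polyfun_translate ratset1mx (ratset_basis x F i) pff.
  by under eq_fun do rewrite mul1r.
- move=> h m hh; rewrite -mulrA -mxpowerSr.
  have -> : m%:~R + 1 = (m + 1)%:~R :> F by rewrite rmorphD.
  by rewrite !finv.
- exists u; rewrite mul1r -mxpowerSr -[X i as Y in f Y](mxpower1 F0 (sX i)) !hQ f1.
  rewrite -qE; apply: contra_neq qu => ->.
  by rewrite qE add0r.
Qed.

Section FromCoordinates.
Variable alpha : 'I_n -> 'M[F]_N -> F.
Hypothesis pa : forall j, pf (alpha j).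
Hypothesis aE : forall a : 'I_n -> int, supp_lt i a -> forall j, alpha j (word x (toF a)) = (a j)%:~R.

(** Suppose that every rational polynomial vanishing on [GF i] also vanished at the powers of x_i.
    Then these powers would satisfy the identity that recovers an element of [GF i] from its
    coordinates [alpha]. For a suitable D > 0 the coordinates of x_i^D are integers, so x_i^D would
    lie in [GF i], against [embed_term_free]. *)
Lemma separating_function : exists2 f, pf f &
  (forall h, GF i h -> f h = 0) /\ exists m : nat, f (mxpower (X i) m%:R) != 0.
Proof.
apply: contrapT => nf.
have {nf} vanish f : pf f -> (forall h, GF i h -> f h = 0) ->
    forall m : nat, f (mxpower (X i) m%:R) = 0.
  move=> pff f0 m; apply: contrapT => fm; apply: nf; exists f => //; split=> //.
  by exists m; exact/eqP.
have xword m : mxpower (X i) m%:R = word x (fun j => alpha j (mxpower (X i) m%:R)).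
  apply/matrixP => a b; apply/eqP; rewrite -subr_eq0; apply/eqP.
  pose s g := (g - word x (fun j => alpha j g)) a b.
  have -> : mxpower (X i) m%:R a b - word x (fun j => alpha j (mxpower (X i) m%:R)) a b =
     s (mxpower (X i) m%:R) by rewrite /s !mxE.
  apply: vanish => [|h hh].
    by move: a b @s; apply: polyfunmxB => //; [exact: polyfunmx_id | exact: polyfunmx_word].
  have [c sc ->] := embed_word x_basis F0 iN hh.
  rewrite /s (_ : (fun j => _) = toF c); last by apply/funext => j; rewrite aE.
  by rewrite subrr mxE.
have a0 (j : 'I_n) m : (i <= j)%N -> alpha j (mxpower (X i) m%:R) = 0.
  move=> ij; apply: vanish => // h hh; have [c sc ->] := embed_word x_basis F0 iN hh.
  by rewrite aE// sc.
have /choice[d hd] : forall j, exists d, exists P : {poly int}, forall t,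
    d.+1%:R * alpha j (mxpower (X i) t) = (map_poly intr P).[t].
  move=> j; apply: (@polyfun1_rat F (fun t => alpha j (mxpower (X i) t))).
  apply: polyfun_comp (pa j) => -[a b]; rewrite /mxentry /=; move: a b.
  apply: polyfunmx_power => //; first exact: (polyfun_coord _ _ tt).
  by apply: polyfunmx_cst => a b; exact: ratset_basis.
(* Each coordinate of x_i^t has the form P(t) / (d + 1) with P integral, and P(0) = 0 since the
   coordinates of 1 vanish. It is therefore an integer whenever t is a multiple of d + 1. *)
pose D := (\prod_j (d j).+1)%N.
have D0 : (0 < D)%N by exact: prodn_gt0.
have /choice[c hc] : forall j, exists c : int, alpha j (mxpower (X i) D%:R) = c%:~R.
  move=> j; have [P hP] := hd j.
  have [R [b PE]] : exists R : {poly int}, exists b, P = R * 'X + b%:P.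
    by elim/poly_ind: P {hP} => [|R b _]; [exists 0, 0; rewrite mul0r add0r | exists R, b].
  have PF (t : F) : (map_poly intr P).[t] = (map_poly intr R).[t] * t + b%:~R.
    by rewrite PE rmorphD rmorphM /= map_polyX map_polyC hornerD hornerM hornerX hornerC.
  have b0 : (b%:~R : F) = 0.
    have := hP 0; rewrite mxpower0 PF mulr0 add0r => <-.
    by rewrite -(@word0 _ _ x F (toF (fun=> 0)))// aE ?mulr0.
  have [e De] : exists e, D = (e * (d j).+1)%N.
    by apply/dvdnP; rewrite /D (bigD1 j)//= dvdn_mulr.
  exists (R.[D%:R] * e%:R).
  have dj := natf_neq0_char0 F0 (d j).
  apply: (mulfI dj); rewrite hP PF b0 addr0 {2}De natrM rmorphM rmorph_nat.
  rewrite [LHS]mulrA mulrC; congr (_ * (_ * _)).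
  by rewrite -horner_map rmorph_nat.
have hD : mxpower (X i) D%:R = word x (toF c).
  by rewrite {1}xword; congr (word x _); apply/funext => j; rewrite hc.
have sc : supp_lt i c.
  move=> j ij; have := hc j; rewrite a0// => /esym.
  by move/eqP; rewrite intr_eq0_char0 => [/eqP|].
have := word_embed x_basis F0 iN sc; rewrite -hD => /(embed_term_free x_basis F0 (m := D%:Z)).
by case=> DE; rewrite DE in D0.
Qed.

Lemma top_coordinate : exists2 chi, pf chi &
  forall h (m : int), GF i h -> chi (h * mxpower (X i) m%:~R) = m%:~R.
Proof.
have [f0 pf0 [f0h [m fm]]] := separating_function.
have [f [pff fh [g hg fg] finv]] : exists f', invariant_upto i f'.
  apply: (@invariant_exists f0); split=> //.
    exists (mxpower (X i) m%:R) => //.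
    by have := @embed_term_powz _ _ _ x_basis _ F0 i i.+1 m%:Z (ltnSn i).
  by move=> h g' /embed_term0 -> _; rewrite mul1r.
apply: (@top_coordinate_of f); split=> //.
  by move=> h k hh; apply: finv => //; exact: embed_term_powz.
have [h hh [k gE]] := embed_termP x_basis F0 hg.
exists k%:~R; rewrite (fh 1); last exact: embed_term1.
by rewrite -(finv h)// -?gE//; exact: embed_term_powz.
Qed.

End FromCoordinates.
End Step.

Lemma coordinates_exist : exists2 alpha : 'I_n -> 'M[F]_N -> F, forall j, pf (alpha j) &
  forall (a : 'I_n -> int) j, alpha j (word x (toF a)) = (a j)%:~R.
Proof.
suff H k : (k <= n)%N -> exists2 alpha : 'I_n -> 'M[F]_N -> F, forall j, pf (alpha j) &
  forall a : 'I_n -> int, supp_lt k a -> forall j, alpha j (word x (toF a)) = (a j)%:~R.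
  have [alpha pa aE] := H n (leqnn n); exists alpha => // a j; apply: aE => k.
  by rewrite leqNgt ltn_ord.
elim: k => [|k IH] kn.
  exists (fun _ _ => 0) => [j|a sa j]; last by rewrite sa.
  by apply: polyfun_rat => //; exact: (ratset_nat F 0).
have [alpha pa aE] := IH (ltnW kn); pose i := Ordinal kn.
have [chi pchi chiE] := @top_coordinate i alpha pa aE.
(* The last factor x_i^chi(g) is stripped off and the earlier coordinates are read on the rest.
   There [alpha i] is 0 by the induction hypothesis, so [chi g] can be added to it. *)
exists (fun j g => alpha j (g * mxpower (X i) (- chi g)) + (j == i)%:R * chi g).
  move=> j; apply: polyfunD; last by apply: polyfunM => //; apply: polyfun_rat => //; exact: ratset_nat.
  apply: polyfun_comp (pa j) => -[a b]; rewrite /mxentry /=; move: a b.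
  apply: polyfunmxM => //; first exact: polyfunmx_id.
  apply: polyfunmx_power => //; last by apply: polyfunmx_cst => a b; exact: ratset_basis.
  have -> : (fun t => - chi t) = (fun t => (-1)%:~R * chi t) by apply/funext => t; rewrite mulN1r.
  by apply: polyfunM => //; apply: polyfun_rat => //; exact: ratset_int.
move=> a sa j; rewrite (@word_split G n x F a i)//.
have su := supp_lt_upd (i := i) sa.
have hw := word_embed x_basis F0 (ltnW kn) su.
rewrite chiE// -mulrA -mxpowerD// subrr mxpower0 mulr1 aE// /upd.
by case: eqP => [->|_]; rewrite ?add0r ?mul1r// mul0r addr0.
Qed.

End Coordinates.

(** * Coordinates on all points over a field of characteristic 0 *)

Section MalcevCoordinates.
Context (G : unipotent_Zgroup).
Local Notation N := (Defs.msize G).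
Context (n : nat) (x : 'I_n -> 'M[int]_N) (x_basis : malcev_basis G x).
Context (F : fieldType) (F0 : [pchar F] =i pred0) (rq : {rmorphism rat -> F}).
Local Notation emb := (map_mx (intr : int -> F)).
Local Notation X := (fun j => emb (x j)).
Local Notation GF := (@embed_term G n x F).
Local Notation toF a := (fun j => (a j)%:~R : F).
Local Notation pf := (polyfun (ratset F) (@mxentry F N)).
Let ratE : ratset F `<=` ratset F. Proof. by []. Qed.
Let ratT : ratset F `<=` setT. Proof. by []. Qed.

Lemma points_power g t : points G F g -> points G F (mxpower g t).
Proof.
move=> hg; have sg := points_strict hg; rewrite mxpower_exp_log//.
have [|_ //] := lie_pointsZ F0 t (X := mxlog1 (g - 1)).
by split; [exact: mxlog1_strict_lower | rewrite mxexp_log1].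
Qed.

Lemma points_word a : points G F (word x a).
Proof.
rewrite /word; apply: big_ind => [||j _]; first exact: points1.
  by move=> g h; exact: pointsM.
by apply: points_power; apply: points_map; exact: basis_points.
Qed.

Lemma word_eq0 (f : 'M[F]_N -> F) : pf f ->
  (forall a : 'I_n -> int, f (word x (toF a)) = 0) -> forall g, points G F g -> f g = 0.
Proof.
move=> pff f0; apply: (polyfun_points_eq0 F0 rq pff) => g hg.
have /(embed_word x_basis F0 (leqnn n)) [a _ ->] : GF n (emb g).
  by apply/(embed_term_full x_basis); exists g.
exact: f0.
Qed.

Variable alpha : 'I_n -> 'M[F]_N -> F.
Hypothesis pa : forall j, pf (alpha j).
Hypothesis aE : forall (a : 'I_n -> int) j, alpha j (word x (toF a)) = (a j)%:~R.

Lemma alpha_word a j : alpha j (word x a) = a j.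
Proof.
apply/eqP; rewrite -subr_eq0; apply/eqP; move: a.
apply: (polyfun_nat_eq0 F0 (f := fun a => alpha j (word x a) - a j)).
  apply: polyfunB => //; last exact: polyfun_coord.
  apply: (polyfun_comp _ (polyfunW ratT (pa j))) => -[a b]; rewrite /mxentry /=; move: a b.
  by apply: polyfunmx_word => // k; exact: polyfun_coord.
by move=> m; rewrite (aE (fun j => (m j)%:Z)) subrr.
Qed.

(** This is where density pays off: each entry of the difference is a rational polynomial in [g]
    that vanishes at the integral words. *)
Lemma word_alpha g : points G F g -> word x (fun j => alpha j g) = g.
Proof.
move=> hg; apply/matrixP => a b; apply/eqP; rewrite -subr_eq0.
pose s g := (word x (fun j => alpha j g) - g) a b.
have -> : word x (fun j => alpha j g) a b - g a b = s g by rewrite /s !mxE.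
apply/eqP; move: g hg; apply: word_eq0 => [|c].
  by move: a b @s; apply: polyfunmxB => //; [exact: polyfunmx_word | exact: polyfunmx_id].
rewrite /s (_ : (fun j => _) = toF c); last by apply/funext => j; rewrite aE.
by rewrite subrr mxE.
Qed.

(** The group G_k in coordinates; over the p-adic numbers it is the given filtration, up to a shift
    of the index ([padic_filtrationE]). *)
Definition term_points k : set 'M[F]_N :=
  [set g | points G F g /\ forall j : 'I_n, (k <= j)%N -> alpha j g = 0].

Lemma alpha1 j : alpha j 1 = 0.
Proof. by rewrite -(@word0 _ _ x F (fun=> 0))// alpha_word. Qed.

Lemma term_points1 k : term_points k 1.
Proof. by split=> [|j _]; [exact: points1 | exact: alpha1]. Qed.

(** Both claims are polynomial identities in the exponents of the two words, so natural exponents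
    suffice. There (h x_i^a)(h' x_i^b) = h'' x_i^(a + b) with h'' in [GF i], by normality. The
    cut-off [tr] keeps the words in G_(i+1) whatever the exponents are. *)
Lemma top_alpha_add (i : 'I_n) g h : term_points i.+1 g -> term_points i.+1 h ->
  alpha i (g * h) = alpha i g + alpha i h /\ forall j : 'I_n, (i < j)%N -> alpha j (g * h) = 0.
Proof.
pose tr (a : 'I_n -> F) (j : 'I_n) := if (j <= i)%N then a j else 0.
have trE u : term_points i.+1 u -> u = word x (tr (fun j => alpha j u)).
  move=> [pu u0]; rewrite -{1}(word_alpha pu); congr (word x _).
  by apply/funext => j; rewrite /tr; case: leqP => // ij; rewrite u0.
move=> hg hh; rewrite {1 3}(trE _ hg) {1 3}(trE _ hh).
pose J := ('I_n + 'I_n)%type.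
pose P (c : J -> F) := word x (tr (fun j => c (inl j))) * word x (tr (fun j => c (inr j))).
have pP : polyfunmx setT (fun j (c : J -> F) => c j) P.
  have ptr (s : 'I_n -> J) j : polyfun setT (fun j (c : J -> F) => c j)
      (fun c => tr (fun k => c (s k)) j).
    rewrite /tr; case: leqP => _; first exact: polyfun_coord.
    exact: polyfun_cst.
  by apply: polyfunmxM => //; apply: polyfunmx_word => // j; exact: ptr.
have paP j : polyfun setT (fun j (c : J -> F) => c j) (fun c => alpha j (P c)).
  apply: (polyfun_comp _ (polyfunW ratT (pa j))) => -[a b]; rewrite /mxentry /=; exact: pP.
pose tz (m : 'I_n -> nat) (j : 'I_n) := if (j <= i)%N then (m j)%:Z else 0 : int.
have tzE m : tr (fun j => (m j)%:R) = toF (tz m).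
  by apply/funext => j; rewrite /tr /tz; case: leqP.
have stz m : supp_lt i.+1 (tz m) by move=> j; rewrite /tz ltnNge => /negPf ->.
have iN := ltn_ord i; have iN' := ltnW iN.
pose ab u := if u is inl j then alpha j g else alpha (if u is inr j then j else i) h.
have -> : word x (tr (fun j => alpha j g)) * word x (tr (fun j => alpha j h)) = P ab by [].
split.
  apply/eqP; rewrite -subr_eq0; apply/eqP.
  have pL : polyfun setT (fun j (c : J -> F) => c j)
      (fun c => alpha i (P c) - (c (inl i) + c (inr i))).
    apply: polyfunB => //; apply: polyfunD; exact: polyfun_coord.
  apply: (polyfun_nat_eq0 F0 pL) => m.
  rewrite /P (tzE (fun j => m (inl j))) (tzE (fun j => m (inr j))).
  set a := tz _; set b := tz _.
  have sa : supp_lt i.+1 a := stz _; have sb : supp_lt i.+1 b := stz _.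
  rewrite (word_split x F sa) (word_split x F sb).
  have ha := word_embed x_basis F0 iN' (supp_lt_upd sa).
  have hb := word_embed x_basis F0 iN' (supp_lt_upd sb).
  have hX : GF i.+1 (mxpower (X i) (a i)%:~R) by exact: embed_term_powz.
  have [h' hh' eX] := embed_term_conj x_basis iN' hb hX.
  rewrite mulrA -[_ * _ * word _ _]mulrA eX mulrA -mulrA -mxpowerD//; last exact: basis_strict.
  have [c sc ->] := embed_word x_basis F0 iN' (embed_term_mul x_basis ha hh').
  have su : supp_lt i.+1 (upd c i (a i + b i)).
    by move=> j ij; rewrite /upd -val_eqE gtn_eqF// sc// ltnW.
  have -> : word x (toF c) = word x (toF (upd (upd c i (a i + b i)) i 0)).
    congr (word x _); apply/funext => j; rewrite /upd; case: eqP => // ->.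
    by rewrite sc.
  have -> : (a i)%:~R + (b i)%:~R = (upd c i (a i + b i) i)%:~R :> F.
    by rewrite /upd eqxx rmorphD.
  rewrite -word_split// aE /upd eqxx rmorphD /= /a /b /tz leqnn.
  by rewrite subrr.
move=> j ij; apply: (polyfun_nat_eq0 F0 (paP j)) => m.
rewrite /P (tzE (fun j => m (inl j))) (tzE (fun j => m (inr j))).
have h1 := word_embed x_basis F0 iN (stz (fun j => m (inl j))).
have h2 := word_embed x_basis F0 iN (stz (fun j => m (inr j))).
have [c sc ->] := embed_word x_basis F0 iN (embed_term_mul x_basis h1 h2).
by rewrite aE sc.
Qed.

Lemma term_pointsM k g h : term_points k g -> term_points k h -> term_points k (g * h).
Proof.
case: (posnP k) => [->|k0] hg hh.
  have E u : term_points 0 u -> u = 1.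
    move=> [pu u0]; rewrite -(word_alpha pu) (@word0 _ _ x F (fun j => alpha j u))// => j.
    by rewrite u0.
  by rewrite (E _ hg) (E _ hh) mulr1; exact: term_points1.
split; first by apply: pointsM => //; [case: hg|case: hh].
have [nk|kn] := leqP n k.-1.
  move=> j kj; have := leq_trans nk (leq_trans (leq_pred k) kj).
  by rewrite leqNgt ltn_ord.
have [||_ +] := @top_alpha_add (Ordinal kn) g h; rewrite /= ?prednK//.
Qed.

Lemma term_pointsS k l : (k <= l)%N -> term_points k `<=` term_points l.
Proof. by move=> kl g [pg hg]; split=> // j lj; apply: hg; exact: leq_trans lj. Qed.

Lemma points_inv g : points G F g -> g * invmx g = 1.
Proof. by move=> hg; exact/mulmxV/strict_lower_unit/(points_strict hg). Qed.

(** Downward induction on [j]: once the coordinates of the inverse beyond [j] vanish, [alpha j] is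
    additive on the product of [g] and its inverse. *)
Lemma term_pointsV k g : term_points k g -> term_points k (invmx g).
Proof.
move=> [pg g0]; have pv := pointsV F0 pg; split=> // j.
have [m] := ubnP (n - j); elim: m j => // m IH j nj kj.
have tg : term_points j.+1 g by split=> // l jl; apply: g0; exact: (leq_trans kj (ltnW jl)).
have tv : term_points j.+1 (invmx g).
  split=> // l jl; apply: IH; last exact: (leq_trans kj (ltnW jl)).
  have := ltn_ord l; move: nj jl; rewrite ltnS => nj jl ln; apply: leq_trans nj.
  by rewrite ltn_sub2l// (ltn_trans jl).
have [] := top_alpha_add tg tv; rewrite points_inv// alpha1 g0// add0r => <- _.
by [].
Qed.

Lemma top_alphaM (i : 'I_n) g h : term_points i.+1 g -> term_points i.+1 h ->
  alpha i (g * h) = alpha i g + alpha i h.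
Proof. by move=> hg hh; have [] := top_alpha_add hg hh. Qed.

Lemma top_alphaV (i : 'I_n) g : term_points i.+1 g -> alpha i (invmx g) = - alpha i g.
Proof.
move=> hg; apply/eqP; rewrite -addr_eq0 addrC -top_alphaM//; last exact: term_pointsV.
by rewrite points_inv ?alpha1//; case: hg.
Qed.

Lemma term_pointsX k g m : term_points k g -> term_points k (g ^+ m).
Proof.
move=> hg; elim: m => [|m IH]; first exact: term_points1.
by rewrite exprS; exact: term_pointsM.
Qed.

Lemma top_alphaX (i : 'I_n) g m : term_points i.+1 g -> alpha i (g ^+ m) = m%:R * alpha i g.
Proof.
move=> hg; elim: m => [|m IH]; first by rewrite mul0r alpha1.
by rewrite exprS top_alphaM//; [rewrite IH -natr1 mulrDl mul1r addrC | exact: term_pointsX].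
Qed.

Lemma alpha_power_poly g j : exists Q : {poly F}, forall t, alpha j (mxpower g t) = Q.[t].
Proof.
apply: polyfun1; apply: (polyfun_comp _ (polyfunW ratT (pa j))) => -[a b].
rewrite /mxentry /=; move: a b; apply: polyfunmx_power => //.
  exact: (polyfun_coord _ _ tt).
exact: polyfunmx_cst.
Qed.

Lemma top_alpha_power (i : 'I_n) g t : term_points i.+1 g ->
  alpha i (mxpower g t) = t * alpha i g.
Proof.
move=> hg; have [pg _] := hg; have [Q hQ] := alpha_power_poly g i.
have QE : Q - alpha i g *: 'X = 0.
  apply: (poly_nat_eq0 F0) => m; rewrite hornerD hornerN hornerZ hornerX -hQ.
  by rewrite mxpower_nat ?top_alphaX// 1?mulrC ?subrr//; exact: points_strict.
by rewrite hQ; move/eqP: QE; rewrite subr_eq0 => /eqP ->; rewrite hornerZ hornerX mulrC.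
Qed.

Lemma alpha_basis_power (i : 'I_n) t j :
  alpha j (mxpower (X i) t) = if j == i then t else 0.
Proof.
pose a j := if j == i then t else 0.
have -> : mxpower (X i) t = word x a; last by rewrite alpha_word.
rewrite (@wordn_full _ _ x F a i.+1 (ltn_ord i)); last first.
  by move=> k ik; rewrite /a -val_eqE gtn_eqF.
rewrite wordnS {2}/a eqxx -[LHS]mul1r; congr (_ * _).
rewrite -(@word0 _ _ x F (fun=> 0))// (@wordn_full _ _ x F (fun=> 0) i (ltnW (ltn_ord i)))//.
by apply: eq_wordn => k ki; rewrite /a -val_eqE ltn_eqF.
Qed.

Lemma term_points_basis_power (i : 'I_n) k t : (i < k)%N -> term_points k (mxpower (X i) t).
Proof.
move=> ik; split.
  by apply: points_power; apply: points_map; exact: basis_points.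
move=> j kj; rewrite alpha_basis_power -val_eqE gtn_eqF//.
exact: leq_trans kj.
Qed.

Lemma term_points_word k (a : 'I_n -> F) : supp_lt k a -> term_points k (word x a).
Proof. by move=> ha; split=> [|j kj]; [exact: points_word | rewrite alpha_word ha]. Qed.

End MalcevCoordinates.

(** * The p-adic norm *)

Section RatEmbedding.
Context (F : fieldType) (F0 : [pchar F] =i pred0).

Let int_neq0 (m : int) : m != 0 -> (m%:~R : F) != 0.
Proof. by rewrite intr_eq0_char0. Qed.

Lemma ratr_frac (a b : int) : b != 0 -> ratr (a%:~R / b%:~R) = a%:~R / b%:~R :> F.
Proof.
move=> b0; rewrite /ratr; set q : rat := (X in numq X).
have dq0 : ((denq q)%:~R : F) != 0 by rewrite int_neq0 ?denq_neq0.
apply/eqP; rewrite eqr_div ?int_neq0// -!rmorphM /=; apply/eqP; congr (_%:~R).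
have b0' : (b%:~R : rat) != 0 by rewrite intr_eq0.
apply: (@intr_inj rat); rewrite !rmorphM /= numqE /q.
by rewrite mulrAC divfK// mulrC.
Qed.

Lemma ratr_char0D (q r : rat) : ratr (q + r) = ratr q + ratr r :> F.
Proof.
rewrite -{1}[q]divq_num_den -{1}[r]divq_num_den.
have dq : (denq q)%:~R != 0 :> rat by rewrite intr_eq0 denq_neq0.
have dr : (denq r)%:~R != 0 :> rat by rewrite intr_eq0 denq_neq0.
rewrite addf_div// -!rmorphM -rmorphD /= ratr_frac ?mulf_neq0 ?denq_neq0//.
by rewrite rmorphD !rmorphM /= -addf_div ?int_neq0 ?denq_neq0.
Qed.

Lemma ratr_char0M (q r : rat) : ratr (q * r) = ratr q * ratr r :> F.
Proof.
rewrite -{1}[q]divq_num_den -{1}[r]divq_num_den.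
rewrite mulf_div -!rmorphM /= ratr_frac ?mulf_neq0 ?denq_neq0//.
by rewrite !rmorphM /= mulf_div.
Qed.

Definition ratr_char0 (q : rat) : F := ratr q.

(** [padic_closure] embeds rational matrices by [ratr]; as a ring morphism it carries points to
    points and subgroups to subgroups. *)
Lemma ratr_char0_exists : exists f : {rmorphism rat -> F}, forall q, f q = ratr q.
Proof.
have add : zmod_morphism ratr_char0.
  move=> q r; rewrite /ratr_char0 ratr_char0D; congr (_ + _).
  apply/eqP; rewrite -addr_eq0 -ratr_char0D addNr.
  by have := @ratr_frac 0 1 isT; rewrite mul0r => ->; rewrite mul0r.
have mul : monoid_morphism ratr_char0.
  split; last exact: ratr_char0M.
  by have := @ratr_frac 1 1 isT; rewrite /ratr_char0 !divr1.
pose a := GRing.isZmodMorphism.Build _ _ ratr_char0 add.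
pose m := GRing.isMonoidMorphism.Build _ _ ratr_char0 mul.
pose f : {rmorphism rat -> F} := HB.pack ratr_char0 a m.
by exists f.
Qed.

End RatEmbedding.

Section PadicArith.
Context (p : nat) (p_pr : prime p).
Local Notation Zp := (padic_int p_pr).
Local Notation Qp := (padic p_pr).
Local Notation toQ := (@padic_of_int p p_pr).
Let p0 : (0 < p)%N := prime_gt0 p_pr.
Let p1 : (1 < p)%N := prime_gt1 p_pr.

Lemma residue_nat (m k : nat) : (m%:R : Zp) k = (m %% p ^ k)%N.
Proof.
elim: m => [|m IH]; first by rewrite mulr0n.
by rewrite -natr1 /= IH modnDml modnDmr addn1.
Qed.

Lemma pchar_Zp_nat m : ((m%:R : Zp) == 0) = (m == 0)%N.
Proof.
apply/eqP/eqP => [e|->//]; have := residue_nat m m; rewrite e [LHS]mod0n.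
by rewrite modn_small// ltn_expl.
Qed.

Lemma toQ_inj : injective toQ.
Proof. by move=> a b /eqP; rewrite /padic_of_int tofrac_eq => /eqP. Qed.

Lemma toQ_neq0 a : (toQ a != 0) = (a != 0).
Proof. by rewrite /padic_of_int tofrac_eq0. Qed.

Lemma pchar_Qp : [pchar Qp] =i pred0.
Proof.
apply/pcharf0P => m; rewrite -(rmorph_nat toQ) -[0](rmorph0 toQ).
by rewrite (inj_eq toQ_inj) pchar_Zp_nat.
Qed.

(** Bezout gives an inverse modulo each power of p. They are coherent because f(k + 2) and f(k + 1)
    are both congruent to f(k + 2) f(k + 1) a(k + 1) modulo p^(k + 1). *)
Lemma Zp_unit (a : Zp) : a 1%N != 0%N -> exists b, b * a = 1.
Proof.
move=> a1; have cop k : coprime (a k) (p ^ k).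
  case: k => [|k]; first by rewrite expn0 coprimen1.
  apply: coprimeXr; rewrite coprime_sym prime_coprime//; apply: contra a1 => pa.
  by rewrite -(residue_mod a (ltn0Sn k)) expn1; exact: pa.
pose f k := (egcdn (a k) (p ^ k)).1.
have fE k : (0 < k)%N -> (f k * a k = 1 %[mod p ^ k])%N.
  move=> k0; have ak : (0 < a k)%N.
    rewrite lt0n; apply: contraTneq (cop k) => ->.
    by rewrite /coprime gcd0n; apply/eqP => e; have := ltn_expl k p1; rewrite e; case: (k) k0.
  by rewrite /f; case: egcdnP => //= u v -> _; rewrite (eqP (cop k)) modnMDl.
have fc : coherent p f.
  case=> [|k]; first by rewrite expn0 !modn1.
  have h1 : (f k.+2 * a k.+1 = 1 %[mod p ^ k.+1])%N.
    have /(congr1 (fun u => u %% p ^ k.+1)%N) := fE k.+2 isT.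
    by rewrite !modn_dvdm ?dvdn_exp2l// -modnMmr residueS.
  transitivity ((f k.+2 * (f k.+1 * a k.+1)) %% p ^ k.+1)%N.
    by rewrite -[RHS]modnMmr fE// modnMmr muln1.
  by rewrite mulnCA -modnMmr h1 modnMmr muln1.
exists (mk_padic p_pr fc); apply: padic_intP => -[|k].
  by rewrite /= !modn1.
by rewrite /= modnMml fE.
Qed.

(** Division by p^v costs v digits of precision, hence the shift from [k] to [k + v] in the
    residues. *)
Lemma Zp_divide v (a : Zp) : a v = 0%N -> exists c : Zp,
  a = (p ^ v)%:R * c /\ forall k, (c k * p ^ v)%N = a (k + v)%N.
Proof.
move=> av; have pv0 : (0 < p ^ v)%N by rewrite expn_gt0 p0.
have dv k : (p ^ v %| a (k + v))%N by rewrite /dvdn residue_mod ?leq_addl// av.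
pose f k := (a (k + v) %/ p ^ v)%N.
have fE k : (f k * p ^ v = a (k + v))%N by rewrite divnK.
have fk k : (f k < p ^ k)%N.
  by rewrite -(ltn_pmul2r pv0) fE -expnD residue_lt.
have fc : coherent p f.
  move=> k; apply/eqP; rewrite -(eqn_pmul2r pv0) !muln_modl !fE -expnD.
  by rewrite !residue_mod ?leq_add2r ?residue_id// leqnSn.
exists (mk_padic p_pr fc); split => [|k]; last by rewrite /= modn_small.
apply: padic_intP => k; rewrite [RHS]/= residue_nat modnMml modnMmr.
rewrite mulnC fE residue_mod//; exact: leq_addr.
Qed.

Lemma Zp_factor (a : Zp) : a != 0 -> exists u w : Zp, w * u = 1 /\ a = (p ^ padic_val a)%:R * u.
Proof.
move=> a0; have /eqP av : a (padic_val a) == 0%N by rewrite padic_valP.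
have [u [aE uE]] := Zp_divide av; have [|w wu] := @Zp_unit u; last by exists u, w.
apply/eqP => u1; have := uE 1%N; rewrite u1 mul0n => /esym/eqP.
by rewrite padic_valP// add1n ltnn.
Qed.

Lemma padic_norm_toQ (z : Zp) : padic_norm (toQ z) = padic_int_norm z.
Proof.
have := @padic_norm_frac p p_pr z 1 (oner_neq0 _).
rewrite rmorph1 divr1 => ->.
have n1 : padic_int_norm (1 : Zp) = 1.
  have /eqP := padic_int_normM (1 : Zp) 1; rewrite mulr1 -subr_eq0 -{1}[padic_int_norm 1]mulr1 -mulrBr.
  by rewrite mulf_eq0 padic_int_norm_eq0 oner_eq0 subr_eq0 => /eqP.
by rewrite n1 divr1.
Qed.

Lemma padic_int_norm_le (z : Zp) k : (padic_int_norm z <= p%:R ^- k) = (z k == 0)%N.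
Proof.
have [->|z0] := eqVneq z 0.
  rewrite /padic_int_norm eqxx invr_ge0 exprn_ge0 ?ler0n//.
  by apply/esym/eqP; exact: mod0n.
rewrite /padic_int_norm (negPf z0) padic_valP//.
by rewrite lef_pV2 ?posrE ?exprn_gt0 ?ltr0n// ler_eXn2l// ltr1n.
Qed.

Lemma padic_norm_toQ_le1 z : padic_norm (toQ z) <= 1.
Proof.
rewrite padic_norm_toQ; have := padic_int_norm_le z 0; rewrite expr0 invr1 => ->.
by rewrite -leqn0 -ltnS -[X in (_ < X)%N](expn0 p) residue_lt.
Qed.

Lemma padic_norm_le1P (x : Qp) : padic_norm x <= 1 -> exists z, x = toQ z.
Proof.
elim/padic_ind: x => a b b0; rewrite padic_norm_frac//.
have [->|a0] := eqVneq a 0; first by exists 0; rewrite rmorph0 mul0r.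
have nb : 0 < padic_int_norm b by rewrite lt_def padic_int_norm_eq0 b0 padic_int_norm_ge0.
rewrite ler_pdivrMr// mul1r {2}/padic_int_norm (negPf b0) padic_int_norm_le => /eqP av.
have [c [aE _]] := Zp_divide av; have [u [w [wu bE]]] := Zp_factor b0.
exists (c * w); have B0 : toQ b != 0 by rewrite toQ_neq0.
apply: (mulIf B0); rewrite divfK// -rmorphM; congr toQ.
move: aE bE; set P := (p ^ _)%:R => aE bE.
by rewrite aE [in RHS]bE mulrACA wu mulr1 mulrC.
Qed.

Lemma padic_norm1 : padic_norm (1 : Qp) = 1.
Proof.
have := padic_normM (1 : Qp) 1; rewrite mulr1 => /eqP; rewrite -subr_eq0 -{1}[padic_norm 1]mulr1 -mulrBr.
by rewrite mulf_eq0 padic_norm_eq0 oner_eq0 subr_eq0 => /eqP.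
Qed.

Lemma padic_norm0 : padic_norm (0 : Qp) = 0.
Proof. by apply/eqP; rewrite padic_norm_eq0. Qed.

Lemma padic_normV (x : Qp) : padic_norm x^-1 = (padic_norm x)^-1.
Proof.
have [->|x0] := eqVneq x 0; first by rewrite invr0 padic_norm0 invr0.
have nx : padic_norm x != 0 by rewrite padic_norm_eq0.
by apply: (mulIf nx); rewrite -padic_normM !mulVf ?padic_norm1.
Qed.

Lemma padic_normX (x : Qp) k : padic_norm (x ^+ k) = padic_norm x ^+ k.
Proof. by elim: k => [|k IH]; rewrite ?expr0 ?padic_norm1// !exprS padic_normM IH. Qed.

Lemma padic_norm_nat_le1 m : padic_norm (m%:R : Qp) <= 1.
Proof. by rewrite -(rmorph_nat toQ) padic_norm_toQ_le1. Qed.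

Lemma padic_norm_int_le1 (m : int) : padic_norm (m%:~R : Qp) <= 1.
Proof.
by case: m => k; rewrite ?NegzE ?mulrNz ?padic_normN -pmulrn padic_norm_nat_le1.
Qed.

Lemma padic_norm_p : padic_norm (p%:R : Qp) = p%:R^-1.
Proof.
rewrite -(rmorph_nat toQ) padic_norm_toQ.
have pn0 : (p%:R : Zp) != 0 by rewrite pchar_Zp_nat -lt0n.
rewrite /padic_int_norm (negPf pn0); suff -> : padic_val (p%:R : Zp) = 1%N by rewrite expr1.
have E k : (k <= padic_val (p%:R : Zp))%N = (p ^ k %| p)%N.
  by rewrite -padic_valP// residue_nat.
apply/eqP; rewrite eqn_leq E expn1 dvdnn andbT leqNgt E.
by rewrite -{2}[p]expn1 dvdn_Pexp2l.
Qed.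

Lemma padic_norm_int_dvd (m : int) k : padic_norm (m%:~R : Qp) <= p%:R ^- k -> (p ^ k %| `|m|)%N.
Proof.
have -> : padic_norm (m%:~R : Qp) = padic_norm (`|m|%N%:R : Qp).
  by case: m => j; rewrite ?NegzE ?mulrNz ?padic_normN -?pmulrn.
by rewrite -(rmorph_nat toQ) padic_norm_toQ padic_int_norm_le residue_nat.
Qed.

Lemma Zp_approx (z : Zp) k : padic_norm (toQ z - (z k)%:R) <= p%:R ^- k.
Proof.
rewrite -(rmorph_nat toQ) -rmorphB padic_norm_toQ padic_int_norm_le.
rewrite [X in X == _]/= modnDmr -/(dvdn _ _).
have -> : ((z k)%:R : Zp) k = z k by rewrite residue_nat residue_id.
by rewrite subnKC ?modnn//; exact/ltnW/residue_lt.
Qed.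

Lemma pX_small (e : rat) : 0 < e -> exists k, p%:R ^- k < e.
Proof.
move=> e0; pose k := Num.bound e^-1; exists k.
rewrite invf_plt ?posrE ?exprn_gt0 ?ltr0n//.
have := archi_boundP (ltW (_ : 0 < e^-1)); rewrite invr_gt0 => /(_ e0) h.
apply: lt_le_trans h _; rewrite -natrX ler_nat; exact/ltnW/ltn_expl.
Qed.

Lemma padic_int_approx (x : Qp) e : padic_norm x <= 1 -> 0 < e ->
  exists m : nat, padic_norm (x - m%:R) < e.
Proof.
move=> /padic_norm_le1P[z ->] /pX_small[k ke]; exists (z k).
exact: le_lt_trans (Zp_approx z k) ke.
Qed.

Lemma padic_norm_bounded (x : Qp) : exists k, padic_norm (p%:R ^+ k * x) <= 1.
Proof.
have [->|x0] := eqVneq x 0; first by exists 0%N; rewrite mulr0 padic_norm0.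
have nx : 0 < (padic_norm x)^-1 by rewrite invr_gt0 lt_def padic_norm_eq0 x0 padic_norm_ge0.
have [k hk] := pX_small nx; exists k; rewrite padic_normM padic_normX padic_norm_p.
rewrite exprVn -ler_pdivlMr ?div1r ?ltW//; by rewrite -invr_gt0.
Qed.

Lemma padic_approx (x : Qp) e : 0 < e ->
  exists m k : nat, padic_norm (x - m%:R / p%:R ^+ k) < e.
Proof.
move=> e0; have [k hk] := padic_norm_bounded x.
have pk : 0 < (p%:R : rat) ^- k by rewrite invr_gt0 exprn_gt0// ltr0n.
have [m hm] := padic_int_approx hk (mulr_gt0 pk e0); exists m, k.
have pn0 : (p%:R : Qp) ^+ k != 0.
  by rewrite expf_neq0//; move/pcharf0P: pchar_Qp => ->; rewrite -lt0n.
move: hm; have -> : p%:R ^+ k * x - m%:R = p%:R ^+ k * (x - m%:R / p%:R ^+ k).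
  by rewrite mulrBr mulrCA divff// mulr1.
by rewrite padic_normM padic_normX padic_norm_p exprVn ltr_pM2l.
Qed.

Lemma padic_norm_pow (x : Qp) : x != 0 -> padic_norm x <= 1 -> exists k, padic_norm x = p%:R ^- k.
Proof.
move=> x0 /padic_norm_le1P[z xz]; rewrite xz padic_norm_toQ /padic_int_norm.
by rewrite xz toQ_neq0 in x0; exists (padic_val z); rewrite (negPf x0).
Qed.

End PadicArith.

(** * Closures of subgroups *)

Section PadicTopology.
Context (p : nat) (p_pr : prime p).
Local Notation Qp := (padic p_pr).
Implicit Types a b : Qp.
Let p0 : (0 < p)%N := prime_gt0 p_pr.
Let p1 : (1 < p)%N := prime_gt1 p_pr.

(** Closed balls of radius p^-k: by the ultrametric inequality, sums lose no precision. *)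
Definition close k a b := padic_norm (a - b) <= p%:R ^- k.

Lemma pX_gt0 k : 0 < (p%:R : rat) ^- k.
Proof. by rewrite invr_gt0 exprn_gt0// ltr0n. Qed.

Lemma pX_le k l : (k <= l)%N -> (p%:R : rat) ^- l <= p%:R ^- k.
Proof. by move=> kl; rewrite lef_pV2 ?posrE ?exprn_gt0 ?ltr0n// ler_weXn2l// ler1n. Qed.

Lemma closeW k l a b : (k <= l)%N -> close l a b -> close k a b.
Proof. by move=> kl h; apply: le_trans h (pX_le kl). Qed.

Lemma close_refl k a : close k a a.
Proof. by rewrite /close subrr padic_norm0 ltW// pX_gt0. Qed.

Lemma padic_norm_sum_le a b (e : rat) : padic_norm a <= e -> padic_norm b <= e -> padic_norm (a + b) <= e.
Proof. by move=> ha hb; apply: le_trans (padic_normD a b) _; rewrite ge_max ha hb. Qed.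

Lemma closeD k a a' b b' : close k a a' -> close k b b' -> close k (a + b) (a' + b').
Proof.
move=> ha hb; rewrite /close opprD addrACA; exact: padic_norm_sum_le.
Qed.

Lemma close_norm k a b (e : rat) : p%:R ^- k <= e -> close k a b -> padic_norm b <= e ->
  padic_norm a <= e.
Proof.
move=> ke ab hb; rewrite -[a](subrK b); apply: padic_norm_sum_le => //.
exact: le_trans ab ke.
Qed.

Lemma close_sym k a b : close k a b -> close k b a.
Proof. by rewrite /close -padic_normN opprB. Qed.

Lemma padic_norm_pX_bound a : exists A, padic_norm a <= p%:R ^+ A.
Proof.
have [A hA] := padic_norm_bounded a; exists A; move: hA.
rewrite padic_normM padic_normX padic_norm_p exprVn mulrC ler_pdivrMr ?mul1r//.
by rewrite exprn_gt0// ltr0n.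
Qed.

Lemma closeM k a b : exists l, forall a' b', close l a a' -> close l b b' ->
  close k (a * b) (a' * b').
Proof.
have [A hA] := padic_norm_pX_bound a; have [B hB] := padic_norm_pX_bound b.
(* As |a| is at most p^A and |b| at most p^B, this precision makes each of the three terms of the
   expansion below at most p^-k. *)
exists (k + A + B)%N => a' b' ha hb; rewrite /close.
have pn C : (p%:R : rat) ^+ C != 0 by rewrite expf_neq0// pnatr_eq0 -lt0n.
have -> : a * b - a' * b' = a * (b - b') + ((a - a') * b + - ((a - a') * (b - b'))).
  by rewrite !mulrBl !mulrBr; ring.
have sp C D : (p%:R : rat) ^+ C * p%:R ^- (C + D) = p%:R ^- D.
  by rewrite exprD invfM mulrA divff// mul1r.
apply: padic_norm_sum_le; last apply: padic_norm_sum_le.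
- rewrite padic_normM; apply: le_trans (ler_pM _ _ hA hb) _; rewrite ?padic_norm_ge0//.
  by rewrite addnAC addnC sp pX_le// leq_addr.
- rewrite padic_normM mulrC; apply: le_trans (ler_pM _ _ hB ha) _; rewrite ?padic_norm_ge0//.
  by rewrite addnC sp pX_le// leq_addr.
- rewrite padic_normN padic_normM; apply: le_trans (ler_pM _ _ ha hb) _; rewrite ?padic_norm_ge0//.
  rewrite -invfM -exprD pX_le// -!addnA; exact: leq_addr.
Qed.

(** Closeness of arguments is measured through the coordinates [c], so the same statement covers
    matrices, pairs of matrices and exponents. *)
Lemma polyfun_continuous T I (c : I -> T -> Qp) f : polyfun setT c f ->
  forall t k, exists l, forall t', (forall i, close l (c i t) (c i t')) -> close k (f t) (f t').
Proof.
move=> pf t; elim: pf => [a _|i|g h _ IHg _ IHh|g h _ IHg _ IHh] k.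
- by exists 0%N => t' _; exact: close_refl.
- by exists k => t'; apply.
- have [l hl] := IHg k; have [m hm] := IHh k; exists (maxn l m) => t' ht'.
  by apply: closeD; [apply: hl|apply: hm] => i; apply: closeW (ht' i); rewrite leq_max leqnn ?orbT.
- have [r hr] := closeM k (g t) (h t).
  have [l hl] := IHg r; have [m hm] := IHh r; exists (maxn l m) => t' ht'.
  by apply: hr; [apply: hl|apply: hm] => i; apply: closeW (ht' i); rewrite leq_max leqnn ?orbT.
Qed.

Definition closemx N k (g h : 'M[Qp]_N) := forall i j, close k (g i j) (h i j).

Lemma polyfunmx_continuous N T I (c : I -> T -> Qp) (M : T -> 'M[Qp]_N) :
  polyfunmx setT c M -> forall t k, exists l, forall t',
  (forall i, close l (c i t) (c i t')) -> closemx k (M t) (M t').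
Proof.
move=> pM t k.
have /choice[l hl] : forall ij : 'I_N * 'I_N, exists l, forall t',
    (forall i, close l (c i t) (c i t')) -> close k (M t ij.1 ij.2) (M t' ij.1 ij.2).
  by move=> [i j]; exact: (polyfun_continuous (pM i j)).
exists (\max_ij l ij) => t' ht' i j; apply: (hl (i, j)) => u.
by apply: closeW (ht' u); exact: (leq_bigmax (F := l) (i, j)).
Qed.

Lemma closure_mxP N (X : set 'M[Qp]_N) g :
  closure X g <-> forall k, exists2 h, X h & closemx k g h.
Proof.
have ballE a e b : ball (a : Qp) e b <-> padic_norm (a - b) < e by rewrite ballEmdist.
split=> [Xg k|Xg B /nbhs_ballP[e /= e0 eB]].
  have /Xg[h [Xh [_ gh]]] : nbhs g (ball g (p%:R ^- k : rat)).
    by apply/nbhs_ballP; exists (p%:R ^- k) => //=; exact: pX_gt0.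
  by exists h => // i j; apply/ltW/ballE; exact: gh.
have [k ke] := pX_small p_pr e0; have [h Xh gh] := Xg k; exists h; split=> //.
by apply: eB; split=> // i j; apply/ballE; exact: le_lt_trans (gh i j) ke.
Qed.

End PadicTopology.

Section ClosedSubgroups.
Context (G : unipotent_Zgroup) (p : nat) (p_pr : prime p).
Local Notation N := (Defs.msize G).
Local Notation Qp := (padic p_pr).
Let Q0 : [pchar Qp] =i pred0 := pchar_Qp p_pr.

Lemma ratsetT (F : fieldType) : ratset F `<=` setT. Proof. by []. Qed.

Lemma unipotent_powerE (g : 'M[Qp]_N) a : @unipotent_power G p p_pr g a = mxpower g a.
Proof. by rewrite /unipotent_power /mxpower; apply: eq_bigr. Qed.

(** Multiplication is polynomial, and so is inversion of unitriangular matrices, written as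
    [mxpower g (- 1)]; both are therefore continuous. *)
Lemma closure_in_G_subgroup X : is_subgroup X -> X `<=` points G Qp ->
  is_subgroup (@closure_in_G G p p_pr X).
Proof.
move=> [_ X1 XM XV] XG; split.
- by move=> g [_ /points_strict]; exact: strict_lower_unit.
- split; last exact: points1.
  by apply/closure_mxP => k; exists 1%:M => // i j; exact: close_refl.
- move=> g h [/closure_mxP cg pg] [/closure_mxP ch ph]; split; last exact: pointsM.
  apply/closure_mxP => k.
  pose c (i : bool * ('I_N * 'I_N)) (t : 'M[Qp]_N * 'M[Qp]_N) :=
    mxentry i.2 (if i.1 then t.1 else t.2).
  have pc : polyfunmx setT c (fun t => t.1 * t.2).
    apply: polyfunmxM; first exact: ratsetT.
      by move=> i j; exact: (polyfun_coord _ _ (true, (i, j))).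
    by move=> i j; exact: (polyfun_coord _ _ (false, (i, j))).
  have [l hl] := polyfunmx_continuous pc (g, h) k.
  have [g' Xg' gg'] := cg l; have [h' Xh' hh'] := ch l.
  exists (g' *m h'); first exact: XM.
  by apply: (hl (g', h')) => -[[] [i j]]; [exact: gg' | exact: hh'].
- move=> g [/closure_mxP cg pg]; split; last exact: pointsV.
  apply/closure_mxP => k.
  have pid : polyfunmx setT (@mxentry Qp N) (fun g => g).
    by move=> i j; exact: (polyfun_coord _ _ (i, j)).
  have pc := polyfunmx_inv Q0 (@ratsetT Qp) pid.
  have [l hl] := polyfunmx_continuous pc g k.
  have [h Xh gh] := cg l; exists (invmx h); first exact: XV.
  rewrite (invmx_power Q0 (points_strict pg)) (invmx_power Q0 (points_strict (XG _ Xh))).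
  by apply: hl => -[i j]; exact: gh.
Qed.

Lemma sub_closure_in_G X : X `<=` points G Qp -> X `<=` @closure_in_G G p p_pr X.
Proof.
move=> XG g Xg; split; last exact: XG.
by apply/closure_mxP => k; exists g => // i j; exact: close_refl.
Qed.

(** An exponent in Z_p is a limit of natural numbers, and the power depends continuously on its
    exponent. *)
Lemma closure_in_G_power X g t : is_subgroup X -> X g -> points G Qp g ->
  points G Qp (mxpower g t) -> padic_norm t <= 1 ->
  @closure_in_G G p p_pr X (mxpower g t).
Proof.
move=> sX Xg pg pgt t1; split=> //; apply/closure_mxP => k.
have pc : polyfunmx setT (fun (_ : unit) (t : Qp) => t) (fun t => mxpower g t).
  apply: (polyfunmx_power Q0 (@ratsetT Qp)); first exact: (polyfun_coord _ _ tt).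
  exact: polyfunmx_cst.
have [l hl] := polyfunmx_continuous pc t k.
have [m hm] := padic_int_approx t1 (pX_gt0 p_pr l).
exists (g ^+ m); first exact: subgroupX.
rewrite -(mxpower_nat Q0 m (points_strict pg)); apply: hl => _; exact: ltW.
Qed.

End ClosedSubgroups.

(** * Integral coordinates *)

Section PFrac.
Context (F : fieldType) (F0 : [pchar F] =i pred0) (p : nat) (p_pr : prime p).
Let pn0 k : (p%:R : F) ^+ k != 0.
Proof. by rewrite expf_neq0//; move/pcharf0P: F0 => ->; rewrite -lt0n prime_gt0. Qed.

Definition pfrac : set F := [set z | exists k, exists m : int, p%:R ^+ k * z = m%:~R].

Lemma pfrac_int m : pfrac m%:~R.
Proof. by exists 0%N, m; rewrite expr0 mul1r. Qed.

Lemma pfracD a b : pfrac a -> pfrac b -> pfrac (a + b).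
Proof.
move=> [k [m hm]] [l [j hj]]; exists (k + l)%N, ((p ^ l)%N%:Z * m + (p ^ k)%N%:Z * j).
rewrite exprD mulrDr rmorphD !rmorphM /= -hm -hj -!pmulrn !natrX.
by congr (_ + _); rewrite ?mulrA// [_ ^+ l * _]mulrC.
Qed.

Lemma pfracM a b : pfrac a -> pfrac b -> pfrac (a * b).
Proof.
move=> [k [m hm]] [l [j hj]]; exists (k + l)%N, (m * j).
by rewrite exprD mulrACA hm hj rmorphM.
Qed.

(* Modulo the part of [l!] prime to [p], [m] is congruent to some [d p^k], and
   [d (d - 1) ... (d - l + 1)] is divisible by [l!]. *)
Lemma pfrac_gbinom (m k l : nat) : pfrac (gbinom (m%:R / p%:R ^+ k) l).
Proof.
pose u := (l`!`_p^')%N; pose v := logn p l`!.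
have lE : (l`! = p ^ v * u)%N by rewrite -[LHS](partnC p (fact_gt0 l)) p_part.
have cop : coprime (p ^ k) u.
  apply: coprimeXl; rewrite (@pnat_coprime p)//; first by rewrite pnat_id.
  exact: part_pnat.
have u0 : (0 < u)%N by exact: part_gt0.
have pk0 : (0 < p ^ k)%N by rewrite expn_gt0 prime_gt0.
pose d := (m * (egcdn (p ^ k) u).1)%N.
have dE : (d * p ^ k = m %[mod u])%N.
  rewrite /d; case: egcdnP => //= a b ab _.
  by rewrite -mulnA ab (eqP cop) mulnDr muln1 mulnA modnMDl.
have cong : (\prod_(j < l) (m%:Z - (j * p ^ k)%N%:Z) =
    \prod_(j < l) ((d * p ^ k)%N%:Z - (j * p ^ k)%N%:Z) %[mod u])%Z.
  apply: (big_ind2 (fun a b => (a = b %[mod u])%Z)) => //.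
    by move=> a b a' b' h h'; rewrite -modzMml h modzMml -modzMmr h' modzMmr.
  by move=> j _; rewrite -modzDml modz_nat -dE -modz_nat modzDml.
have fallE : \prod_(j < l) (d%:Z - j%:Z) = (l`! * 'C(d, l))%N%:Z.
  apply: (@intr_inj rat); rewrite rmorph_prod -pmulrn natrM -(gbinom_nat (@pchar_num _)).
  rewrite /gbinom mulrC divfK ?pnatr_eq0 -?lt0n ?fact_gt0//.
  by apply: eq_bigr => j _; rewrite rmorphB.
have div : (u%:Z %| \prod_(j < l) (m%:Z - (j * p ^ k)%N%:Z))%Z.
  apply/dvdz_mod0P; rewrite cong; apply/dvdz_mod0P.
  have -> : \prod_(j < l) ((d * p ^ k)%N%:Z - (j * p ^ k)%N%:Z) =
      (\prod_(j < l) (d%:Z - j%:Z)) * \prod_(j < l) (p ^ k)%N%:Z.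
    by rewrite -big_split; apply: eq_bigr => j _; rewrite /= mulrBl -!PoszM.
  by rewrite fallE dvdz_mulr// lE dvdzE /= -mulnA dvdn_mull// dvdn_mulr.
have /dvdzP[w wE] := div.
(* p^(kl) clears the denominators of the [l] factors and p^v the p-part of the factorial; the
   remaining denominator [u] divides the product by [div]. *)
exists (k * l + v)%N, w; rewrite /gbinom.
have uF : (u%:R : F) != 0 by move/pcharf0P: F0 => ->; rewrite -lt0n.
have -> : p%:R ^+ (k * l + v) * (\prod_(j < l) (m%:R / p%:R ^+ k - j%:R) / l`!%:R) =
    (\prod_(j < l) (m%:R - (j * p ^ k)%N%:R)) / u%:R :> F.
  have -> : \prod_(j < l) (m%:R - (j * p ^ k)%N%:R) =
      p%:R ^+ (k * l) * \prod_(j < l) (m%:R / p%:R ^+ k - j%:R) :> F.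
    rewrite exprM -[X in _ ^+ X]card_ord -prodr_const -big_split; apply: eq_bigr => j _ /=.
    by rewrite mulrBr mulrCA divff// mulr1 natrM natrX mulrC.
  rewrite lE natrM natrX exprD.
  have := pn0 v; move: (\prod_(j < l) _) (p%:R ^+ (k * l)) (p%:R ^+ v) => P a b b0.
  by field; rewrite uF b0.
apply: (mulIf uF); rewrite divfK//.
have -> : \prod_(j < l) (m%:R - (j * p ^ k)%N%:R) =
    (\prod_(j < l) (m%:Z - (j * p ^ k)%N%:Z))%:~R :> F.
  by rewrite rmorph_prod; apply: eq_bigr => j _; rewrite rmorphB.
by rewrite wE rmorphM.
Qed.
End PFrac.
Arguments pfrac : clear implicits.
Arguments pfrac_int : clear implicits.

Section IntegralCoordinates.
Context (G : unipotent_Zgroup).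
Local Notation N := (Defs.msize G).
Context (n : nat) (x : 'I_n -> 'M[int]_N) (x_basis : malcev_basis G x).
Context (p : nat) (p_pr : prime p).
Local Notation Qp := (padic p_pr).
Local Notation toQ := (@padic_of_int p p_pr).
Let Q0 : [pchar Qp] =i pred0 := pchar_Qp p_pr.

Definition intpt N (g : 'M[Qp]_N) := forall i j, padic_norm (g i j) <= 1.

Lemma Zp_pointsP g : Zp_points G p_pr g <-> points G Qp g /\ intpt g.
Proof.
split=> [[h hh <-]|[pg ig]].
  by split; [exact: points_map | move=> i j; rewrite mxE padic_norm_toQ_le1].
have /choice[z hz] : forall ij : 'I_N * 'I_N, exists z, g ij.1 ij.2 = toQ z.
  by move=> ij; apply: padic_norm_le1P; exact: ig.
have gE : g = map_mx toQ (\matrix_(i, j) z (i, j)).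
  by apply/matrixP => i j; rewrite !mxE -hz.
exists (\matrix_(i, j) z (i, j)) => //.
by apply: (points_map_inj (@toQ_inj p p_pr)); rewrite -gE.
Qed.

Lemma intpt1 M : intpt (1 : 'M[Qp]_M).
Proof. by move=> i j; rewrite mxE padic_norm_nat_le1. Qed.

Lemma intptD M (g h : 'M[Qp]_M) : intpt g -> intpt h -> intpt (g + h).
Proof. by move=> hg hh i j; rewrite mxE; exact: padic_norm_sum_le. Qed.

Lemma intptZ M c (g : 'M[Qp]_M) : padic_norm c <= 1 -> intpt g -> intpt (c *: g).
Proof. by move=> hc hg i j; rewrite mxE padic_normM mulr_ile1 ?padic_norm_ge0. Qed.

Lemma intptM M (g h : 'M[Qp]_M) : intpt g -> intpt h -> intpt (g * h).
Proof.
move=> hg hh i j; rewrite mxE; apply: (big_ind (fun u : Qp => padic_norm u <= 1)) => [||k _].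
- by rewrite padic_norm0 ler01.
- by move=> a b; exact: padic_norm_sum_le.
- by rewrite padic_normM mulr_ile1 ?padic_norm_ge0.
Qed.

Lemma intptX M (g : 'M[Qp]_M) k : intpt g -> intpt (g ^+ k).
Proof.
move=> hg; elim: k => [|k IH]; first exact: intpt1.
by rewrite exprS; exact: intptM.
Qed.

(** Natural numbers approximate [t], and their binomial coefficients are integers. *)
Lemma gbinom_integral (t : Qp) k : padic_norm t <= 1 -> padic_norm (gbinom t k) <= 1.
Proof.
move=> t1; have pc : polyfun setT (fun (_ : unit) (t : Qp) => t) (fun t => gbinom t k).
  apply: (polyfun_gbinom Q0 (@ratsetT Qp)); exact: (polyfun_coord _ _ tt).
have [l hl] := polyfun_continuous pc t 0.
have [m hm] := padic_int_approx t1 (pX_gt0 p_pr l).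
have := hl m%:R (fun _ => ltW hm); rewrite (gbinom_nat Q0) => h.
apply: close_norm h _; first by rewrite expr0 invr1.
exact: padic_norm_nat_le1.
Qed.

Lemma intpt_power (g : 'M[Qp]_N) t : padic_norm t <= 1 -> intpt g -> intpt (mxpower g t).
Proof.
move=> t1 hg; rewrite /mxpower; apply: (big_ind (@intpt N)) => [||k _].
- by move=> i j; rewrite mxE padic_norm0 ler01.
- exact: intptD.
- apply: intptZ; first exact: gbinom_integral.
  apply: intptX => i j; rewrite !mxE; apply: padic_norm_sum_le; first exact: hg.
  by rewrite padic_normN padic_norm_nat_le1.
Qed.

Lemma intpt_emb (g : 'M[int]_N) : intpt (map_mx intr g).
Proof. by move=> i j; rewrite mxE padic_norm_int_le1. Qed.

Lemma pfrac_word (m k : 'I_n -> nat) i j :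
  pfrac Qp p (word x (fun l => (m l)%:R / p%:R ^+ k l) i j).
Proof.
pose pmx (g : 'M[Qp]_N) := forall i j, pfrac Qp p (g i j).
have pD (g h : 'M[Qp]_N) : pmx g -> pmx h -> pmx (g + h).
  by move=> hg hh a b; rewrite mxE; exact: pfracD.
have pM (g h : 'M[Qp]_N) : pmx g -> pmx h -> pmx (g * h).
  move=> hg hh a b; rewrite mxE; apply: (big_ind (pfrac Qp p)) => [|u v|c _].
  - exact: (pfrac_int Qp p 0).
  - exact: pfracD.
  - exact: pfracM.
have p1 : pmx 1 by move=> a b; rewrite mxE; exact: (pfrac_int Qp p (a == b)%:Z).
suff : pmx (word x (fun l => (m l)%:R / p%:R ^+ k l)) by [].
rewrite /word; apply: (big_ind pmx) => // l _; rewrite /mxpower; apply: (big_ind pmx) => [|//|r _].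
  by move=> a b; rewrite mxE; exact: (pfrac_int Qp p 0).
have : pmx ((map_mx intr (x l) - 1) ^+ r).
  elim: (r : nat) => [//|s IH]; rewrite exprS; apply: pM => // a b; rewrite !mxE.
  by have := pfrac_int Qp p (x l a b - (a == b)%:Z); rewrite rmorphB.
by move=> h a b; rewrite mxE; apply: pfracM => //; exact: pfrac_gbinom.
Qed.

Lemma pfrac_integral (z : Qp) : pfrac Qp p z -> padic_norm z <= 1 -> exists m : int, z = m%:~R.
Proof.
move=> [k [m hm]] z1.
have pn0 : (p%:R : Qp) ^+ k != 0.
  by rewrite expf_neq0//; move/pcharf0P: Q0 => ->; rewrite -lt0n prime_gt0.
have : padic_norm (m%:~R : Qp) <= p%:R ^- k.
  rewrite -hm padic_normM padic_normX padic_norm_p exprVn -[leRHS]mulr1.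
  by rewrite ler_wpM2l// ltW// pX_gt0.
move=> /padic_norm_int_dvd pm.
have /dvdzP[w wE] : ((p ^ k)%N%:Z %| m)%Z by rewrite dvdzE.
exists w; apply: (mulfI pn0); rewrite hm wE rmorphM /= mulrC; congr (_ * _).
by rewrite -pmulrn natrX.
Qed.

Variable alpha : 'I_n -> 'M[Qp]_N -> Qp.
Hypothesis wordK : forall g, points G Qp g -> word x (fun j => alpha j g) = g.
Hypothesis alphaK : forall a j, alpha j (word x a) = a j.

(* Approximate the coordinates of [g] by elements of [Z[1/p]]: the matrix entries
   of the resulting word lie in the intersection of [Z[1/p]] and [Z_p], which is
   [Z], so that it is a point over [Z] and its coordinates are integers. *)
Lemma alpha_integral g : Zp_points G p_pr g -> forall j, padic_norm (alpha j g) <= 1.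
Proof.
move=> /Zp_pointsP[pg ig] j.
have pc : polyfunmx setT (fun j (a : 'I_n -> Qp) => a j) (fun a => word x a).
  apply: (@polyfunmx_word _ _ x Qp Q0 setT _ _ _ (fun j a => a j) (@ratsetT Qp)) => i.
  exact: polyfun_coord.
have [l hl] := polyfunmx_continuous pc (fun j => alpha j g) 0.
have /choice[mk hmk] : forall j, exists mk : nat * nat,
    padic_norm (alpha j g - mk.1%:R / p%:R ^+ mk.2) < p%:R ^- l.
  by move=> i; have [m [k h]] := padic_approx (alpha i g) (pX_gt0 p_pr l); exists (m, k).
pose a (i : 'I_n) : Qp := (mk i).1%:R / p%:R ^+ (mk i).2.
have ca : closemx 0 g (word x a).
  by rewrite -{1}(wordK pg); apply: hl => i; exact/ltW/hmk.
have ia : intpt (word x a).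
  move=> r s; apply: (close_norm _ (close_sym (ca r s))) (ig r s).
  by rewrite expr0 invr1.
have /choice[c hc] : forall rs : 'I_N * 'I_N, exists m : int, word x a rs.1 rs.2 = m%:~R.
  by move=> rs; apply: pfrac_integral; [exact: pfrac_word | exact: ia].
have wE : word x a = map_mx intr (\matrix_(r, s) c (r, s)).
  by apply/matrixP => r s; rewrite !mxE -hc.
have ph : points G int (\matrix_(r, s) c (r, s)).
  apply: (points_map_inj (f := (intr : {rmorphism int -> Qp})) (intr_inj_char0 Q0)).
  rewrite -wE; exact: points_word.
have hG : @embed_term G n x Qp n (word x a).
  by apply/(embed_term_full x_basis); exists (\matrix_(r, s) c (r, s)).
have [b _ ab] := embed_word x_basis Q0 (leqnn n) hG.
have aj : padic_norm (a j) <= 1.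
  by rewrite -alphaK ab alphaK padic_norm_int_le1.
apply: (close_norm (k := l) _ _ aj); last exact/ltW/hmk.
by rewrite -[leRHS]invr1 -[X in _ <= X^-1](expr0 (p%:R : rat)) pX_le.
Qed.

Lemma basis_power_integral (i : 'I_n) t : padic_norm t <= 1 ->
  Zp_points G p_pr (mxpower (map_mx intr (x i)) t).
Proof.
move=> t1; apply/Zp_pointsP; split; last by apply: intpt_power => //; exact: intpt_emb.
by apply: points_power => //; apply: points_map; exact: basis_points.
Qed.

End IntegralCoordinates.

(** * Indices and transversals *)

Section Index.
Context (S : comUnitRingType) (N : nat).
Implicit Types (H K : set 'M[S]_N).

Definition is_transversal H K (T : finType) (s : T -> 'M[S]_N) :=
  (forall t, H (s t)) /\ forall g, H g -> exists! t, K (invmx (s t) *m g).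

Lemma index_transversal (R : realType) H K (T : finType) (s : T -> 'M[S]_N) :
  is_subgroup H -> is_subgroup K -> is_transversal H K s ->
  Defs.index R H K = (#|T|%:R)%:E.
Proof.
move=> [Hu H1 HM HV] [Ku K1 KM KV] [Hs sU].
pose f t : set 'M[S]_N := [set s t *m k | k in K].
have us t : s t \in unitmx by exact: Hu.
have fP t g : f t g <-> K (invmx (s t) *m g).
  split=> [[k Kk <-]|h]; first by rewrite mulKmx.
  by exists (invmx (s t) *m g) => //; rewrite mulKVmx.
have finj : injective f.
  move=> t t' e; have [u [_ uu]] := sU _ (Hs t).
  have /uu <- : K (invmx (s t) *m s t) by rewrite mulVmx.
  by apply: uu; apply/fP; rewrite -e; apply/fP; rewrite mulVmx.
have cosE : left_cosets H K = f @` [set: T].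
  apply/seteqP; split=> [_ [g Hg <-]|_ [t _ <-]]; last by exists (s t).
  have [t [Kt _]] := sU _ Hg; exists t => //; apply/seteqP; split=> h.
    move=> [k Kk <-]; exists (invmx g *m s t *m k); last first.
      by rewrite mulmxA mulKVmx// Hu.
    apply: KM => //; have -> : invmx g *m s t = invmx (invmx (s t) *m g).
      by apply: invmx_eq; rewrite mulmxA mulmxK ?mulVmx// Hu.
    exact: KV.
  move=> [k Kk <-]; exists (invmx (s t) *m g *m k); first exact: KM.
  by rewrite !mulmxA mulmxV// mul1mx.
rewrite /Defs.index cosE /counting asboolT; last exact/finite_image/finite_finset.
rewrite fset_set_image; last exact: finite_finset.
rewrite finmap.card_imfset//=; congr (_%:R%:E).
rewrite cardE; apply/perm_size/uniq_perm; rewrite ?enum_uniq ?finmap.fset_uniq//.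
move=> t; rewrite mem_enum; apply/idP; rewrite in_fset_set ?inE//.
exact: finite_finset.
Qed.

(** Pigeonhole: two of the cosets of the powers of [g] coincide. *)
Lemma finite_index_power (R : realType) H K g :
  is_subgroup H -> is_subgroup K -> (Defs.index R H K < +oo)%E -> H g ->
  exists2 m, (0 < m)%N & K (g ^+ m).
Proof.
move=> sH [Ku K1 KM KV] fin Hg; have [Hu _ _ _] := sH.
have ug j : g ^+ j \in unitmx by apply: Hu; exact: subgroupX.
pose f j : set 'M[S]_N := [set g ^+ j *m k | k in K].
have /finite_seqP[s sE] : finite_set (left_cosets H K).
  by move: fin; rewrite /Defs.index /counting; case: asboolP.
have fs j : f j \in s.
  have : left_cosets H K (f j) by exists (g ^+ j) => //; exact: subgroupX.
  by rewrite sE.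
have [i [j [ij fij]]] : exists i j, (i < j)%N /\ f i = f j.
  pose l := [seq f i | i <- iota 0 (size s).+1].
  have /negP nu : ~~ uniq l.
    apply/negP => ul; have /(uniq_leq_size ul) : {subset l <= s}.
      by move=> _ /mapP[i _ ->].
    by rewrite size_map size_iota ltnn.
  apply: contrapT => h; apply: nu; rewrite map_inj_uniq ?iota_uniq// => i j fij.
  case: (ltngtP i j) => // ij; exfalso; apply: h; first by exists i, j.
  by exists j, i.
have : f j (g ^+ j) by exists 1%:M => //; rewrite mulmx1.
rewrite -fij => -[k Kk e]; exists (j - i)%N; first by rewrite subn_gt0.
suff <- : k = g ^+ (j - i) by [].
have -> : g ^+ (j - i) = invmx (g ^+ i) *m g ^+ j.
  by rewrite -{2}(subnKC (ltnW ij)) exprD mulKmx.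
by rewrite -e mulKmx.
Qed.

Lemma invmxM (g h : 'M[S]_N) : g \in unitmx -> h \in unitmx ->
  invmx (g *m h) = invmx h *m invmx g.
Proof. by move=> ug uh; symmetry; apply: invmx_eq; rewrite !mulmxA mulmxK// mulmxV. Qed.

(** One layer of the count, for abstract groups F0 < F1. Writing h = g^m h0 k with [h0] in F0, the
    transversal below supplies a representative of [h0]; only the existence ([decomp]) and the
    uniqueness ([separate]) of [m] are left to arithmetic. *)
Lemma is_transversal_extend H K (F0 F1 : set 'M[S]_N) r g (T : finType) (s : T -> 'M[S]_N) :
  is_subgroup H -> is_subgroup K -> is_subgroup F0 -> is_subgroup F1 ->
  K `<=` H -> F0 `<=` F1 -> H g -> F1 g ->
  (forall h, H h -> F1 h -> exists m : 'I_r, exists k,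
    [/\ K k, F1 k & F0 (invmx (g ^+ m) *m h *m invmx k)]) ->
  (forall (m m' : 'I_r) a b h, F0 a -> F0 b -> F1 h ->
    K (invmx (g ^+ m *m a) *m h) -> K (invmx (g ^+ m' *m b) *m h) -> m = m') ->
  is_transversal (H `&` F0) (K `&` F0) s ->
  is_transversal (H `&` F1) (K `&` F1) (fun mt : 'I_r * T => g ^+ mt.1 *m s mt.2).
Proof.
move=> sH sK sF0 sF1 KH F01 Hg F1g decomp separate [Hs sU].
have [Hu _ HM HV] := sH; have [_ _ KM KV] := sK.
have [_ _ F0M F0V] := sF0; have [_ _ F1M F1V] := sF1.
have HX m : H (g ^+ m) by exact: subgroupX.
have F1X m : F1 (g ^+ m) by exact: subgroupX.
have F0s t : F0 (s t) by have [] := Hs t.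
have invs mt : invmx (g ^+ (mt.1 : 'I_r) *m s mt.2) = invmx (s mt.2) *m invmx (g ^+ mt.1).
  by apply: invmxM; [exact/Hu/HX | apply: Hu; have [] := Hs mt.2].
split=> [mt|h [Hh F1h]].
  by split; [apply: HM => //; have [] := Hs mt.2 | apply: F1M => //; exact/F01/F0s].
have [m [k [Kk F1k F0h]]] := decomp h Hh F1h.
have uk : k \in unitmx by exact/Hu/KH.
pose h0 := invmx (g ^+ m) *m h *m invmx k; rewrite -/h0 in F0h.
have Hh0 : H h0 by apply: (HM); [apply: HM => //; exact: HV | exact/HV/KH].
have [t [[Kt F0t] tU]] := sU h0 (conj Hh0 F0h).
exists (m, t); split.
  have -> : invmx (g ^+ (m, t).1 *m s (m, t).2) *m h = invmx (s t) *m h0 *m k.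
    by rewrite invs /h0 !mulmxA mulmxKV.
  by split; [exact: KM | apply: F1M => //; exact: F01].
move=> [m' t'] [K' F1'].
have mm' : m = m'.
  have K1 : K (invmx (g ^+ m *m s t) *m h).
    rewrite (invs (m, t)) (_ : _ *m h = invmx (s t) *m h0 *m k); first exact: KM.
    by rewrite /h0 !mulmxA mulmxKV.
  exact: (separate _ _ _ _ _ (F0s t) (F0s t') F1h K1 K').
rewrite -mm' in K' F1' *; congr (_, _); apply: tU.
have -> : invmx (s t') *m h0 = invmx (g ^+ (m, t').1 *m s (m, t').2) *m h *m invmx k.
  by rewrite invs /h0 !mulmxA.
split; first by apply: KM => //; exact: KV.
suff <- : invmx (s t') *m h0 = invmx (g ^+ (m, t').1 *m s (m, t').2) *m h *m invmx k.
  by apply: F0M => //; exact: F0V.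
by rewrite invs /h0 !mulmxA.
Qed.

End Index.

(** * Good bases *)

Lemma subgroupI (S : comUnitRingType) N (H K : set 'M[S]_N) :
  is_subgroup H -> is_subgroup K -> is_subgroup (H `&` K).
Proof.
move=> [Hu H1 HM HV] [Ku K1 KM KV]; split=> //.
- by move=> g [/Hu].
- by move=> g h [? ?] [? ?]; split; [exact: HM|exact: KM].
- by move=> g [? ?]; split; [exact: HV|exact: KV].
Qed.

Lemma sub_scaled_eq0 (F : fieldType) (z m c : F) : - (m * c) + z * c - (z - m) * c = 0.
Proof. by ring. Qed.

Section GoodBases.
Context (G : unipotent_Zgroup).
Local Notation N := (Defs.msize G).
Context (n : nat) (x : 'I_n -> 'M[int]_N) (x_basis : malcev_basis G x).
Context (p : nat) (p_pr : prime p).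
Local Notation Qp := (padic p_pr).
Let Q0 : [pchar Qp] =i pred0 := pchar_Qp p_pr.
Context (rq : {rmorphism rat -> Qp}).
Variable alpha : 'I_n -> 'M[Qp]_N -> Qp.
Hypothesis pa : forall j, polyfun (ratset Qp) (@mxentry Qp N) (alpha j).
Hypothesis aE : forall (a : 'I_n -> int) j, alpha j (word x (fun j => (a j)%:~R)) = (a j)%:~R.
Local Notation term := (term_points alpha).

Lemma points_subgroup_Qp : is_subgroup (points G Qp).
Proof. exact: points_subgroup. Qed.

Lemma term_points_subgroup k : is_subgroup (term k).
Proof.
split.
- by move=> g [/points_strict /strict_lower_unit].
- exact: (term_points1 Q0 pa aE).
- by move=> g h; exact: (term_pointsM x_basis Q0 rq pa aE).
- by move=> g; exact: (term_pointsV x_basis Q0 rq pa aE).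
Qed.

Lemma term_points_full : term n = points G Qp.
Proof.
apply/seteqP; split=> [g []//|g pg]; split=> // j.
by rewrite leqNgt ltn_ord.
Qed.

Lemma basis_powerE i t : basis_power x i (t : Qp) = mxpower (map_mx intr (x i)) t.
Proof. exact: unipotent_powerE. Qed.

Lemma padic_wordE (a : 'rV[Qp]_n) : padic_word x a = word x (fun i => a ord0 i).
Proof. by apply: eq_bigr => i _; exact: basis_powerE. Qed.

Local Notation filt := (@padic_filtration G p p_pr n x).

Lemma padic_filtrationE (i : 'I_n) : filt i = term i.+1.
Proof.
apply/seteqP; split.
  apply: (generated_sub (term_points_subgroup _)) => _ [j ji [t ->]].
  rewrite basis_powerE; exact: (term_points_basis_power x_basis Q0 pa aE).
move=> g [pg g0]; rewrite -(word_alpha x_basis Q0 rq pa aE pg).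
have sub : is_subgroup (filt i).
  apply: (generated_subgroup points_subgroup_Qp) => _ [j ji [t ->]].
  rewrite basis_powerE; apply: (points_power Q0); apply: points_map.
  exact: basis_points x_basis j.
have [_ s1 sM _] := sub.
rewrite /word; apply: (big_ind (filt i)) => // j _.
have [ji|ij] := leqP j i; last by rewrite g0// mxpower0.
by rewrite -basis_powerE; apply: sub_generated; exists j => //; exists (alpha j g).
Qed.

(** [alpha i] maps the part of [H] in G_(i+1) onto Z_p kappa_i, stated as two inclusions. Only the
    diagonal of a good basis is retained, so that G(Z_p), for which no matrix is given, fits in with
    kappa = 1. *)
Definition diag_basis (H : set 'M[Qp]_N) (kappa : 'I_n -> Qp) := forall i : 'I_n,
  (forall g, H g -> term i.+1 g -> padic_norm (alpha i g) <= padic_norm (kappa i)) /\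
  (forall t, padic_norm t <= 1 -> exists g, [/\ H g, term i.+1 g & alpha i g = t * kappa i]).

(** On the abstract group generated by h_0, ..., h_i the values of [alpha i] are the integer
    multiples of the diagonal entry, and the resulting norm bound passes to the closure. Conversely,
    the closure contains the Z_p-powers of h_i, which realize all of Z_p times that entry. *)
Lemma good_basis_diag H (A : 'M[Qp]_n) : is_trig_mx A -> H `<=` points G Qp ->
  good_basis x H (fun i => padic_word x (row i A)) -> diag_basis H (fun i => A i i).
Proof.
move=> /is_trig_mxP tA HG [Hh hB] i.
pose h (j : 'I_n) : 'M[Qp]_N := padic_word x (row j A).
have hE j : h j = word x (fun l => A j l).
  by rewrite /h padic_wordE; congr (word x _); apply/funext => l; rewrite mxE.
have ht (j : 'I_n) k : (j < k)%N -> term k (h j).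
  move=> jk; rewrite hE; apply: (term_points_word x_basis Q0 pa aE) => l kl.
  by apply: tA; exact: leq_trans kl.
have ah j l : alpha l (h j) = A j l by rewrite hE (alpha_word Q0 pa aE).
pose X : set 'M[Qp]_N := [set h j | j in [set j : 'I_n | (j <= i)%N]].
have XG : X `<=` points G Qp by move=> _ [j _ <-]; exact: (HG _ (Hh j)).
have sX : is_subgroup (generated X) := generated_subgroup points_subgroup_Qp XG.
have gXG : generated X `<=` points G Qp := generated_sub points_subgroup_Qp XG.
have hi := hB i; rewrite padic_filtrationE -/h -/X in hi.
split=> [g Hg tg|t t1].
  have : closure_in_G (generated X) g by rewrite hi; split.
  move=> [/closure_mxP cg pg].
  have sK : is_subgroup [set g | term i.+1 g /\ exists m : int, alpha i g = m%:~R * A i i].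
    have [tu t1 tM tV] := term_points_subgroup i.+1; split.
    - by move=> u [/tu].
    - by split=> //; exists 0; rewrite mul0r (alpha1 Q0 pa aE).
    - move=> u v [tu' [m um]] [tv [l vl]]; split; first exact: tM.
      exists (m + l); rewrite (top_alphaM x_basis Q0 rq pa aE tu' tv) um vl.
      by rewrite rmorphD mulrDl.
    - move=> u [tu' [m um]]; split; first exact: tV.
      exists (- m); rewrite (top_alphaV x_basis Q0 rq pa aE tu') um.
      by rewrite rmorphN mulNr.
  have gK := generated_sub sK (X := X).
  have {gK} gK u : generated X u -> padic_norm (alpha i u) <= padic_norm (A i i).
    move=> /gK[|_ [m ->]]; last first.
      by rewrite padic_normM ler_piMl ?padic_norm_ge0// padic_norm_int_le1.
    move=> _ [j ji <-]; split; first exact: ht.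
    have [<-|ne] := eqVneq j i; first by exists 1; rewrite ah mul1r.
    by exists 0; rewrite ah mul0r tA// ltn_neqAle ne.
  (* If the bound failed at [g], an element of the generated group closer to [g] than the size of
     its coordinate would violate the bound as well. *)
  rewrite leNgt; apply/negP => lt.
  have n0 : 0 < padic_norm (alpha i g) := le_lt_trans (padic_norm_ge0 _) lt.
  have [k hk] := pX_small p_pr n0.
  have [l hl] := polyfun_continuous (polyfunW (@ratsetT Qp) (pa i)) g k.
  have [u Xu gu] := cg l.
  have au : close k (alpha i g) (alpha i u) by apply: hl => -[a b]; exact: gu.
  pose e := Num.max (p%:R ^- k : rat) (padic_norm (A i i)).
  have : padic_norm (alpha i g) <= e.
    apply: (close_norm _ au); first by rewrite le_max lexx.
    by rewrite le_max gK// orbT.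
  by rewrite le_max leNgt hk /= leNgt lt.
have Xhi : X (h i) := ex_intro2 _ _ i (leqnn i) erefl.
have gh : generated X (h i) := sub_generated Xhi.
have ph : points G Qp (h i) := HG _ (Hh i).
have thi : term i.+1 (h i) by exact: ht.
have ppow : points G Qp (mxpower (h i) t) by exact: (points_power Q0).
have : closure_in_G (generated X) (mxpower (h i) t).
  exact: (closure_in_G_power sX gh ph ppow t1).
rewrite hi => -[Hp tp]; exists (mxpower (h i) t); split=> //.
by rewrite (top_alpha_power x_basis Q0 rq pa aE t thi) ah.
Qed.

Section Count.
Variables (H L : set 'M[Qp]_N) (kappa lambda : 'I_n -> Qp) (e : 'I_n -> nat).
Hypothesis (sH : is_subgroup H) (sL : is_subgroup L) (LH : L `<=` H) (HG : H `<=` points G Qp).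
Hypothesis (bH : diag_basis H kappa) (bL : diag_basis L lambda).
Hypothesis (k0 : forall i, kappa i != 0).
Hypothesis (eE : forall i, padic_norm (lambda i) = padic_norm (kappa i) * p%:R ^- e i).

Let nk i : 0 < padic_norm (kappa i).
Proof. by rewrite lt_def padic_norm_eq0 k0 padic_norm_ge0. Qed.

(** The layer contributes the quotient of Z_p kappa by Z_p lambda, which is cyclic of order p^e and
    generated by the image of an element with coordinate kappa. *)
Lemma transversal_step (i : 'I_n) (T : finType) (s : T -> 'M[Qp]_N) :
  is_transversal (H `&` term i) (L `&` term i) s ->
  exists s' : 'I_(p ^ e i) * T -> 'M[Qp]_N,
    is_transversal (H `&` term i.+1) (L `&` term i.+1) s'.
Proof.
have st := term_points_subgroup i.+1; have [_ _ tM tV] := st.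
have up : term i `<=` term i.+1 by move=> g; exact: term_pointsS.
have ai0 g : term i g -> alpha i g = 0 by move=> [_]; apply.
have aM g h : term i.+1 g -> term i.+1 h -> alpha i (g *m h) = alpha i g + alpha i h.
  exact: (top_alphaM x_basis Q0 rq pa aE).
have aV g : term i.+1 g -> alpha i (invmx g) = - alpha i g.
  exact: (top_alphaV x_basis Q0 rq pa aE).
have [|g1 [Hg1 tg1 ag1]] := (bH i).2 1; first by rewrite padic_norm1.
rewrite mul1r in ag1.
have tX m : term i.+1 (g1 ^+ m) := subgroupX m st tg1.
have aX m : alpha i (g1 ^+ m) = m%:R * kappa i.
  by rewrite (top_alphaX x_basis Q0 rq pa aE m tg1) ag1.
have lam0 : lambda i != 0.
  by rewrite -padic_norm_eq0 eE mulf_neq0 ?padic_norm_eq0// gt_eqF// pX_gt0.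
move=> ts; eexists; apply: (is_transversal_extend sH sL (term_points_subgroup i) st LH up Hg1 tg1 _ _ ts).
  move=> g Hg tg; pose z := alpha i g / kappa i.
  have zE : alpha i g = z * kappa i by rewrite /z divfK.
  have z1 : padic_norm z <= 1.
    by rewrite padic_normM padic_normV ler_pdivrMr// mul1r; exact: (bH i).1.
  have [zz zzE] := padic_norm_le1P z1.
  have zm : padic_norm (z - (zz (e i))%:R) <= p%:R ^- e i by rewrite zzE; exact: Zp_approx.
  (* With m the residue of z modulo p^e, the rest (z - m) kappa lies in Z_p lambda, so an element of
     [L] has exactly this coordinate and corrects [g]. *)
  have [|l [Ll tl al]] := (bL i).2 ((z - (zz (e i))%:R) * kappa i / lambda i).
    rewrite padic_normM padic_normV padic_normM eE ler_pdivrMr ?mul1r.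
      by rewrite mulrC ler_pM2l.
    by rewrite mulr_gt0// pX_gt0.
  rewrite divfK// in al.
  have tV1 := tV _ (tX (zz (e i))); have tVl := tV _ tl.
  have t2 := tM _ _ tV1 tg.
  have E1 := aM _ _ t2 tVl; have E2 := aM _ _ tV1 tg.
  have E3 := aV _ (tX (zz (e i))); have E4 := aV _ tl; have E5 := aX (zz (e i)).
  have E := etrans E1 (congr2 +%R (etrans E2 (congr2 +%R (etrans E3 (congr1 -%R E5)) zE))
    (etrans E4 (congr1 -%R al))).
  have {}E := etrans E (sub_scaled_eq0 _ _ _).
  exists (Ordinal (residue_lt zz (e i))), l; split; [exact: Ll|exact: tl|].
  have [pg0 g0] := tM _ _ t2 tVl; split; first exact: pg0.
  move=> j; rewrite leq_eqVlt => /predU1P[/val_inj <-|]; last exact: g0.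
  exact: E.
move=> m m' a b g ta tb tg Lm Lm'.
(* A representative with exponent k determines k kappa modulo Z_p lambda. Two exponents for the same
   element thus differ by a multiple of p^e, and both are below p^e. *)
have main c (k : 'I_(p ^ e i)) : term i c -> L (invmx (g1 ^+ k *m c) *m g) ->
    padic_norm (alpha i g - k%:R * kappa i) <= padic_norm (lambda i).
  move=> tc Lk; have tkc : term i.+1 (g1 ^+ k *m c) := tM _ _ (tX k) (up _ tc).
  have tV' := tV _ tkc; have h := (bL i).1 _ Lk (tM _ _ tV' tg).
  have E1 := aM _ _ (tX k) (up _ tc); have E2 := aM _ _ tV' tg.
  have E := etrans E2 (congr2 +%R (etrans (aV _ tkc) (congr1 -%R (etrans E1
    (congr2 +%R (aX k) (ai0 _ tc))))) erefl).
  by rewrite E addr0 addrC in h.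
have := padic_norm_sum_le (main _ _ tb Lm'); move/(_ (- (alpha i g - m%:R * kappa i))).
rewrite padic_normN => /(_ (main _ _ ta Lm)).
rewrite opprB addrC addrA subrK -mulrBl padic_normM eE mulrC ler_pM2l//.
have -> : (m : nat)%:R - (m' : nat)%:R = ((m : nat)%:Z - (m' : nat)%:Z)%:~R :> Qp.
  by rewrite rmorphB.
move=> /padic_norm_int_dvd dv; apply: val_inj => /=; apply/eqP.
have : (`|(m : nat)%:Z - (m' : nat)%:Z|%N < p ^ e i)%N.
  have := ltn_ord m; have := ltn_ord m'; move: (m : nat) (m' : nat) => u v hv hu.
  case: (leqP v u) => uv; first by rewrite subzn// absz_nat (leq_ltn_trans (leq_subr _ _)).
  by rewrite -abszN opprB subzn ?(ltnW uv)// absz_nat (leq_ltn_trans (leq_subr _ _)).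
move: dv; rewrite /dvdn => /eqP dv lt; move: dv; rewrite modn_small// => /eqP.
by rewrite absz_eq0 subr_eq0 eqz_nat.
Qed.

Lemma transversal_exists k : (k <= n)%N -> exists (T : finType) (s : T -> 'M[Qp]_N),
  is_transversal (H `&` term k) (L `&` term k) s /\
  #|T| = (\prod_(i < n | (i < k)%N) p ^ e i)%N.
Proof.
elim: k => [|k IH] kn.
  exists 'I_1, (fun=> 1); split; last by rewrite card_ord big1.
  have [_ H1 _ _] := sH; have [_ L1 _ _] := sL.
  have t1 := term_points1 Q0 pa aE 0; split=> [_|g [Hg tg]]; first by split.
  have g1 : g = 1.
    have [pg g0] := tg; rewrite -(word_alpha x_basis Q0 rq pa aE pg).
    by rewrite (@word0 _ _ x Qp (fun j => alpha j g))// => j; rewrite g0.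
  exists ord0; split=> [|t _]; last by rewrite [t]ord1.
  by rewrite g1 mulVmx ?unitmx1.
have [T [s [ts cT]]] := IH (ltnW kn).
have [s' ts'] := @transversal_step (Ordinal kn) T s ts.
exists ('I_(p ^ e (Ordinal kn)) * T)%type, s'; split=> //.
rewrite card_prod card_ord cT [RHS](bigD1 (Ordinal kn))//=; congr (_ * _)%N.
apply: eq_bigl => j; rewrite ltnS -val_eqE /= [RHS]andbC.
by rewrite ltn_neqAle.
Qed.

Lemma index_diag_basis (R : realType) :
  Defs.index R H L = (\prod_(i < n) (p%:R : R) ^+ e i)%:E.
Proof.
have [T [s [ts cT]]] := transversal_exists (leqnn n).
rewrite term_points_full in ts.
have HE : H `&` points G Qp = H by apply: setIidl.
have LE : L `&` points G Qp = L by apply: setIidl => g /LH /HG.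
rewrite HE LE in ts; rewrite (index_transversal R sH sL ts) cT.
rewrite natr_prod; congr (_%:E); apply: eq_big => i; first by rewrite ltn_ord.
by rewrite natrX.
Qed.

End Count.
End GoodBases.

(** * Conclusion *)

Lemma subgroup_map (S S' : comUnitRingType) N (f : {rmorphism S -> S'}) (H : set 'M[S]_N) :
  is_subgroup H -> is_subgroup [set map_mx f g | g in H].
Proof.
move=> [Hu H1 HM HV]; split.
- move=> _ [g /Hu /= ug <-]; rewrite /= unitmxE det_map_mx rmorph_unit//.
- by exists 1%:M => //; rewrite map_mx1.
- by move=> _ _ [g Hg <-] [h Hh <-]; exists (g *m h); [exact: HM | rewrite map_mxM].
- move=> _ [g Hg <-]; exists (invmx g); first exact: HV.
  by rewrite map_mx_inv//; exact: (Hu _ Hg).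
Qed.

Lemma subgroup_preimage (E F : fieldType) N (f : {rmorphism E -> F}) (H : set 'M[F]_N) :
  is_subgroup H -> is_subgroup [set g | H (map_mx f g)].
Proof.
move=> [Hu H1 HM HV]; split.
- by move=> g /Hu; rewrite /= map_unitmx.
- by rewrite /= map_mx1.
- by move=> g h /= Hg Hh; rewrite map_mxM; exact: HM.
- by move=> g /= Hg; rewrite map_invmx; exact: HV.
Qed.

(** In the extended reals 0 times infinity is 0. Finiteness of the product of two indices bounds the
    second only because the first is positive. *)
Lemma left_coset_index_gt0 (R : realType) (S : comUnitRingType) N (H K : set 'M[S]_N) :
  is_subgroup H -> (0 < Defs.index R H K)%E.
Proof.
move=> [_ H1 _ _]; rewrite /Defs.index /counting; case: asboolP => [fin|]; last by [].
rewrite lte_fin ltr0n finmap.cardfs_gt0; apply/eqP => e0.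
have : left_cosets H K [set 1%:M *m k | k in K] by exists 1%:M.
have := @fset_set0 (set 'M[S]_N); rewrite -e0 => /(fset_set_inj _ fin) E.
by rewrite -E.
Qed.

Lemma comm_index_finite_power (R : realType) (S : comUnitRingType) N (H K : set 'M[S]_N) g :
  is_subgroup H -> is_subgroup K -> (comm_index R H K < +oo)%E -> K g ->
  exists2 m, (0 < m)%N & H (g ^+ m).
Proof.
move=> sH sK fin Kg; have sI := subgroupI sH sK.
have [|m m0 []] := @finite_index_power S N R K (H `&` K) g sK sI _ Kg; last by exists m.
have := left_coset_index_gt0 R (H `&` K) sH; move: fin; rewrite /comm_index.
case: (Defs.index R K _) => [r _ _|fin h|_ _]; rewrite ?ltry ?ltNyr//.
by rewrite gt0_muley// in fin.
Qed.

Section PadicClosure.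
Context (R : realType) (G : unipotent_Zgroup).
Local Notation N := (Defs.msize G).
Context (n : nat) (x : 'I_n -> 'M[int]_N) (x_basis : malcev_basis G x).
Context (p : nat) (p_pr : prime p).
Local Notation Qp := (padic p_pr).
Let Q0 : [pchar Qp] =i pred0 := pchar_Qp p_pr.
Context (Delta : set 'M[R]_N) (Delta_lattice : arithmetic_lattice G Delta).

Definition padic_image : set 'M[Qp]_N :=
  [set map_mx ratr g | g in [set g : 'M[rat]_N | Delta (map_mx ratr g)]].

Lemma padic_image_subgroup : is_subgroup padic_image.
Proof.
have [sD _ _] := Delta_lattice; have [rq rqE] := ratr_char0_exists Q0.
have E : padic_image = [set map_mx rq g | g in [set g : 'M[rat]_N | Delta (map_mx ratr g)]].
  have mE (g : 'M[rat]_N) : map_mx ratr g = map_mx rq g.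
    by apply/matrixP => i j; rewrite !mxE rqE.
  by apply/seteqP; split=> _ [g Dg <-]; exists g.
rewrite E; apply: subgroup_map.
exact: (@subgroup_preimage rat R N ratr).
Qed.

Lemma padic_image_points : padic_image `<=` points G Qp.
Proof.
have [_ DG _] := Delta_lattice; have [rq rqE] := ratr_char0_exists Q0.
move=> _ [g /DG pg <-].
have -> : map_mx ratr g = map_mx rq g by apply/matrixP => i j; rewrite !mxE rqE.
by apply: points_map; apply: (points_map_inj (f := ratr) (fmorph_inj _) pg).
Qed.

Lemma padic_closure_subgroup : is_subgroup (padic_closure G p_pr Delta).
Proof. exact: closure_in_G_subgroup padic_image_subgroup padic_image_points. Qed.

Lemma padic_closure_points : padic_closure G p_pr Delta `<=` points G Qp.
Proof. by move=> g []. Qed.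

(** Commensurability puts a power of each basis element into Delta; this is what makes the diagonals
    of both matrices nonzero. *)
Lemma padic_closure_power j : exists2 m, (0 < m)%N &
  padic_closure G p_pr Delta (map_mx intr (x j) ^+ m).
Proof.
have [sD DG fin] := Delta_lattice.
have sI : is_subgroup [set map_mx (intr : int -> R) g | g in points G int].
  exact: (@subgroup_map int R N intr _ (points_int_subgroup G)).
have [|m m0 Dm] := comm_index_finite_power (g := map_mx intr (x j)) sD sI fin.
  by exists (x j) => //; exact: basis_points.
exists m => //; apply: (sub_closure_in_G padic_image_points).
exists (map_mx intr (x j) ^+ m).
  rewrite /= map_mxX_sq (_ : map_mx ratr _ = map_mx intr (x j))//.
  by apply/matrixP => a b; rewrite !mxE ratr_int.
have [rq rqE] := ratr_char0_exists Q0.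
have mE (g : 'M[rat]_N) : map_mx ratr g = map_mx rq g.
  by apply/matrixP => a b; rewrite !mxE rqE.
rewrite mE map_mxX_sq; congr (_ ^+ m).
by apply/matrixP => a b; rewrite !mxE rmorph_int.
Qed.

Lemma Zp_points_subgroup : is_subgroup (Zp_points G p_pr).
Proof.
split.
- by move=> g /Zp_pointsP[/points_strict /strict_lower_unit].
- by apply/Zp_pointsP; split; [exact: points1 Q0 | exact: intpt1].
- move=> g h /Zp_pointsP[pg ig] /Zp_pointsP[ph ih]; apply/Zp_pointsP.
  by split; [exact: (pointsM Q0 pg ph) | exact: (intptM ig ih)].
- move=> g /Zp_pointsP[pg ig]; apply/Zp_pointsP; split; first exact: (pointsV Q0 pg).
  rewrite (invmx_power Q0 (points_strict pg)); apply: intpt_power => //.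
  by rewrite padic_normN padic_norm1.
Qed.

End PadicClosure.

Theorem lemma3p10 (R : realType) (G : unipotent_Zgroup)
    (n : nat) (x : 'I_n -> 'M[int]_(msize G)) (x_basis : malcev_basis G x)
    (p : nat) (p_pr : prime p)
    (Delta : set 'M[R]_(msize G)) (Delta_lattice : arithmetic_lattice G Delta)
    (A : 'M[padic p_pr]_n) (B : 'M[padic_int p_pr]_n)
    (AB_good : good_pairs G p_pr x Delta (A, B)) :
  comm_index R (padic_closure G p_pr Delta) (Zp_points G p_pr)
  = (ratr (padic_norm (padic_of_int (\det B) ^+ 2 * (\det A)^-1))^-1)%:E.
Proof.
have [tA tB gA gB] := AB_good; rewrite /= in tA tB gA gB.
pose F := padic p_pr.
have Q0 : [pchar F] =i pred0 := pchar_Qp p_pr.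
have [rq _] := ratr_char0_exists Q0.
have [alpha pa aE] := coordinates_exist x_basis Q0.
set H := padic_closure G p_pr Delta; set K := Zp_points G p_pr.
have sH : is_subgroup H := padic_closure_subgroup p_pr Delta_lattice.
have sK : is_subgroup K := Zp_points_subgroup G p_pr.
have HG : H `<=` points G F := @padic_closure_points R G p p_pr Delta.
have KG : K `<=` points G F by move=> g /Zp_pointsP[].
have sL := subgroupI sH sK.
have LG : H `&` K `<=` points G F by move=> g [/HG].
have bH := good_basis_diag x_basis rq pa aE tA HG gA.
pose B' := map_mx (@padic_of_int p p_pr) B.
have tB' : is_trig_mx B'.
  by apply/is_trig_mxP => i j ij; rewrite mxE (is_trig_mxP tB)// rmorph0.
have gB' : good_basis x (H `&` K) (fun i => padic_word x (row i B')).
  have E : (fun i => padic_word x (row i B')) =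
      (fun i => padic_word x (map_mx (@padic_of_int p p_pr) (row i B))).
    by apply/funext => i; rewrite /B' map_row.
  by rewrite E.
have bL := good_basis_diag x_basis rq pa aE tB' LG gB'.
(* The coordinates of G(Z_p) are integral, and the Z_p-powers of x_i realize every value in Z_p. *)
have bK : diag_basis alpha K (fun=> 1).
  move=> i; split=> [g Kg tg|t t1].
    rewrite padic_norm1; apply: (alpha_integral x_basis _ _ Kg).
      exact: (word_alpha x_basis Q0 rq pa aE).
    exact: (alpha_word Q0 pa aE).
  exists (mxpower (map_mx intr (x i)) t); split.
  - exact: (basis_power_integral x_basis i t1).
  - exact: (term_points_basis_power x_basis Q0 pa aE).
  - by rewrite (alpha_basis_power Q0 pa aE) eqxx mulr1.
(* Some x_i^m with m > 0 lies in both groups; its coordinate m is bounded by either diagonal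
   entry. *)
have nz i : A i i != 0 /\ B' i i != 0.
  have [m m0 Hm] := padic_closure_power x_basis p_pr Delta_lattice i.
  have Km : K (map_mx intr (x i) ^+ m).
    apply/Zp_pointsP; split; first exact: HG.
    exact/intptX/intpt_emb.
  have pX : mxpower (map_mx intr (x i)) m%:R = map_mx intr (x i) ^+ m :> 'M[F]_(Defs.msize G).
    by apply: (mxpower_nat Q0); exact: (basis_strict x_basis).
  have tm : term_points alpha i.+1 (map_mx intr (x i) ^+ m).
    by rewrite -pX; exact: (term_points_basis_power x_basis Q0 pa aE).
  have am : alpha i (map_mx intr (x i) ^+ m) = m%:R.
    by rewrite -pX (alpha_basis_power Q0 pa aE) eqxx.
  have m1 : 0 < padic_norm (m%:R : F).
    rewrite lt_def padic_norm_eq0 padic_norm_ge0 andbT.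
    by move/pcharf0P: Q0 => ->; rewrite -lt0n.
  split; rewrite -padic_norm_eq0 gt_eqF//.
    by apply: (lt_le_trans m1); rewrite -am; exact: ((bH i).1).
  by apply: (lt_le_trans m1); rewrite -am; exact: ((bL i).1).
have np i : 0 < padic_norm (A i i).
  by rewrite lt_def padic_norm_eq0 (nz i).1 padic_norm_ge0.
(* The i-th diagonal entry of B is the coordinate of an element of cl(Delta), so its quotient by
   that of A lies in Z_p and its norm is a power of 1/p. *)
have /choice[eH heH] : forall i, exists e, padic_norm (B' i i) = padic_norm (A i i) * p%:R ^- e.
  move=> i; have [g [[Hg _] tg ag]] : exists g, [/\ (H `&` K) g, term_points alpha i.+1 g & alpha i g = 1 * B' i i].
    by apply: (bL i).2; rewrite padic_norm1.
  have le1 : padic_norm (B' i i / A i i) <= 1.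
    rewrite padic_normM padic_normV ler_pdivrMr// mul1r.
    by rewrite -[B' i i]mul1r -ag; exact: ((bH i).1).
  have [|e he] := padic_norm_pow _ le1; first by rewrite mulf_neq0 ?invr_eq0 ?(nz i).1 ?(nz i).2.
  exists e; rewrite -he padic_normM padic_normV mulrCA divff ?mulr1//.
  by rewrite gt_eqF.
have /choice[eK heK] : forall i, exists e, padic_norm (B' i i) = padic_norm (1 : F) * p%:R ^- e.
  move=> i; have B1 : padic_norm (B' i i) <= 1 by rewrite mxE padic_norm_toQ_le1.
  have [e he] := padic_norm_pow (nz i).2 B1.
  by exists e; rewrite he padic_norm1 mul1r.
have iH := index_diag_basis x_basis rq pa aE sH sL (@subIsetl _ _ _) HG bH bL (fun i => (nz i).1) heH R.
have iK := index_diag_basis x_basis rq pa aE sK sL (@subIsetr _ _ _) KG bK bL (fun i => oner_neq0 _) heK R.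
rewrite /comm_index iH iK -EFinM -big_split; congr (_%:E) => /=.
rewrite (det_trig tA) -det_map_mx (det_trig tB') -/B'.
rewrite padic_normM padic_normV padic_normX.
have nprod (f : 'I_n -> F) : padic_norm (\prod_i f i) = \prod_i padic_norm (f i).
  by apply: (big_morph _ (@padic_normM p p_pr)); rewrite padic_norm1.
(* It remains to compare factors: |b|^2 / |a| = p^-eH p^-eK, since |b| = |a| p^-eH and |b| =
   p^-eK. *)
rewrite !nprod -prodrXl -prodfV -big_split /= -prodfV rmorph_prod /=.
apply: eq_bigr => i _; rewrite expr2 {1}heH heK padic_norm1 mul1r.
have An : padic_norm (A i i) != 0 by rewrite gt_eqF.
have -> : padic_norm (A i i) * p%:R ^- eH i * p%:R ^- eK i / padic_norm (A i i) =
   p%:R ^- eH i * p%:R ^- eK i.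
  by rewrite mulrAC [_ * p%:R ^- eH i]mulrC mulfK// mulrC.
by rewrite invfM !invrK rmorphM !rmorphXn rmorph_nat.
Qed.
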